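(* Let $f$ be a nonsquare element of $\mathbb C(y)$ and let $g$ be the genus of the curve $x^2=f(y)$. Then $$\mathrm N_{\mathrm{Jonq}}(\mathbb T_f)^\circ=\mathbb T_f\rtimes\mathcal N_{\mathbb C(y)^*\rtimes\mathrm{PGL}_2}(\mathbb T_f)^\circ.$$ Moreover, the group $\mathcal N_{\mathbb C(y)^*\rtimes\mathrm{PGL}_2}(\mathbb T_f)^\circ$ is trivial if $g\ge1$ and isomorphic to $\mathbb C^*$ if $g=0$. Spelling out the details in the two cases: (1) $\mathrm N_{\mathrm{Jonq}}(\mathbb T_f)^\circ=\mathbb T_f$ if $g\ge1$; (2) $\mathrm N_{\mathrm{Jonq}}(\mathbb T_y)^\circ=\mathbb T_y\rtimes\mathbb T_{1,2}$.
   Context: $\mathrm{Bir}(\mathbb P^2)$ is the group of birational transformations of the complex projective plane, identified with $\mathrm{Bir}(\mathbb A^2)$ via $(x,y)\mapsto[x:y:1]$. $\mathrm{PGL}_2=\mathrm{PGL}_2(\mathbb C)$. Zariski topology. For an irreducible complex algebraic variety $A$, a morphism $A\to\mathrm{Bir}(\mathbb P^2)$ is a map $a\mapsto f_a$ arising from an $A$-birational map $f$ of $A\times\mathbb P^2$ that induces an isomorphism $U\to V$ between open subsets $U,V\subseteq A\times \mathbb P^2$ whose projections to $A$ are both surjective, where $f_a$ is $w\dashrightarrow p_2(f(a,w))$ and $p_2$ is the second projection. A subset $F\subseteq\mathrm{Bir}(\mathbb P^2)$ is closed if its preimage under every such morphism (for every $A$) is closed in $A$. For a subgroup $H$ with the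 induced topology, $H^\circ$ is the connected component of $H$ containing the identity. $\mathrm{Jonq}=\mathrm{PGL}_2(\mathbb C(y))\rtimes\mathrm{PGL}_2$ is the subgroup of maps $(x,y)\dashrightarrow\left(\frac{\alpha(y)x+\beta(y)}{\gamma(y)x+\delta(y)},\frac{ay+b}{cy+d}\right)$ with $\begin{pmatrix}\alpha&\beta\\ \gamma&\delta\end{pmatrix}\in\mathrm{PGL}_2(\mathbb C(y))$, $\begin{pmatrix}a&b\\ c&d\end{pmatrix}\in\mathrm{PGL}_2$; the factor $\mathrm{PGL}_2(\mathbb C(y))$ consists of those maps with second component $y$. For a nonsquare $f\in\mathbb C(y)$, $\mathbb T_f=\left\{\begin{pmatrix}a&bf\\ b&a\end{pmatrix}: a,b\in\mathbb C(y),\ (a,b)\neq(0,0)\right\}\subseteq\mathrm{PGL}_2(\mathbb C(y))$; $\mathbb T_y$ is the case $f=y$. $\mathbb T_{1,2}=\{(tx,t^2y):t\in\mathbb C^*\}$. $\mathrm N_{\mathrm{Jonq}}(\mathbb T_f)$ is the normaliser of $\mathbb T_f$ in $\mathrm{Jonq}$. $\mathbb C(y)^*\rtimes\mathrm{PGL}_2\subseteq\mathrm{Jonq}$ is the subgroup of transformations $(\lambda(y)x,\mu(y))$ with $\lambda\in\mathbb C(y)^*$, $\mu\in\mathrm{PGL}_2$, and $\mathcal N_{\mathbb C(y)^*\rtimes\mathrm{PGL}_2}(\mathbb T_f)$ is the subgroup of those $\varphi\in\mathbb C(y)^*\rtimes\mathrm{PGL}_2$ with $\varphi\mathbb T_f\varphi^{-1}=\mathbb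 T_f$. Semidirect products are inner: $G=N\rtimes H$ means that $N,H$ are subgroups of $G$, $N$ is normal in $G$, $G=NH$ and $N\cap H=\{1\}$. The genus of the curve $x^2=f(y)$ means the genus of the smooth projective curve with function field $\mathbb C(y)[\sqrt f]$. *)

(* Defs.v *)
From HB Require Import structures.
(* The notations of mpoly clash with those of topology. *)
From mathcomp Require Import -(notations) mpoly.
From mathcomp Require Import all_boot all_order all_algebra all_field.
From mathcomp Require Import generic_quotient fraction.
From mathcomp Require Import all_classical all_reals.
From mathcomp Require Import topology complex.

Set Implicit Arguments.
Unset Strict Implicit.
Unset Printing Implicit Defensive.

Import GRing.Theory.
Local Open Scope classical_set_scope.
Local Open Scope quotient_scope.
Local Open Scope ring_scope.

(* Varieties are spaces with functions: a Zariski topology together with a    *)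
(* sheaf of k-valued functions, recorded by its germs. [regular_at x h] says  *)
(* that h is regular on some neighbourhood of x, so that the sections over an *)
(* open set U are the h that are regular at every point of U.                 *)
Record spaceFun (k : fieldType) := SpaceFun {
  space_sort :> topologicalType;
  regular_at : space_sort -> (space_sort -> k) -> Prop }.

Section SpaceFun.
Variable k : fieldType.
Implicit Types X Y : spaceFun k.

Definition morphism_at X Y (f : X -> Y) (x : X) : Prop :=
  continuous_at x f /\
  forall h : Y -> k, regular_at (f x) h -> regular_at x (h \o f).

(* f restricts to an isomorphism U -> V with inverse g; the values of f       *)
(* outside U and of g outside V are irrelevant.                               *)
Definition open_iso X Y (U : set X) (V : set Y) (f : X -> Y) (g : Y -> X) :=
  [/\ open U, open V,
      forall x, U x -> [/\ V (f x), g (f x) = x & morphism_at f x] &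
      forall y, V y -> [/\ U (g y), f (g y) = y & morphism_at g y]].

Definition irreducible (T : topologicalType) : Prop :=
  [set: T] !=set0 /\
  forall U V : set T, open U -> open V -> U !=set0 -> V !=set0 ->
    U `&` V !=set0.

(* The topology of the product is not the product topology: its open sets are *)
(* generated by the nonvanishing loci of the functions \sum_i f_i(x) g_i(y).  *)
Definition prod_sort X Y : Type := (X * Y)%type.

Definition prod_basic X Y : set (set (prod_sort X Y)) :=
  [set W | exists (U : set X) (V : set Y) (n : nat)
                  (f : 'I_n -> X -> k) (g : 'I_n -> Y -> k),
    [/\ open U, open V,
        forall i x, U x -> regular_at x (f i),
        forall i y, V y -> regular_at y (g i) &
        W = [set p | [/\ U p.1, V p.2 & \sum_i f i p.1 * g i p.2 != 0]]]].

HB.instance Definition _ X Y := Choice.on (prod_sort X Y).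
HB.instance Definition _ X Y :=
  isSubBaseTopological.Build (prod_sort X Y) (prod_basic (X:=X) (Y:=Y)) id.

Definition prod_regular_at X Y (p : prod_sort X Y) (h : prod_sort X Y -> k) :=
  exists (n m : nat) (f : 'I_n -> X -> k) (g : 'I_n -> Y -> k)
         (f' : 'I_m -> X -> k) (g' : 'I_m -> Y -> k),
    [/\ forall i, regular_at p.1 (f i) /\ regular_at p.2 (g i),
        forall j, regular_at p.1 (f' j) /\ regular_at p.2 (g' j),
        \sum_j f' j p.1 * g' j p.2 != 0 &
        \forall q \near p,
          h q = (\sum_i f i q.1 * g i q.2) / (\sum_j f' j q.1 * g' j q.2)].

Definition prod_space X Y : spaceFun k := SpaceFun (@prod_regular_at X Y).

Definition affine_set n (S : set (mpoly n k)) : Type :=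
  {v : 'I_n -> k | forall F, S F -> meval v F = 0}.

HB.instance Definition _ n (S : set (mpoly n k)) :=
  gen_eqMixin (affine_set S).
HB.instance Definition _ n (S : set (mpoly n k)) :=
  gen_choiceMixin (affine_set S).
HB.instance Definition _ n (S : set (mpoly n k)) :=
  isSubBaseTopological.Build (affine_set S)
    [set [set v : affine_set S | meval (sval v) F != 0]
      | F in [set: mpoly n k]] id.

Definition affine_regular_at n (S : set (mpoly n k))
    (v : affine_set S) (h : affine_set S -> k) : Prop :=
  exists F G : mpoly n k, meval (sval v) G != 0 /\
    \forall w \near v, h w = meval (sval w) F / meval (sval w) G.

Definition affine_space n (S : set (mpoly n k)) : spaceFun k :=
  SpaceFun (@affine_regular_at n S).

Definition affine_open X (U : set X) : Prop :=
  exists (n : nat) (S : set (mpoly n k))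
         (f : X -> affine_space S) (g : affine_space S -> X),
    open_iso U [set: affine_space S] f g.

Definition irreducible_variety X : Prop :=
  [/\ irreducible X,
      exists (n : nat) (U : 'I_n -> set X),
        (forall i, affine_open (U i)) /\ \bigcup_i U i = [set: X] &
      closed [set p : prod_space X X | p.1 = p.2]].

End SpaceFun.

Section ProjectivePlane.
Variable k : fieldType.

Definition P2_sort : Type := {W : {vspace 'rV[k]_3} | \dim W == 1%N}.
HB.instance Definition _ := Choice.on P2_sort.

(* Homogeneous coordinates of W, defined up to a nonzero scalar. *)
Definition hcoord (W : P2_sort) : 'I_3 -> k := vpick (val W) 0.

Definition homogeneous d : pred (mpoly 3 k) :=
  fun F => F \is ishomog1 d mdeg.

HB.instance Definition _ :=
  isSubBaseTopological.Build P2_sort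
    [set [set W : P2_sort | meval (hcoord W) F != 0]
      | F in [set F | exists d, homogeneous d F]] id.

Definition P2_regular_at (W : P2_sort) (h : P2_sort -> k) : Prop :=
  exists (d : nat) (F G : mpoly 3 k),
    [/\ homogeneous d F, homogeneous d G, meval (hcoord W) G != 0 &
        \forall W' \near W,
          h W' = meval (hcoord W') F / meval (hcoord W') G].

Definition P2 : spaceFun k := SpaceFun P2_regular_at.

Lemma dim_point (x y : k) :
  \dim <[\row_(i < 3) [:: x; y; 1]`_i : 'rV[k]_3]>%VS == 1%N.
Proof.
rewrite dim_vline; apply/eqP; case: eqP => // /rowP /(_ (inord 2)).
by rewrite !mxE inordK //= => /eqP; rewrite oner_eq0.
Qed.

(* [x : y : 1] *)
Definition point (x y : k) : P2 := exist (fun W : {vspace 'rV[k]_3} => \dim W == 1%N) _ (dim_point x y).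

End ProjectivePlane.

Section P2irr.
Variable k : closedFieldType.

Lemma mevalZ_homog d (F : mpoly 3 k) (c : k) (v w : 'I_3 -> k) :
  homogeneous d F -> (forall i, w i = c * v i) ->
  meval w F = c ^+ d * meval v F.
Proof.
move=> /dhomogP hF wE; rewrite !mevalE big_distrr /=.
apply: eq_big_seq => m /hF mE; rewrite mulrCA; congr (_ * _).
rewrite (eq_bigr (fun i => c ^+ m i * v i ^+ m i)); last first.
  by move=> i _; rewrite wE exprMn.
rewrite big_split /=; congr (_ * _).
by rewrite -mE /= mdegE expr_sum.
Qed.

Lemma P2_open_basic (O : set (P2 k)) (p : P2 k) : open O -> O p ->
  exists d (F : mpoly 3 k), [/\ homogeneous d F, meval (hcoord p) F != 0 &
    forall W : P2 k, meval (hcoord W) F != 0 -> O W].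
Proof.
move=> [D' sD' <-] [A DA Ap].
have [E ED EA] := sD' _ DA.
pose s : seq (set (P2 k)) := finmap.enum_fset E.
have sD (B : set (P2 k)) : B \in s -> exists d (F : mpoly 3 k),
    homogeneous d F /\ B = [set W | meval (hcoord W) F != 0].
  by move=> /ED /set_mem [F [d hF] <-]; exists d, F.
have sp B : B \in s -> B p by move=> Bs; move: Ap; rewrite -EA; apply.
suff [d [F [hF Fp FE]]] : exists d (F : mpoly 3 k), [/\ homogeneous d F,
    meval (hcoord p) F != 0 &
    forall W : P2 k, meval (hcoord W) F != 0 -> forall B, B \in s -> B W].
  exists d, F; split=> // W FW; exists A => //=.
  by rewrite -EA => i iE; apply: FE FW _ iE.
move: s sD sp {D' sD' DA A Ap ED EA} => /= s.
elim: s {E} => [|B s IHs] sD sp.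
  exists 0%N, 1; split=> //; first exact: dhomog1.
  by rewrite meval1 oner_neq0.
have [B' Bs|B' Bs|d [F [hF Fp FE]]] := IHs.
- by apply: sD; rewrite inE Bs orbT.
- by apply: sp; rewrite inE Bs orbT.
have [e [G [hG BE]]] := sD B (mem_head _ _).
have := sp B (mem_head _ _); rewrite BE /= => Gp.
exists (d + e)%N, (F * G); split.
- exact: dhomogM.
- by rewrite mevalM mulf_neq0.
move=> W; rewrite mevalM mulf_eq0 negb_or => /andP[FW GW] B'.
by rewrite inE => /predU1P[->|]; [exact: GW | exact: FE].
Qed.

Lemma P2_pick_neq0 (p : P2 k) : vpick (val p) != 0.
Proof.
rewrite vpick0; apply: contraTneq (valP p) => /= ->.
by rewrite dimv0.
Qed.

Lemma P2_line (p : P2 k) : val p = <[vpick (val p)]>%VS.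
Proof.
apply/eqP; rewrite eq_sym eqEdim -memvE memv_pick dim_vline P2_pick_neq0.
by rewrite (eqP (valP p)).
Qed.

(* The points of a line of P2 at which F does not vanish are the nonroots of  *)
(* a polynomial.                                                              *)
Lemma P2_irreducible : irreducible (P2 k).
Proof.
split; first by exists (point 0 0).
move=> U V oU oV [p Up] [q Vq].
have [d [F [hF Fp FU]]] := P2_open_basic oU Up.
have [e [G [hG Gq GV]]] := P2_open_basic oV Vq.
have [pq|pNq] := eqVneq p q; first by exists p; split; rewrite // pq.
pose v := vpick (val p); pose w := vpick (val q).
pose l (i : 'I_3) : {poly k} := (v 0 i)%:P + 'X * (w 0 i - v 0 i)%:P.
pose P (H : mpoly 3 k) : {poly k} := mmap polyC l H.
have PE H t : (P H).[t] = meval (fun i => (v + t *: (w - v)) 0 i) H.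
  rewrite /P /mmap mevalE horner_sum; apply: eq_bigr => m _.
  rewrite hornerM hornerC /mmap1 horner_prod; congr (_ * _).
  by apply: eq_bigr => i _; rewrite horner_exp !hornerE !mxE.
have FGn0 : P F * P G != 0.
  rewrite mulf_neq0 //; apply/negP=> /eqP P0.
    move: Fp; rewrite /hcoord -/v; have := PE F 0.
    by rewrite P0 horner0 scale0r addr0 => <-; rewrite eqxx.
  move: Gq; rewrite /hcoord -/w; have := PE G 1.
  by rewrite P0 horner0 scale1r addrC subrK => <-; rewrite eqxx.
have /closed_nonrootP [t] := FGn0.
rewrite rootM negb_or /root !PE => /andP[Ft Gt].
set u := v + t *: (w - v) in Ft Gt.
have u0 : u != 0.
  apply: contraNneq pNq => u0; apply/eqP/val_inj.
  rewrite (P2_line p) (P2_line q) -/v -/w; apply/eqP.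
  have [t0|t0] := eqVneq t 0.
    by move: u0 (P2_pick_neq0 p); rewrite /u t0 scale0r addr0 -/v => ->; rewrite eqxx.
  rewrite eq_sym eqEdim !dim_vline !P2_pick_neq0 andbT -memvE.
  apply/vlineP; exists ((t - 1) / t).
  apply: (scalerI t0); rewrite scalerA mulrC divfK //.
  by apply/eqP; rewrite -subr_eq0 scalerBl scale1r opprB addrCA -scalerBr -u0.
have dimu : \dim <[u]>%VS == 1%N by rewrite dim_vline u0.
pose W : P2 k := exist (fun W : {vspace 'rV[k]_3} => \dim W == 1%N) _ dimu.
have [c ucW] : exists c, u = c *: vpick (val W).
  by apply/vlineP; rewrite -(P2_line W) memv_line.
exists W; split; [apply: FU | apply: GV].
- apply: contraNneq Ft => FW.
  rewrite (@mevalZ_homog d F c (hcoord W)) ?FW ?mulr0 //.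
  by move=> i; rewrite ucW mxE.
- apply: contraNneq Gt => GW.
  rewrite (@mevalZ_homog e G c (hcoord W)) ?GW ?mulr0 //.
  by move=> i; rewrite ucW mxE.
Qed.
End P2irr.

Section BirationalMap.
Variables (k : fieldType) (X : spaceFun k).

Definition generically (P : set X) : Prop :=
  exists O : set X, [/\ open O, O !=set0 & O `<=` P].

Record birmap := BirMap {
  bir_fun :> X -> X;
  bir_inv : X -> X;
  bir_dom : set X;
  bir_cod : set X;
  bir_iso : open_iso bir_dom bir_cod bir_fun bir_inv;
  bir_dom0 : bir_dom !=set0 }.

HB.instance Definition _ := gen_eqMixin birmap.
HB.instance Definition _ := gen_choiceMixin birmap.

Definition bir_equiv (f g : birmap) : bool :=
  `[< generically [set x | f x = g x] >].

Lemma morphism_at_id (x : X) : morphism_at (fun y : X => y) x.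
Proof. by split. Qed.

Lemma morphism_at_comp (f g : X -> X) (x : X) :
  morphism_at g x -> morphism_at f (g x) -> morphism_at (f \o g) x.
Proof.
move=> [cg rg] [cf rf]; split; first exact: continuous_comp.
by move=> h hr; exact: (rg (h \o f) (rf h hr)).
Qed.

Lemma open_iso_preimage (U V : set X) (f g : X -> X) (O : set X) :
  open_iso U V f g -> open O -> open (U `&` f @^-1` O).
Proof.
move=> [oU _ fP _] oO; rewrite openE => x [Ux Ofx].
have [_ _ [cf _]] := fP x Ux.
have nU : nbhs x U by apply: open_nbhs_nbhs.
have nO : nbhs x (f @^-1` O) by apply: cf; apply: open_nbhs_nbhs.
exact: filterI nU nO.
Qed.

Lemma open_iso_sym (U V : set X) (f g : X -> X) :
  open_iso U V f g -> open_iso V U g f.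
Proof. by case. Qed.

Lemma open_iso_comp (U V U' V' : set X) (f g f' g' : X -> X) :
  open_iso U V f g -> open_iso U' V' f' g' ->
  open_iso (U' `&` f' @^-1` U) (V `&` g @^-1` V') (f \o f') (g' \o g).
Proof.
move=> fP fP'; split.
- by apply: open_iso_preimage fP' _; case: fP.
- by apply: open_iso_preimage (open_iso_sym fP) _; case: fP'.
- move=> x [U'x Ufx]; case: fP => _ _ /(_ _ Ufx) [Vfx gfx mf] _.
  case: fP' => _ _ /(_ _ U'x) [V'x gx mf'] _.
  by split=> /=; [rewrite gfx | rewrite gfx | exact: morphism_at_comp].
move=> y [Vy V'gy]; case: fP => _ _ _ /(_ _ Vy) [Ugy fgy mg].
case: fP' => _ _ _ /(_ _ V'gy) [U'y fy mg'].
by split=> /=; [rewrite fy | rewrite fy | exact: morphism_at_comp].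
Qed.

Lemma bir_domP (f : birmap) x : bir_dom f x ->
  bir_cod f (f x) /\ bir_inv f (f x) = x.
Proof. by move=> dx; have [_ _ /(_ x dx) [? ? _] _] := bir_iso f. Qed.

Lemma bir_codP (f : birmap) y : bir_cod f y ->
  bir_dom f (bir_inv f y) /\ f (bir_inv f y) = y.
Proof. by move=> cy; have [_ _ _ /(_ y cy) [? ? _]] := bir_iso f. Qed.

Lemma bir_cod0 (f : birmap) : bir_cod f !=set0.
Proof. by have [x /bir_domP [? _]] := bir_dom0 f; exists (f x). Qed.

Lemma open_dom (f : birmap) : open (bir_dom f).
Proof. by case: (bir_iso f). Qed.

Lemma open_cod (f : birmap) : open (bir_cod f).
Proof. by case: (bir_iso f). Qed.

Definition birV (f : birmap) : birmap :=
  BirMap (open_iso_sym (bir_iso f)) (bir_cod0 f).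

Hypothesis hX : irreducible X.

Lemma generically_dense (P : set X) (O : set X) :
  generically P -> open O -> O !=set0 -> (O `&` P) !=set0.
Proof.
move=> [U [oU U0 UP]] oO O0; have [x [Ox Ux]] := hX.2 O U oO oU O0 U0.
by exists x; split=> //; apply: UP.
Qed.

Lemma generically_and (P Q : set X) :
  generically P -> generically Q -> generically (P `&` Q).
Proof.
move=> [U [oU U0 UP]] [V [oV V0 VQ]]; exists (U `&` V); split.
- exact: openI.
- exact: hX.2.
- by move=> x [Ux Vx]; split; [apply: UP | apply: VQ].
Qed.

Lemma generically_open (O : set X) : open O -> O !=set0 -> generically O.
Proof. by move=> oO O0; exists O; split. Qed.

Lemma generically_sub (P Q : set X) :
  P `<=` Q -> generically P -> generically Q.
Proof. by move=> PQ [U [oU U0 UP]]; exists U; split=> // x /UP /PQ. Qed.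

Lemma generically_preimage (f : birmap) (P : set X) :
  generically P -> generically (bir_dom f `&` f @^-1` P).
Proof.
move=> [U [oU U0 UP]]; exists (bir_dom f `&` f @^-1` U); split.
- exact: open_iso_preimage (bir_iso f) oU.
- have [y [cy Uy]] := hX.2 _ _ (open_cod f) oU (bir_cod0 f) U0.
  have [dx fx] := bir_codP cy.
  by exists (bir_inv f y); split=> //=; rewrite fx.
- by move=> x [dx Ux]; split=> //; apply: UP.
Qed.

Lemma bir_id_iso : open_iso [set: X] [set: X] id id.
Proof.
by split; first [exact: openT | move=> x _; split=> //; exact: morphism_at_id].
Qed.

Definition bir1 : birmap := BirMap bir_id_iso hX.1.

Lemma bir_comp_dom0 (f g : birmap) :
  (bir_dom g `&` g @^-1` bir_dom f) !=set0.
Proof.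
have [O [_ [x Ox] OP]] :=
  generically_preimage g (generically_open (open_dom f) (bir_dom0 f)).
by exists x; apply: OP.
Qed.

Definition birM (f g : birmap) : birmap :=
  BirMap (open_iso_comp (bir_iso f) (bir_iso g)) (bir_comp_dom0 f g).

Lemma bir_equivP (f g : birmap) :
  reflect (generically [set x | f x = g x]) (bir_equiv f g).
Proof. exact: asboolP. Qed.

Lemma bir_equiv_refl : reflexive bir_equiv.
Proof.
move=> f; apply/bir_equivP; apply: generically_sub (generically_open _ hX.1) => //.
exact: openT.
Qed.

Lemma bir_equiv_sym : symmetric bir_equiv.
Proof.
by move=> f g; apply/bir_equivP/bir_equivP; apply: generically_sub => x /= ->.
Qed.

Lemma bir_equiv_trans : transitive bir_equiv.
Proof.
move=> g f h /bir_equivP fg /bir_equivP gh; apply/bir_equivP.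
by apply: generically_sub (generically_and fg gh) => x /= [-> ->].
Qed.

Canonical bir_equiv_rel :=
  EquivRel bir_equiv bir_equiv_refl bir_equiv_sym bir_equiv_trans.

(* Two birational maps are equal when they agree on a nonempty open set. *)
Definition Bir : Type := {eq_quot bir_equiv_rel}.

HB.instance Definition _ := Choice.on Bir.
HB.instance Definition _ := EqQuotient.on Bir.

Definition bir_class (f : birmap) : Bir := \pi f.

Lemma bir_classP (f g : birmap) :
  bir_class f = bir_class g <-> generically [set x | f x = g x].
Proof. by split=> [/eqmodP/bir_equivP|?]; last by apply/eqmodP/bir_equivP. Qed.

Lemma bir_class_repr (b : Bir) : bir_class (repr b) = b.
Proof. exact: reprK. Qed.

Definition Bir_mul (b c : Bir) : Bir := bir_class (birM (repr b) (repr c)).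
Definition Bir_inv (b : Bir) : Bir := bir_class (birV (repr b)).
Definition Bir_one : Bir := bir_class bir1.

Lemma Bir_mulE (f g : birmap) :
  Bir_mul (bir_class f) (bir_class g) = bir_class (birM f g).
Proof.
apply/bir_classP.
have /bir_classP fE := bir_class_repr (bir_class f).
have /bir_classP gE := bir_class_repr (bir_class g).
apply: generically_sub (generically_and gE (generically_preimage g fE)).
by move=> x /= [-> [_ ->]].
Qed.

Lemma Bir_invE (f : birmap) : Bir_inv (bir_class f) = bir_class (birV f).
Proof.
apply/bir_classP.
have /bir_classP fE := bir_class_repr (bir_class f).
move: (repr _) fE => g gf.
have := generically_and (generically_preimage (birV f) gf)
  (generically_preimage (birV f)
    (generically_open (open_dom g) (bir_dom0 g))).
apply: generically_sub => y /= [[cy gy] [_ dy]].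
have [_ fy] := bir_codP cy; have [_ <-] := bir_domP dy.
by rewrite gy fy.
Qed.

Lemma Bir_mulA : associative Bir_mul.
Proof.
move=> a b c; rewrite -(bir_class_repr a) -(bir_class_repr b).
rewrite -(bir_class_repr c) !Bir_mulE.
apply/bir_classP; apply: generically_sub (generically_open openT hX.1).
by [].
Qed.

Lemma Bir_mul1 : left_id Bir_one Bir_mul.
Proof.
move=> a; rewrite -(bir_class_repr a) Bir_mulE; apply/bir_classP.
by apply: generically_sub (generically_open openT hX.1).
Qed.

Lemma Bir_1mul : right_id Bir_one Bir_mul.
Proof.
move=> a; rewrite -(bir_class_repr a) Bir_mulE; apply/bir_classP.
by apply: generically_sub (generically_open openT hX.1).
Qed.

Lemma Bir_mulV : left_inverse Bir_one Bir_inv Bir_mul.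
Proof.
move=> a; rewrite -(bir_class_repr a) Bir_invE Bir_mulE; apply/bir_classP.
apply: generically_sub (generically_open (open_dom (repr a)) (bir_dom0 _)).
by move=> x /bir_domP [].
Qed.

Lemma Bir_Vmul : right_inverse Bir_one Bir_inv Bir_mul.
Proof.
move=> a; rewrite -(bir_class_repr a) Bir_invE Bir_mulE; apply/bir_classP.
apply: generically_sub (generically_open (open_cod (repr a)) (bir_cod0 _)).
by move=> x /bir_codP [].
Qed.

HB.instance Definition _ :=
  isGroup.Build Bir Bir_mulA Bir_mul1 Bir_1mul Bir_mulV Bir_Vmul.

Definition represents (b : Bir) (h : X -> X) : Prop :=
  exists2 f : birmap, b = bir_class f & generically [set x | f x = h x].

(* The A-birational map is given by its restriction phi : U -> V, with        *)
(* inverse psi; b a is the birational map w |-> p_2 (phi (a, w)).             *)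
Definition bir_morphism (A : spaceFun k) (b : A -> Bir) : Prop :=
  exists (U V : set (prod_space A X)) (phi psi : prod_space A X -> prod_space A X),
    [/\ open_iso U V phi psi,
        forall p, U p -> (phi p).1 = p.1,
        forall a, exists x, U (a, x),
        forall a, exists x, V (a, x) &
        forall a, represents (b a) (fun x => (phi (a, x)).2)].

Definition Bir_open (F : set Bir) : Prop :=
  forall (A : spaceFun k) (b : A -> Bir),
    irreducible_variety A -> bir_morphism b -> open (b @^-1` F).

Lemma Bir_openT : Bir_open setT.
Proof. by move=> A b _ _; rewrite preimage_setT; exact: openT. Qed.

Lemma Bir_openI : setI_closed Bir_open.
Proof.
move=> F G oF oG A b hA hb; rewrite preimage_setI.
by apply: openI; [exact: oF | exact: oG].
Qed.

Lemma Bir_open_bigU (I : Type) (F : I -> set Bir) :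
  (forall i, Bir_open (F i)) -> Bir_open (\bigcup_i F i).
Proof.
move=> oF A b hA hb; rewrite preimage_bigcup.
by apply: bigcup_open => i _; exact: oF.
Qed.

HB.instance Definition _ :=
  isOpenTopological.Build Bir Bir_openT Bir_openI Bir_open_bigU.

Lemma Bir_closedP (F : set Bir) :
  closed F <-> forall (A : spaceFun k) (b : A -> Bir),
    irreducible_variety A -> bir_morphism b -> closed (b @^-1` F).
Proof.
rewrite -openC -[open _]/(Bir_open _).
split=> cF A b hA hb; last by rewrite -preimage_setC openC; apply: cF hA hb.
by rewrite -openC preimage_setC; apply: cF hA hb.
Qed.

End BirationalMap.

Definition Cremona (k : closedFieldType) : Type := Bir (@P2_irreducible k).
HB.instance Definition _ k :=
  Topological.copy (Cremona k) (Bir (@P2_irreducible k)).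
HB.instance Definition _ k :=
  monoid.Group.copy (Cremona k) (Bir (@P2_irreducible k)).


Section Groups.
Variable G : groupType.
Local Open Scope group_scope.

Definition subgroup (H : set G) : Prop :=
  [/\ H 1, forall x y, H x -> H y -> H (x * y) & forall x, H x -> H x^-1].

Definition normaliser (H T : set G) : set G :=
  [set x | H x /\ [set x * t * x^-1 | t in T] = T].

Definition semidirect (K N H : set G) : Prop :=
  [/\ subgroup K, subgroup N /\ N `<=` K, subgroup H /\ H `<=` K,
      forall x, K x -> [set x * n * x^-1 | n in N] = N &
      K = [set n * h | n in N & h in H] /\ N `&` H = [set 1]].

End Groups.

Section Jonquieres.
Variable k : closedFieldType.
Local Notation K := {fraction {poly k}}.

(* The value of h at y, meaningless at the finitely many zeros of the chosen  *)
(* denominator.                                                               *)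
Definition rat_eval (h : K) (y : k) : k :=
  (\n_(repr h)).[y] / (\d_(repr h)).[y].

Definition rat_const (c : k) : K := FracField.tofrac c%:P.
Definition rat_y : K := FracField.tofrac 'X.

(* b is (x, y) |-> (F x y, G x y) under (x, y) |-> [x : y : 1]; only generic  *)
(* values of F and G matter.                                                  *)
Definition in_coords (b : Cremona k) (F G : k -> k -> k) : Prop :=
  exists2 f : birmap (P2 k), b = bir_class (@P2_irreducible k) f &
    generically [set p : P2 k |
      forall x y, p = point x y -> f p = point (F x y) (G x y)].

Definition mobius (a b c d y : k) : k := (a * y + b) / (c * y + d).

Definition rat_mobius (a b c d : K) (x y : k) : k :=
  mobius (rat_eval a y) (rat_eval b y) (rat_eval c y) (rat_eval d y) x.

Definition Jonq : set (Cremona k) :=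
  [set phi | exists (A B C D : K) (a b c d : k),
    [/\ A * D - B * C != 0, a * d - b * c != 0 &
        in_coords phi (rat_mobius A B C D) (fun _ y => mobius a b c d y)]].

Definition torus (f : K) : set (Cremona k) :=
  [set phi | exists a b : K, (a, b) != (0, 0) /\
    in_coords phi (rat_mobius a (b * f) b a) (fun _ y => y)].

Definition Jonq_diag : set (Cremona k) :=
  [set phi | exists (l : K) (a b c d : k),
    [/\ l != 0, a * d - b * c != 0 &
        in_coords phi (fun x y => rat_eval l y * x)
                      (fun _ y => mobius a b c d y)]].

Definition torus12 : set (Cremona k) :=
  [set phi | exists2 t : k, t != 0 &
    in_coords phi (fun x _ => t * x) (fun _ y => t ^+ 2 * y)].

Definition id_component (H : set (Cremona k)) : set (Cremona k) :=
  connected_component H 1%g.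

Definition isomorphic_Gm (H : set (Cremona k)) : Prop :=
  exists h : k -> Cremona k,
    set_bij [set t | t != 0] H h /\
    forall s t, s != 0 -> t != 0 -> h (s * t) = (h s * h t)%g.

End Jonquieres.
Arguments Jonq : clear implicits.
Arguments Jonq_diag : clear implicits.
Arguments torus12 : clear implicits.

Definition nonsquare (K : fieldType) (f : K) : Prop := forall h : K, h ^+ 2 != f.

Section Genus.
Variable k : closedFieldType.
Local Notation K := {fraction {poly k}}.
Variable L : fieldExtType K.

Definition ext_const (c : k) : L := (rat_const c)%:A.

(* Normalised discrete valuations of L over k, i.e. the points of the smooth  *)
(* projective curve with function field L. The value v 0 is irrelevant.       *)
Definition place (v : L -> int) : Prop :=
  [/\ forall a b, a != 0 -> b != 0 -> v (a * b) = v a + v b,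
      forall a b, a != 0 -> b != 0 -> a + b != 0 ->
        (Order.min (v a) (v b) <= v (a + b))%R,
      forall c, c != 0 -> v (ext_const c) = 0 &
      exists2 t, t != 0 & v t = 1].

(* The derivation d/dy of L, unique in characteristic 0. *)
Definition derivation_dy (D : L -> L) : Prop :=
  [/\ forall a b, D (a + b) = D a + D b,
      forall a b, D (a * b) = a * D b + b * D a,
      forall c, D (ext_const c) = 0 &
      D (rat_y k)%:A = 1].

(* h dy is regular everywhere: at each point h dy = u dt for a uniformiser t  *)
(* and a regular u.                                                           *)
Definition regular_differential (D : L -> L) (h : L) : Prop :=
  forall v, place v -> exists t u : L,
    [/\ t != 0, v t = 1, u = 0 \/ (0 <= v u)%R & h = u * D t].

Definition k_dimension (W : set L) (g : nat) : Prop :=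
  exists e : 'I_g -> L, (forall i, W (e i)) /\
    forall h, W h ->
      exists! c : {ffun 'I_g -> k}, h = \sum_i ext_const (c i) * e i.

(* dim H^0(Omega^1) *)
Definition has_genus (g : nat) : Prop :=
  exists2 D, derivation_dy D & k_dimension (regular_differential D) g.

End Genus.

Definition sqrt_curve_genus (k : closedFieldType) (f : {fraction {poly k}})
    (g : nat) : Prop :=
  exists (L : fieldExtType {fraction {poly k}}) (s : L),
    [/\ s ^+ 2 = f%:A, <<1; s>>%VS = fullv & has_genus L g].

(* Main.v *)
Require Import Defs.
From HB Require Import structures.
From mathcomp Require Import -(notations) mpoly.
From mathcomp Require Import all_boot all_order all_algebra all_field.
From mathcomp Require Import generic_quotient fraction.
From mathcomp Require Import all_classical all_reals.
From mathcomp Require Import topology complex ring zify.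

Set Implicit Arguments.
Unset Strict Implicit.
Unset Printing Implicit Defensive.

Import Order.TTheory GRing.Theory Num.Theory.
Local Open Scope classical_set_scope.
Local Open Scope quotient_scope.
Local Open Scope ring_scope.

(* The normaliser N of T_f in Jonq is T_f D, where D consists of the maps      *)
(* (l(y) x, m(y)) with f o m = l^2 f. Up to squares, f is the product of the  *)
(* y - c for c in a finite set r.                                             *)
(* If r has at least three elements, m maps them to branch points of          *)
(* x^2 = f(y), so D is finite. As T_f is the centraliser in N of two of its   *)
(* elements, it is closed of finite index in N; it is also connected, whence  *)
(* N^o = T_f and D^o = 1. Moreover dy / s, where s^2 is the product of the    *)
(* y - c, is a nonzero regular differential, so g >= 1.                       *)
(* If r has at most two elements, a Moebius substitution reduces to f = y.    *)
(* Then T_{1,2} has index two in D, the other coset being that of             *)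
(* (x / y, 1 / y), which inverts T_{1,2}; commutators with one element of     *)
(* T_{1,2} thus show that T_y T_{1,2} is closed in N. The function field is   *)
(* C(z) for some z, and the valuations of C(z) given by the points of P^1     *)
(* leave no room for a nonzero regular differential, so g = 0.                *)

(** * Germs, products and birational morphisms *)

(** Two facts about the topology of the Cremona group reduce the theorem to algebra. First, a word
    in one variable with constants from the group carries morphisms to morphisms ([algebraic_map]),
    so it is continuous, and the solutions of w = 1 form a closed set ([closed_algebraic_eq1]): if a
    member of a family moves a point, a regular function detects it, and nearby members move a point
    as well. Centralisers are therefore closed. Second, a morphism from an irreducible variety has
    connected image ([bir_morphism_connected]); the connecting families live over the multiplicative
    group [Gm] and come from [family_frac].

    On the algebraic side, an element of Jonq is a matrix over C(y) up to scalars together with a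
    Moebius map, and products are matrix products twisted by substitution ([jel_calculus]). T_f is
    the multiplicative group of K(sqrt f) modulo that of K = C(y). An element normalising T_f sends
    sqrt f, which has trace zero, to an element of T_f of trace zero, that is, to sqrt f up to a
    scalar. Solving this equation gives the normaliser as T_f D, where D consists of the (l(y) x,
    m(y)) with f o m = l^2 f ([elts_normaliser]). T_f is connected ([torus_connected]) and is the
    centraliser in the normaliser of two of its elements ([torus_centraliser]). A relatively closed
    subgroup of finite index contains the identity component ([id_component_finite_index]), so
    everything depends on the size of D.

    Modulo squares f is the product of the y - c for c in a list r without repetition
    ([branch_points]). If r has at least three elements, m maps them into r or to infinity and is
    determined by three images, so D is finite ([finite_diag_norm]) and [id_component_finite]
    concludes. If r has one or two elements, T_f is conjugate to T_y by a diagonal map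
    ([rational_case], [rational_torus]); for T_y the group D is T_{1,2} extended by one involution
    that inverts it, and a commutator condition shows that T_y T_{1,2} is relatively closed of index
    two ([Hy_closed], [id_component_y]).

    The genus follows the same dichotomy. With three or more elements in r, dy / s is a nonzero
    regular differential ([regular_place], [genus_positive]); with at most two, the function field
    is C(z), and counting zeros and poles of (P / Q) dz excludes nonzero regular differentials
    ([regular_eq0], [genus_zero]). *)

Section Germs.
Variable k : fieldType.
Implicit Types X Y Z : spaceFun k.

(* [regular_at] need not depend on germs only; [germ_regular] is its closure  *)
(* under equality of germs.                                                   *)
Definition germ_regular X (x : X) (h : X -> k) : Prop :=
  exists (U : set X) (h0 : X -> k),
    [/\ open U, U x, forall y, U y -> regular_at y h0
      & forall y, U y -> h0 y = h y].

(** The sheaf property of [regular_at]. It leads back from germs to [regular_at], which is what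
    [morphism_at] tests. *)
Definition saturated X : Prop :=
  forall (x : X) h, germ_regular x h -> regular_at x h.

(** A [spaceFun] obeys no axioms by itself. These are the axioms of a sheaf of functions with local
    stalks, phrased with germs so that they survive restriction and transport along charts. *)
Record local_space X : Prop := LocalSpace {
  regular_germ : forall (x : X) h, regular_at x h -> germ_regular x h;
  germ_cst : forall (x : X) c, germ_regular x (fun=> c);
  germD : forall (x : X) h h', germ_regular x h -> germ_regular x h' ->
    germ_regular x (fun y => h y + h' y);
  germM : forall (x : X) h h', germ_regular x h -> germ_regular x h' ->
    germ_regular x (fun y => h y * h' y);
  germV : forall (x : X) h, germ_regular x h -> h x != 0 ->
    germ_regular x (fun y => (h y)^-1);
  germ_neq0 : forall (x : X) h, germ_regular x h -> h x != 0 ->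
    \forall y \near x, h y != 0 }.

Lemma open_nbhsP (X : topologicalType) (U : set X) (x : X) : open U -> U x -> nbhs x U.
Proof. by move=> oU Ux; apply: open_nbhs_nbhs; split. Qed.

Lemma near_open (X : topologicalType) (x : X) (P : set X) : (\forall y \near x, P y) ->
  exists U : set X, [/\ open U, U x & forall y, U y -> P y].
Proof. by rewrite /prop_near1 nbhsE => -[U [oU Ux] UP]; exists U. Qed.

Lemma germ_eq_near X (x : X) h h' :
  germ_regular x h -> (\forall y \near x, h y = h' y) -> germ_regular x h'.
Proof.
move=> [U [h0 [oU Ux Uh0 Eh0]]] /near_open[V [oV Vx VE]].
exists (U `&` V), h0; split; [exact: openI | by split | |].
- by move=> y [Uy _]; apply: Uh0.
- by move=> y [Uy /VE <-]; apply: Eh0.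
Qed.

Lemma germN X (x : X) h : local_space X -> germ_regular x h ->
  germ_regular x (fun y => - h y).
Proof.
move=> lX hr; apply: germ_eq_near (germM lX (germ_cst lX x (-1)) hr) _.
by near=> y; rewrite mulN1r.
Unshelve. all: by end_near. Qed.

Lemma germB X (x : X) h h' : local_space X -> germ_regular x h ->
  germ_regular x h' -> germ_regular x (fun y => h y - h' y).
Proof. by move=> lX hr /(germN lX); apply: germD. Qed.

Lemma germ_div X (x : X) h h' : local_space X -> germ_regular x h ->
  germ_regular x h' -> h' x != 0 -> germ_regular x (fun y => h y / h' y).
Proof. by move=> lX hr /(germV lX) hr' /hr'; apply: germM. Qed.

Lemma germ_sum X (x : X) n (h : 'I_n -> X -> k) : local_space X ->
  (forall i, germ_regular x (h i)) ->
  germ_regular x (fun y => \sum_i h i y).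
Proof.
move=> lX hr; elim: n h hr => [|n IHn] h hr.
  apply: germ_eq_near (germ_cst lX x 0) _.
  by near=> y; rewrite big_ord0.
have := germD lX (hr ord0) (IHn (fun i => h (lift ord0 i)) (fun i => hr _)).
move=> /germ_eq_near; apply; near=> y; by rewrite big_ord_recl.
Unshelve. all: by end_near. Qed.

Lemma germ_comp X Y (U : set X) (f : X -> Y) (x : X) h : open U -> U x ->
  (forall y, U y -> morphism_at f y) -> germ_regular (f x) h ->
  germ_regular x (h \o f).
Proof.
move=> oU Ux mf [V [h0 [oV Vfx Vh0 Eh0]]].
exists (U `&` f @^-1` V), (h0 \o f); split => //.
- rewrite openE => y [Uy Vfy].
  have [cf _] := mf y Uy.
  apply: filterI; first exact: open_nbhsP.
  by apply: cf; apply: open_nbhsP.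
- by move=> y [Uy Vfy]; have [_] := mf y Uy; apply; apply: Vh0.
- by move=> y [Uy Vfy]; apply: Eh0.
Qed.

Lemma morphism_comp X Y Z (f : X -> Y) (g : Y -> Z) (x : X) :
  morphism_at f x -> morphism_at g (f x) -> morphism_at (g \o f) x.
Proof.
move=> [cf rf] [cg rg]; split; first exact: continuous_comp.
by move=> h hr; exact: (rf (h \o g) (rg h hr)).
Qed.

Definition morphism_near X Y (f : X -> Y) (x : X) : Prop :=
  \forall y \near x, morphism_at f y.

Lemma germ_comp_near X Y (f : X -> Y) (x : X) h :
  morphism_near f x -> germ_regular (f x) h -> germ_regular x (h \o f).
Proof.
by move=> /near_open[U [oU Ux mf]]; apply: germ_comp mf.
Qed.

(** Each axiom is local: germs go to the chart by [g], where the axiom is known, and come back by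
    [f]. This serves arbitrary irreducible varieties, which are known only through affine charts. *)
Lemma local_space_cover X :
  (forall x : X, exists (Y : spaceFun k) (U : set X) (V : set Y)
     (f : X -> Y) (g : Y -> X), [/\ local_space Y, U x & open_iso U V f g]) ->
  local_space X.
Proof.
move=> cX.
have trans (x : X) : exists (Y : spaceFun k) (f : X -> Y) (g : Y -> X),
    [/\ local_space Y, g (f x) = x /\ continuous_at x f, (\forall y \near x, g (f y) = y),
      forall h : Y -> k, germ_regular (f x) h -> germ_regular x (h \o f) &
      (forall h : X -> k, germ_regular x h -> germ_regular (f x) (h \o g))
      /\ (forall h : X -> k, regular_at x h -> germ_regular (f x) (h \o g))].
  have [Y [U [V [f [g [lY Ux [oU oV fP gP]]]]]]] := cX x.
  exists Y, f, g; have [Vfx gfx mfx] := fP x Ux; split=> //.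
  - by split=> //; case: mfx.
  - by apply: filterS (open_nbhsP oU Ux) => y /fP [].
  - by move=> h; apply: germ_comp Ux _ => // y /fP [].
  split=> h hr; last first.
    apply: (regular_germ lY); have [_ _ [_]] := gP _ Vfx; apply.
    by rewrite gfx.
  by apply: germ_comp Vfx _ _ => // [y /gP [] //|]; rewrite gfx.
split.
- move=> x h hr; have [Y [f [g [lY [gfx _] nx pf [_ /(_ h hr) pg]]]]] := trans x.
  by apply: germ_eq_near (pf _ pg) _; apply: filterS nx => y /= ->.
- move=> x c; have [Y [f [g [lY _ _ pf _]]]] := trans x.
  exact: (pf _ (germ_cst lY _ c)).
- move=> x h h' hr hr'; have [Y [f [g [lY [gfx _] nx pf [pg _]]]]] := trans x.
  apply: germ_eq_near (pf _ (germD lY (pg _ hr) (pg _ hr'))) _.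
  by apply: filterS nx => y /= ->.
- move=> x h h' hr hr'; have [Y [f [g [lY [gfx _] nx pf [pg _]]]]] := trans x.
  apply: germ_eq_near (pf _ (germM lY (pg _ hr) (pg _ hr'))) _.
  by apply: filterS nx => y /= ->.
- move=> x h hr hx; have [Y [f [g [lY [gfx _] nx pf [pg _]]]]] := trans x.
  have hfx : (h \o g) (f x) != 0 by rewrite /= gfx.
  apply: germ_eq_near (pf _ (germV lY (pg _ hr) hfx)) _.
  by apply: filterS nx => y /= ->.
move=> x h hr hx; have [Y [f [g [lY [gfx cf] nx pf [pg _]]]]] := trans x.
have hfx : (h \o g) (f x) != 0 by rewrite /= gfx.
have := cf _ (germ_neq0 lY (pg _ hr) hfx) => /(filterI nx).
by apply: filterS => y [/= ->].
Qed.

Lemma morphism_near_at X Y (f : X -> Y) (x : X) :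
  morphism_near f x -> morphism_at f x.
Proof. exact: nbhs_singleton. Qed.

Lemma morphism_near_open X Y (U : set X) (f : X -> Y) : open U ->
  (forall x, U x -> morphism_at f x) -> forall x, U x -> morphism_near f x.
Proof. by move=> oU mf x Ux; apply: filterS mf _; apply: open_nbhsP. Qed.

Lemma open_germ_neq0 X (U : set X) h : local_space X -> open U ->
  (forall x, U x -> germ_regular x h) -> open (U `&` [set x | h x != 0]).
Proof.
move=> lX oU hr; rewrite openE => x [Ux hx].
apply: filterI; first exact: open_nbhsP.
exact: (germ_neq0 lX (hr x Ux) hx).
Qed.

Lemma germ_horner X (x : X) (u : X -> k) (p : {poly k}) : local_space X ->
  germ_regular x u -> germ_regular x (fun y => p.[u y]).
Proof.
move=> lX ur; elim/poly_ind: p => [|p c IHp].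
  apply: germ_eq_near (germ_cst lX x 0) _.
  by near=> y; rewrite horner0.
apply: germ_eq_near (germD lX (germM lX IHp ur) (germ_cst lX x c)) _.
by near=> y; rewrite hornerMXaddC.
Unshelve. all: by end_near. Qed.

Lemma germ_horner2 X (x : X) (u v : X -> k) (p : {poly {poly k}}) :
  local_space X -> germ_regular x u -> germ_regular x v ->
  germ_regular x (fun y => (p.[(u y)%:P]).[v y]).
Proof.
move=> lX ur vr; elim/poly_ind: p => [|p c IHp].
  apply: germ_eq_near (germ_cst lX x 0) _.
  by near=> y; rewrite !horner0.
apply: germ_eq_near (germD lX (germM lX IHp ur) (germ_horner c lX vr)) _.
by near=> y; rewrite hornerMXaddC hornerD hornerM hornerC.
Unshelve. all: by end_near. Qed.

Lemma germ_meval X (x : X) n (u : 'I_n -> X -> k) (F : mpoly n k) :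
  local_space X -> (forall i, germ_regular x (u i)) ->
  germ_regular x (fun y => meval (fun i => u i y) F).
Proof.
move=> lX ur; elim/mpolyind: F => [|c m F _ _ IH].
  apply: germ_eq_near (germ_cst lX x 0) _.
  by near=> y; rewrite meval0.
have mr : germ_regular x (fun y => \prod_i u i y ^+ m i).
  elim: (index_enum _) => [|i r IHr].
    apply: germ_eq_near (germ_cst lX x 1) _.
    by near=> y; rewrite big_nil.
  have pr : germ_regular x (fun y => u i y ^+ m i).
    elim: (m i) => [|j IHj].
      apply: germ_eq_near (germ_cst lX x 1) _.
      by near=> y; rewrite expr0.
    apply: germ_eq_near (germM lX (ur i) IHj) _.
    by near=> y; rewrite exprS.
  apply: germ_eq_near (germM lX pr IHr) _.
  by near=> y; rewrite big_cons.
apply: germ_eq_near (germD lX (germM lX (germ_cst lX x c) mr) IH) _.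
by near=> y; rewrite mevalD mevalZ /meval mmapX.
Unshelve. all: by end_near. Qed.

End Germs.

(** * Affine sets, the projective plane and the topology of products *)

Section ModelSpaces.
Variable k : fieldType.
Implicit Types X Y Z : spaceFun k.

Lemma affine_open_neq0 n (S : set (mpoly n k)) (F : mpoly n k) :
  open [set v : affine_space S | meval (sval v) F != 0].
Proof.
exists [set [set v : affine_space S | meval (sval v) F != 0]]; last exact: bigcup_set1.
by move=> _ ->; apply: finI_from1; exists F.
Qed.

Lemma affine_regular_germ n (S : set (mpoly n k)) (x : affine_space S) h :
  regular_at x h -> germ_regular x h.
Proof.
move=> [F [G [Gx /near_open[U [oU Ux UE]]]]].
exists (U `&` [set v | meval (sval v) G != 0]), h; split => //.
- by apply: openI => //; apply: affine_open_neq0.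
move=> y [Uy Gy]; exists F, G; split=> //.
by apply: filterS (open_nbhsP oU Uy).
Qed.

Lemma affine_saturated n (S : set (mpoly n k)) : saturated (affine_space S).
Proof.
move=> x h [U [h0 [oU Ux Uh0 Eh0]]]; have [F [G [Gx nE]]] := Uh0 x Ux.
exists F, G; split=> //; apply: filterS2 nE (open_nbhsP oU Ux).
by move=> y <- /Eh0.
Qed.

Lemma affine_local n (S : set (mpoly n k)) : local_space (affine_space S).
Proof.
split.
- exact: affine_regular_germ.
- move=> x c; apply: affine_regular_germ; exists (mpolyC n c), 1.
  rewrite meval1 oner_eq0; split=> //.
  by near=> y; rewrite mevalC meval1 divr1.
- move=> x h h' /affine_saturated[F [G [Gx nE]]].
  move=> /affine_saturated[F' [G' [G'x nE']]]; apply: affine_regular_germ.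
  exists (F * G' + F' * G), (G * G'); split.
    by rewrite mevalM mulf_neq0.
  have nG := open_nbhsP (@affine_open_neq0 _ S G) Gx.
  have nG' := open_nbhsP (@affine_open_neq0 _ S G') G'x.
  near=> y; rewrite mevalD !mevalM -addf_div; try by near: y.
  by congr (_ + _); near: y.
- move=> x h h' /affine_saturated[F [G [Gx nE]]].
  move=> /affine_saturated[F' [G' [G'x nE']]]; apply: affine_regular_germ.
  exists (F * F'), (G * G'); split.
    by rewrite mevalM mulf_neq0.
  near=> y; rewrite !mevalM -mulf_div.
  by congr (_ * _); near: y.
- move=> x h /affine_saturated[F [G [Gx nE]]] hx.
  apply: affine_regular_germ; exists G, F; split.
    by apply: contraNneq hx => Fx; rewrite (nbhs_singleton nE) Fx mul0r.
  by near=> y; rewrite -invf_div; congr (_^-1); near: y.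
- move=> x h /affine_saturated[F [G [Gx nE]]] hx.
  have Fx : meval (sval x) F != 0.
    by apply: contraNneq hx => Fx; rewrite (nbhs_singleton nE) Fx mul0r.
  have := open_nbhsP (@affine_open_neq0 _ S F) Fx => nF.
  have := open_nbhsP (@affine_open_neq0 _ S G) Gx => nG.
  near=> y; have -> : h y = meval (sval y) F / meval (sval y) G by near: y.
  rewrite mulf_neq0 ?invr_eq0 //; by near: y.
Unshelve. all: by end_near. Qed.

Lemma P2_open_neq0 d (F : mpoly 3 k) : homogeneous d F ->
  open [set W : P2 k | meval (hcoord W) F != 0].
Proof.
move=> hF; exists [set [set W : P2 k | meval (hcoord W) F != 0]]; last exact: bigcup_set1.
move=> _ ->; apply: finI_from1; by exists F => //; exists d.
Qed.

Lemma P2_regular_germ (x : P2 k) h : regular_at x h -> germ_regular x h.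
Proof.
move=> [d [F [G [hF hG Gx /near_open[U [oU Ux UE]]]]]].
exists (U `&` [set v : P2 k | meval (hcoord v) G != 0]), h; split => //.
- by apply: openI => //; apply: P2_open_neq0 hG.
move=> y [Uy Gy]; exists d, F, G; split=> //.
by apply: filterS (open_nbhsP oU Uy).
Qed.

Lemma P2_saturated : saturated (P2 k).
Proof.
move=> x h [U [h0 [oU Ux Uh0 Eh0]]]; have [d [F [G [hF hG Gx nE]]]] := Uh0 x Ux.
exists d, F, G; split=> //; apply: filterS2 nE (open_nbhsP oU Ux).
by move=> y <- /Eh0.
Qed.

Lemma P2_local : local_space (P2 k).
Proof.
split.
- exact: P2_regular_germ.
- move=> x c; apply: P2_regular_germ; exists 0%N, (c *: 1), 1.
  rewrite meval1 oner_eq0; split=> //; try exact: dhomog1.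
    by apply: rpredZ; exact: dhomog1.
  by near=> y; rewrite mevalZ meval1 divr1 mulr1.
- move=> x h h' /P2_saturated[d [F [G [hF hG Gx nE]]]].
  move=> /P2_saturated[d' [F' [G' [hF' hG' G'x nE']]]]; apply: P2_regular_germ.
  exists (d + d')%N, (F * G' + F' * G), (G * G'); split.
  + apply: dhomogD; first exact: dhomogM.
    by rewrite addnC; exact: dhomogM.
  + exact: dhomogM.
  + by rewrite mevalM mulf_neq0.
  have nG := open_nbhsP (P2_open_neq0 hG) Gx.
  have nG' := open_nbhsP (P2_open_neq0 hG') G'x.
  near=> y; rewrite mevalD !mevalM -addf_div; try by near: y.
  by congr (_ + _); near: y.
- move=> x h h' /P2_saturated[d [F [G [hF hG Gx nE]]]].
  move=> /P2_saturated[d' [F' [G' [hF' hG' G'x nE']]]]; apply: P2_regular_germ.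
  exists (d + d')%N, (F * F'), (G * G'); split; try exact: dhomogM.
    by rewrite mevalM mulf_neq0.
  near=> y; rewrite !mevalM -mulf_div.
  by congr (_ * _); near: y.
- move=> x h /P2_saturated[d [F [G [hF hG Gx nE]]]] hx.
  apply: P2_regular_germ; exists d, G, F; split => //.
    by apply: contraNneq hx => Fx; rewrite (nbhs_singleton nE) Fx mul0r.
  by near=> y; rewrite -invf_div; congr (_^-1); near: y.
- move=> x h /P2_saturated[d [F [G [hF hG Gx nE]]]] hx.
  have Fx : meval (hcoord x) F != 0.
    by apply: contraNneq hx => Fx; rewrite (nbhs_singleton nE) Fx mul0r.
  have := open_nbhsP (P2_open_neq0 hF) Fx => nF.
  have := open_nbhsP (P2_open_neq0 hG) Gx => nG.
  near=> y; have -> : h y = meval (hcoord y) F / meval (hcoord y) G by near: y.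
  rewrite mulf_neq0 ?invr_eq0 //; by near: y.
Unshelve. all: by end_near. Qed.

Lemma prod_basic_open X Y (U : set X) (V : set Y) n (f : 'I_n -> X -> k)
    (g : 'I_n -> Y -> k) : open U -> open V ->
  (forall i x, U x -> regular_at x (f i)) ->
  (forall i y, V y -> regular_at y (g i)) ->
  open [set p : prod_space X Y | [/\ U p.1, V p.2 & \sum_i f i p.1 * g i p.2 != 0]].
Proof.
move=> oU oV rf rg; exists [set [set p : prod_space X Y |
  [/\ U p.1, V p.2 & \sum_i f i p.1 * g i p.2 != 0]]]; last exact: bigcup_set1.
by move=> _ ->; apply: finI_from1; exists U, V, n, f, g; split.
Qed.

(** Finitely many neighbourhoods are intersected. The basic open sets of a product ask for functions
    regular on a whole open set, and germs provide these only after such a shrinking. *)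
Lemma germ_common X (x : X) n (f : 'I_n -> X -> k) :
  (forall i, germ_regular x (f i)) ->
  exists (U : set X) (f0 : 'I_n -> X -> k), [/\ open U, U x,
    forall i y, U y -> regular_at y (f0 i) &
    forall i y, U y -> f0 i y = f i y].
Proof.
elim: n f => [|n IHn] f rf.
  exists setT, f; split=> //; [exact: openT | by case].
have [U [h0 [oU Ux Uh0 Eh0]]] := rf ord0.
have [V [f0 [oV Vx Vf0 Ef0]]] := IHn (fun i => f (lift ord0 i)) (fun i => rf _).
exists (U `&` V), (fun i => if unlift ord0 i is Some j then f0 j else h0).
split=> //; first exact: openI.
- by move=> i y [Uy Vy]; case: unliftP => [j|] _; [apply: Vf0 | apply: Uh0].
- by move=> i y [Uy Vy]; case: unliftP => [j|] ->; [apply: Ef0 | apply: Eh0].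
Qed.

Variables (X Y : spaceFun k) (lX : local_space X) (lY : local_space Y).

Lemma prod_open_neq0 (x : X) (y : Y) n (f : 'I_n -> X -> k) (g : 'I_n -> Y -> k) :
  (forall i, germ_regular x (f i)) -> (forall i, germ_regular y (g i)) ->
  \sum_i f i x * g i y != 0 ->
  \forall p \near ((x, y) : prod_space X Y), \sum_i f i p.1 * g i p.2 != 0.
Proof.
move=> /germ_common[U [f0 [oU Ux Uf0 Ef0]]] /germ_common[V [g0 [oV Vy Vg0 Eg0]]].
move=> fg; apply: filterS (open_nbhsP (prod_basic_open oU oV Uf0 Vg0) _) => /=.
  move=> p [Up Vp]; rewrite (eq_bigr (fun i => f i p.1 * g i p.2)) // => i _.
  by rewrite Ef0 ?Eg0.
split=> //; rewrite (eq_bigr (fun i => f i x * g i y)) // => i _.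
by rewrite Ef0 ?Eg0.
Qed.

Lemma prod_open_box (U : set X) (V : set Y) : open U -> open V ->
  open [set p : prod_space X Y | U p.1 /\ V p.2].
Proof.
move=> oU oV; rewrite openE => -[x y] [/= Ux Vy].
(* Basic open sets carry a nonvanishing condition. The constants 1, represented by functions regular
   near [x] and [y], make it automatic. *)
have [U1 [f1 [oU1 U1x U1f1 Ef1]]] := germ_cst lX x 1.
have [V1 [g1 [oV1 V1y V1g1 Eg1]]] := germ_cst lY y 1.
have := @prod_basic_open X Y (U `&` U1) (V `&` V1) 1 (fun=> f1) (fun=> g1).
case=> [||_ z [_]|_ z [_]|D oD DE].
- exact: openI.
- exact: openI.
- exact: U1f1.
- exact: V1g1.
have oB : open [set p : prod_space X Y | [/\ (U `&` U1) p.1, (V `&` V1) p.2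
    & \sum_(i < 1) f1 p.1 * g1 p.2 != 0]] by exists D.
apply: filterS (open_nbhsP oB _) => [p [[Up _] [Vp _] _] //|].
by split=> //=; rewrite big_ord1 Ef1 // Eg1 // mulr1 oner_neq0.
Qed.

Lemma fst_continuous (p : prod_space X Y) : continuous_at p (fun q : prod_space X Y => q.1).
Proof.
move=> A /near_open[U [oU Up UA]].
apply: filterS (open_nbhsP (prod_open_box oU openT) _) => [q [/UA]//|]; by split.
Qed.

Lemma snd_continuous (p : prod_space X Y) : continuous_at p (fun q : prod_space X Y => q.2).
Proof.
move=> A /near_open[U [oU Up UA]].
apply: filterS (open_nbhsP (prod_open_box openT oU) _) => [q [_ /UA]//|]; by split.
Qed.

(* [prod_regular_at] with [regular_at] weakened to [germ_regular]. *)
Lemma prod_regularP (p : prod_space X Y) h :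
  regular_at p h <->
  exists (n m : nat) (f : 'I_n -> X -> k) (g : 'I_n -> Y -> k)
         (f' : 'I_m -> X -> k) (g' : 'I_m -> Y -> k),
    [/\ forall i, germ_regular p.1 (f i) /\ germ_regular p.2 (g i),
        forall j, germ_regular p.1 (f' j) /\ germ_regular p.2 (g' j),
        \sum_j f' j p.1 * g' j p.2 != 0 &
        \forall q \near p,
          h q = (\sum_i f i q.1 * g i q.2) / (\sum_j f' j q.1 * g' j q.2)].
Proof.
split=> -[n [m [f [g [f' [g' [fg fg' n0 nE]]]]]]].
  exists n, m, f, g, f', g'; split=> // i; split; apply: regular_germ => //.
  - by have [] := fg i.
  - by have [] := fg i.
  - by have [] := fg' i.
  - by have [] := fg' i.
have [U [f0 [oU Ux Uf0 Ef0]]] := germ_common (fun i => (fg i).1).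
have [V [g0 [oV Vy Vg0 Eg0]]] := germ_common (fun i => (fg i).2).
have [U' [f0' [oU' Ux' Uf0' Ef0']]] := germ_common (fun i => (fg' i).1).
have [V' [g0' [oV' Vy' Vg0' Eg0']]] := germ_common (fun i => (fg' i).2).
exists n, m, f0, g0, f0', g0'; split.
- by move=> i; split; [apply: Uf0 | apply: Vg0].
- by move=> i; split; [apply: Uf0' | apply: Vg0'].
- rewrite (eq_bigr (fun i => f' i p.1 * g' i p.2)) // => i _.
  by rewrite Ef0' ?Eg0'.
have nU := open_nbhsP (prod_open_box (openI oU oU') (openI oV oV'))
  (conj (conj Ux Ux') (conj Vy Vy')).
apply: filterS2 nE nU => q -> [[/= Uq Uq'] [Vq Vq']].
congr (_ / _); apply: eq_bigr => i _; first by rewrite Ef0 ?Eg0.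
by rewrite Ef0' ?Eg0'.
Qed.

End ModelSpaces.

(** * Regular functions on a product and its universal property *)

Section ProductSpace.
Variables (k : fieldType) (X Y : spaceFun k).
Hypotheses (lX : local_space X) (lY : local_space Y).
Local Notation XY := (prod_space X Y).

(** The image of the tensor product of the two stalks. The expansion is required at every point, so
    that sums and products need no shrinking. *)
Definition germ_tensor (p : XY) (a : XY -> k) : Prop :=
  exists (n : nat) (f : 'I_n -> X -> k) (g : 'I_n -> Y -> k),
    (forall i, germ_regular p.1 (f i) /\ germ_regular p.2 (g i)) /\
    forall q, a q = \sum_i f i q.1 * g i q.2.

Lemma germ_tensorD p a b : germ_tensor p a -> germ_tensor p b ->
  germ_tensor p (fun q => a q + b q).
Proof.
move=> [n [f [g [fg aE]]]] [m [f' [g' [fg' bE]]]].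
exists (n + m)%N, (fun i => match fintype.split i with inl j => f j | inr j => f' j end),
  (fun i => match fintype.split i with inl j => g j | inr j => g' j end); split.
  by move=> i; case: fintype.split => j; [exact: fg | exact: fg'].
move=> q; rewrite aE bE big_split_ord /=; congr (_ + _); apply: eq_bigr => i _.
  by rewrite -[lshift _ _]/(unsplit (inl i)) unsplitK.
by rewrite -[rshift _ _]/(unsplit (inr i)) unsplitK.
Qed.

Lemma germ_tensor1 (p : XY) f g : germ_regular p.1 f -> germ_regular p.2 g ->
  germ_tensor p (fun q => f q.1 * g q.2).
Proof.
move=> fr gr; exists 1%N, (fun=> f), (fun=> g); split=> // q.
by rewrite big_ord1.
Qed.

Lemma germ_tensorC (p : XY) c : germ_tensor p (fun=> c).
Proof.
exists 1%N, (fun=> fun=> c), (fun=> fun=> 1); split=> [_|q].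
  by split; [exact: germ_cst lX _ _ | exact: germ_cst lY _ _].
by rewrite big_ord1 mulr1.
Qed.

Lemma germ_tensor_ext p a b : germ_tensor p a -> a =1 b -> germ_tensor p b.
Proof.
by move=> [n [f [g [fg aE]]]] ab; exists n, f, g; split=> // q; rewrite -ab.
Qed.

Lemma germ_tensorM p a b : germ_tensor p a -> germ_tensor p b ->
  germ_tensor p (fun q => a q * b q).
Proof.
move=> [n [f [g [fg aE]]]] [m [f' [g' [fg' bE]]]].
elim: n f g fg a aE => [|n IHn] f g fg a aE.
  apply: germ_tensor_ext (germ_tensorC p 0) _ => q.
  by rewrite aE big_ord0 mul0r.
pose a1 (q : XY) := \sum_(i < n) f (lift ord0 i) q.1 * g (lift ord0 i) q.2.
have a1E (q : XY) : a1 q = \sum_(i < n) f (lift ord0 i) q.1 * g (lift ord0 i) q.2 by [].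
have IH := IHn _ _ (fun i => fg (lift ord0 i)) a1 a1E.
have [f0r g0r] := fg ord0.
have T0 : germ_tensor p (fun q => f ord0 q.1 * g ord0 q.2 * b q).
  exists m, (fun i x => f ord0 x * f' i x), (fun i y => g ord0 y * g' i y); split.
    move=> i; have [fr gr] := fg' i.
    by split; [exact: germM | exact: germM].
  by move=> q; rewrite bE big_distrr; apply: eq_bigr => i _; rewrite mulrACA.
apply: germ_tensor_ext (germ_tensorD T0 IH) _ => q.
by rewrite aE big_ord_recl mulrDl.
Qed.

Lemma germ_tensor_neq0 p a : germ_tensor p a -> a p != 0 ->
  \forall q \near p, a q != 0.
Proof.
case: p => x y [n [f [g [fg aE]]]]; rewrite aE => a0.
have := prod_open_neq0 (fun i => (fg i).1) (fun i => (fg i).2) a0.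
by apply: filterS => q; rewrite aE.
Qed.

Lemma germ_tensor_near p a : germ_tensor p a ->
  \forall q \near p, germ_tensor q a.
Proof.
move=> [n [f [g [fg aE]]]].
have [U [f0 [oU Ux Uf0 Ef0]]] := germ_common (fun i => (fg i).1).
have [V [g0 [oV Vy Vg0 Eg0]]] := germ_common (fun i => (fg i).2).
apply: filterS (open_nbhsP (prod_open_box lX lY oU oV) (conj Ux Vy)).
move=> q [Uq Vq]; exists n, f, g; split=> // i; split.
  by exists U, (f0 i); split=> // x; [apply: Uf0 | apply: Ef0].
by exists V, (g0 i); split=> // x; [apply: Vg0 | apply: Eg0].
Qed.

Lemma prod_regular_tensor (p : XY) h : regular_at p h <->
  exists a b, [/\ germ_tensor p a, germ_tensor p b, b p != 0 &
    \forall q \near p, h q = a q / b q].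
Proof.
rewrite (prod_regularP lX lY); split.
  move=> [n [m [f [g [f' [g' [fg fg' n0 nE]]]]]]].
  exists (fun q => \sum_i f i q.1 * g i q.2), (fun q => \sum_i f' i q.1 * g' i q.2).
  by split=> //; [exists n, f, g | exists m, f', g'].
move=> [a [b [[n [f [g [fg aE]]]] [m [f' [g' [fg' bE]]]] b0 nE]]].
exists n, m, f, g, f', g'; split=> //; first by rewrite -bE.
by apply: filterS nE => q ->; rewrite aE bE.
Qed.

Lemma prod_regular_germ (p : XY) h : regular_at p h -> germ_regular p h.
Proof.
move=> /prod_regular_tensor[a [b [ta tb b0 /near_open[U [oU Up UE]]]]].
suff /near_open[V [oV Vp Vr]] : \forall q \near p, regular_at q h.
  by exists V, h; split.
have na := germ_tensor_near ta; have nb := germ_tensor_near tb.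
have nb0 := germ_tensor_neq0 tb b0; have nU := open_nbhsP oU Up.
near=> q; apply/prod_regular_tensor; exists a, b; split; try by near: q.
have Uq : U q by near: q.
by apply: filterS (open_nbhsP oU Uq) => r /UE.
Unshelve. all: by end_near. Qed.

Lemma prod_saturated : saturated XY.
Proof.
move=> p h [U [h0 [oU Ux Uh0 Eh0]]].
have /prod_regular_tensor[a [b [ta tb b0 nE]]] := Uh0 p Ux.
apply/prod_regular_tensor.
exists a, b; split=> //; apply: filterS2 nE (open_nbhsP oU Ux).
by move=> y <- /Eh0.
Qed.

Lemma prod_local : local_space XY.
Proof.
split.
- exact: prod_regular_germ.
- move=> p c; apply: prod_regular_germ; apply/prod_regular_tensor.
  exists (fun=> c), (fun=> 1); split; try exact: germ_tensorC.
    exact: oner_neq0.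
  by near=> q; rewrite divr1.
- move=> x h h' /prod_saturated/prod_regular_tensor[a [b [ta tb b0 nE]]].
  move=> /prod_saturated/prod_regular_tensor[a' [b' [ta' tb' b0' nE']]].
  apply: prod_regular_germ; apply/prod_regular_tensor.
  exists (fun q => a q * b' q + a' q * b q), (fun q => b q * b' q); split.
  + by apply: germ_tensorD; apply: germ_tensorM.
  + exact: germ_tensorM.
  + by rewrite mulf_neq0.
  have nb0 := germ_tensor_neq0 tb b0; have nb0' := germ_tensor_neq0 tb' b0'.
  near=> y; rewrite -addf_div; try by near: y.
  by congr (_ + _); near: y.
- move=> x h h' /prod_saturated/prod_regular_tensor[a [b [ta tb b0 nE]]].
  move=> /prod_saturated/prod_regular_tensor[a' [b' [ta' tb' b0' nE']]].
  apply: prod_regular_germ; apply/prod_regular_tensor.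
  exists (fun q => a q * a' q), (fun q => b q * b' q); split.
  + exact: germ_tensorM.
  + exact: germ_tensorM.
  + by rewrite mulf_neq0.
  near=> y; rewrite -mulf_div.
  by congr (_ * _); near: y.
- move=> x h /prod_saturated/prod_regular_tensor[a [b [ta tb b0 nE]]] hx.
  apply: prod_regular_germ; apply/prod_regular_tensor.
  exists b, a; split=> //.
    by apply: contraNneq hx => ax; rewrite (nbhs_singleton nE) ax mul0r.
  by near=> y; rewrite -invf_div; congr (_^-1); near: y.
- move=> x h /prod_saturated/prod_regular_tensor[a [b [ta tb b0 nE]]] hx.
  have ax : a x != 0.
    by apply: contraNneq hx => ax; rewrite (nbhs_singleton nE) ax mul0r.
  have na0 := germ_tensor_neq0 ta ax; have nb0 := germ_tensor_neq0 tb b0.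
  near=> y; have -> : h y = a y / b y by near: y.
  rewrite mulf_neq0 ?invr_eq0 //; by near: y.
Unshelve. all: by end_near. Qed.

Lemma fst_morphism (p : XY) : @morphism_at k XY X (fun q => q.1) p.
Proof.
split; first exact: fst_continuous.
move=> h hr; apply: prod_saturated.
apply: germ_eq_near (_ : germ_regular p (fun q : XY => h q.1 * 1)) _.
  apply: prod_regular_germ; apply/prod_regular_tensor.
  exists (fun q => h q.1 * 1), (fun=> 1); split.
  - apply: (@germ_tensor1 p h (fun=> 1)); first exact: regular_germ.
    exact: germ_cst.
  - exact: germ_tensorC.
  - exact: oner_neq0.
  by near=> q; rewrite divr1.
by near=> q; rewrite mulr1.
Unshelve. all: by end_near. Qed.

Lemma snd_morphism (p : XY) : @morphism_at k XY Y (fun q => q.2) p.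
Proof.
split; first exact: snd_continuous.
move=> h hr; apply: prod_saturated.
apply: germ_eq_near (_ : germ_regular p (fun q : XY => 1 * h q.2)) _.
  apply: prod_regular_germ; apply/prod_regular_tensor.
  exists (fun q => 1 * h q.2), (fun=> 1); split.
  - apply: (@germ_tensor1 p (fun=> 1) h); first exact: germ_cst.
    exact: regular_germ.
  - exact: germ_tensorC.
  - exact: oner_neq0.
  by near=> q; rewrite divr1.
by near=> q; rewrite mul1r.
Unshelve. all: by end_near. Qed.

Lemma prod_nbhs_basic (p : XY) (A : set XY) : nbhs p A ->
  exists s : seq (set XY),
    (forall W, W \in s -> prod_basic W /\ W p) /\
    forall q, (forall W, W \in s -> W q) -> A q.
Proof.
rewrite nbhsE => -[O [[D' sD' <-] [B DB Bp]] OA].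
have [E ED EB] := sD' _ DB; exists (finmap.enum_fset E); split.
  move=> W WE; split; first by have /set_mem := ED _ WE.
  by move: Bp; rewrite -EB; apply.
move=> q qE; apply: OA; exists B => //=.
by rewrite -EB => W WE; apply: qE.
Qed.

Section Pair.
Variables (Z : spaceFun k) (f : Z -> X) (g : Z -> Y) (z : Z).
Hypotheses (lZ : local_space Z) (cf : continuous_at z f) (cg : continuous_at z g).
Hypothesis rf : forall h, germ_regular (f z) h -> germ_regular z (h \o f).
Hypothesis rg : forall h, germ_regular (g z) h -> germ_regular z (h \o g).

Lemma germ_tensor_pair (a : XY -> k) : germ_tensor (f z, g z) a ->
  germ_regular z (fun w => a (f w, g w)).
Proof.
move=> [n [u [v [uv aE]]]].
have : germ_regular z (fun w => \sum_i (u i (f w) * v i (g w))).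
  apply: germ_sum => // i; have [ur vr] := uv i.
  apply: (germM lZ); first exact: (rf ur).
  exact: (rg vr).
move=> /germ_eq_near; apply; by near=> w; rewrite aE.
Unshelve. all: by end_near. Qed.

(** Only subbasic sets need checking: their nonvanishing condition pulls back to a germ at [z],
    which stays nonzero nearby. *)
Lemma pair_continuous : continuous_at z (fun w => (f w, g w) : XY).
Proof.
move=> A /prod_nbhs_basic[s [sW sA]].
suff : \forall w \near z, forall W, W \in s -> W (f w, g w).
  by apply: filterS => w wE; apply: sA => W WE; apply: wE.
elim: s sW {sA} => [|W s IHs] sW; first exact: nearW.
have {}IHs : \forall w \near z, forall W', W' \in s -> W' (f w, g w).
  by apply: IHs => W' W's; apply: sW; rewrite inE W's orbT.
have : \forall w \near z, W (f w, g w).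
  have [[U [V [n [u [v [oU oV ur vr ->]]]]]] [/= Uz Vz nz]] := sW W (mem_head _ _).
  have nU : \forall w \near z, U (f w) by apply: cf; apply: open_nbhsP.
  have nV : \forall w \near z, V (g w) by apply: cg; apply: open_nbhsP.
  have tz : germ_tensor (f z, g z) (fun q => \sum_i u i q.1 * v i q.2).
    exists n, u, v; split=> // i.
    by split; apply: regular_germ => //; [exact: ur | exact: vr].
  have nN := germ_neq0 lZ (germ_tensor_pair tz) nz.
  near=> w; split; by near: w.
move=> nW; near=> w => W'; rewrite inE => /predU1P[->|]; first by near: w.
by move: W'; near: w.
Unshelve. all: by end_near. Qed.

Lemma pair_germ h : @regular_at k XY (f z, g z) h ->
  germ_regular z (fun w => h (f w, g w)).
Proof.
move=> /prod_regular_tensor[a [b [ta tb b0 nE]]].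
have := germ_div lZ (germ_tensor_pair ta) (germ_tensor_pair tb) b0.
move=> /germ_eq_near; apply.
have nh : \forall w \near z, h (f w, g w) = a (f w, g w) / b (f w, g w).
  exact: pair_continuous nE.
by near=> w; symmetry; near: w.
Unshelve. all: by end_near. Qed.

End Pair.

(** The existence half of the universal property of the product. It yields the slices and all maps
    (a, x) to (a, u(a, x)) that define families. *)
Lemma pair_morphism (Z : spaceFun k) (f : Z -> X) (g : Z -> Y) (z : Z) :
  local_space Z -> saturated Z ->
  morphism_near f z -> morphism_near g z ->
  @morphism_at k Z XY (fun w => (f w, g w)) z.
Proof.
move=> lZ rZ mf mg.
have [cf _] := morphism_near_at mf; have [cg _] := morphism_near_at mg.
have rf h := @germ_comp_near k Z X f z h mf.
have rg h := @germ_comp_near k Z Y g z h mg.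
split; first exact: pair_continuous.
by move=> h hr; apply: rZ; apply: pair_germ hr.
Qed.

Lemma morphism_cst (Z : spaceFun k) (x : X) (z : Z) : local_space Z ->
  saturated Z ->
  morphism_at (fun _ : Z => x) z.
Proof.
move=> lZ rZ; split; first exact: cst_continuous.
by move=> h hr; apply: rZ; apply: germ_cst.
Qed.

End ProductSpace.

(** * Morphisms to the group of birational maps, and words in them *)

Section BirMorphisms.
Variables (k : fieldType) (X : spaceFun k) (hX : irreducible X).
Hypotheses (lX : local_space X) (sX : saturated X).
Local Notation Bir := (Bir hX).

Section Slices.
Variables (A : spaceFun k) (lA : local_space A).
Local Notation AX := (prod_space A X).

Lemma slice_morphism (a : A) (x : X) :
  @morphism_at k X AX (fun y => (a, y)) x.
Proof.
apply: pair_morphism => //; apply: nearW => y; last exact: morphism_at_id.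
exact: morphism_cst.
Qed.

Lemma slice_open (U : set AX) (a : A) : open U -> open [set x | U (a, x)].
Proof.
move=> oU; rewrite openE => x Ux.
by have [cf _] := slice_morphism a x; apply: cf; apply: open_nbhsP.
Qed.

Lemma slice_near (a : A) (x : X) (U : set AX) : open U -> U (a, x) ->
  \forall b \near a, U (b, x).
Proof.
move=> oU Ux.
have : continuous_at a (fun b => (b, x) : AX).
  apply: pair_continuous => //; first exact: cst_continuous.
  by move=> h hr; apply: germ_cst.
by apply; apply: open_nbhsP.
Qed.

(** As [phi] preserves the first coordinate, so does [psi]; both then restrict to the fibre over [a]
    through the slice and the second projection. *)
Lemma family_section (U V : set AX) (phi psi : AX -> AX) (a : A) :
  open_iso U V phi psi -> (forall p, U p -> (phi p).1 = p.1) ->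
  open_iso [set x | U (a, x)] [set x | V (a, x)]
    (fun x => (phi (a, x)).2) (fun x => (psi (a, x)).2).
Proof.
move=> [oU oV Uphi Vpsi] phi1.
have psi1 q : V q -> (psi q).1 = q.1.
  by move=> /Vpsi [Up pq _]; rewrite -{2}pq phi1.
split; try exact: slice_open.
- move=> x Ux; have [Vp gp mp] := Uphi _ Ux.
  have E : phi (a, x) = (a, (phi (a, x)).2) by rewrite [LHS]surjective_pairing phi1.
  split; [by rewrite /= -E | by rewrite -E gp |].
  apply: (morphism_comp (f := fun y => phi (a, y)) (g := fun p : AX => p.2)).
    by apply: morphism_comp mp; exact: slice_morphism.
  exact: snd_morphism.
move=> x Vx; have [Up gp mp] := Vpsi _ Vx.
have E : psi (a, x) = (a, (psi (a, x)).2) by rewrite [LHS]surjective_pairing psi1.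
split; [by rewrite /= -E | by rewrite -E gp |].
apply: (morphism_comp (f := fun y => psi (a, y)) (g := fun p : AX => p.2)).
  by apply: morphism_comp mp; exact: slice_morphism.
exact: snd_morphism.
Qed.

Definition family (U V : set AX) (phi psi : AX -> AX) : Prop :=
  [/\ open_iso U V phi psi,
        forall p, U p -> (phi p).1 = p.1,
        forall a, exists x, U (a, x) &
        forall a, exists x, V (a, x)].

Lemma bir_morphismP (b : A -> Bir) : bir_morphism b <->
  exists U V phi psi, family U V phi psi /\
    forall a, represents (b a) (fun x => (phi (a, x)).2).
Proof.
by split=> [[U [V [phi [psi [? ? ? ? ?]]]]]|[U [V [phi [psi [[? ? ? ?] ?]]]]]];
  exists U, V, phi, psi.
Qed.

Lemma family_bir_morphism U V phi psi : family U V phi psi ->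
  exists2 b : A -> Bir, bir_morphism b &
    forall a, represents (b a) (fun x => (phi (a, x)).2).
Proof.
move=> fP; have [isoP phi1 U0 V0] := fP.
pose f a := BirMap (family_section a isoP phi1) (U0 a).
have fr a : represents (bir_class hX (f a)) (fun x => (phi (a, x)).2).
  exists (f a) => //; exists setT; split=> //; first exact: openT.
  by have [x _] := U0 a; exists x.
by exists (fun a => bir_class hX (f a)) => //; apply/bir_morphismP; exists U, V, phi, psi.
Qed.

Lemma represents_uniq (b c : Bir) (h h' : X -> X) : represents b h ->
  represents c h' -> generically [set x | h x = h' x] -> b = c.
Proof.
move=> [f -> fh] [g -> gh] hh; apply/bir_classP.
apply: (generically_sub _ (generically_and hX (generically_and hX fh gh) hh)).
by move=> x [[/= -> ->]].
Qed.

Lemma represents_agree (b : Bir) (h h' : X -> X) : represents b h ->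
  represents b h' -> generically [set x | h x = h' x].
Proof.
move=> [f -> fh] [g /bir_classP fg gh].
apply: (generically_sub _ (generically_and hX (generically_and hX fh gh) fg)).
by move=> x [[/= -> ->]].
Qed.

Lemma represents_ext (b : Bir) (h h' : X -> X) : represents b h ->
  generically [set x | h x = h' x] -> represents b h'.
Proof.
move=> [f -> fh] hh; exists f => //.
by apply: (generically_sub _ (generically_and hX fh hh)) => x [/= -> ->].
Qed.

Lemma represents_mul (b c : Bir) (h h' : X -> X) :
  represents b h -> represents c h' -> represents (b * c)%g (h \o h').
Proof.
move=> [f -> fh] [g -> gh]; exists (birM hX f g); first exact: Bir_mulE.
apply: (generically_sub _ (generically_and hX gh (generically_preimage hX g fh))).
by move=> x [/= -> [_ /= ->]].
Qed.

Lemma bir_morphism_cst (b : Bir) : bir_morphism (fun _ : A => b).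
Proof.
rewrite -(bir_class_repr b); set f := repr b; apply/bir_morphismP.
have pairP (g : birmap X) (p : AX) : bir_dom g p.2 ->
    @morphism_at k AX AX (fun p => (p.1, g p.2)) p.
  move=> gp; have lAX := prod_local lA lX.
  apply: pair_morphism => //; first exact: prod_saturated.
    by apply: (morphism_near_open openT) => // q _; exact: fst_morphism.
  suff : \forall q \near p, bir_dom g q.2.
    apply: filterS => q gq; have [_ _ /(_ _ gq)[_ _ mg] _] := bir_iso g.
    by apply: (@morphism_comp k AX X X _ g) mg; exact: snd_morphism.
  by apply: snd_continuous => //; apply: open_nbhsP gp; apply: open_dom.
exists [set p : AX | setT p.1 /\ bir_dom f p.2], [set p : AX | setT p.1 /\ bir_cod f p.2].
exists (fun p => (p.1, f p.2)), (fun p => (p.1, bir_inv f p.2)); split; last first.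
  move=> a; exists f => //; exists setT; split=> //; first exact: openT.
  exact: hX.1.
split=> //.
- split.
  + by apply: prod_open_box => //; [exact: openT | exact: open_dom].
  + by apply: prod_open_box => //; [exact: openT | exact: open_cod].
  + move=> [a x] [_ /= dx]; have [cx fx] := bir_domP dx.
    by split; rewrite /= ?fx //; exact: pairP.
  + move=> [a x] [_ /= dx]; have [cx fx] := bir_codP dx.
    by split; rewrite /= ?fx //; exact: (pairP (birV f)).
- by move=> a; have [x] := bir_dom0 f; exists x.
- by move=> a; have [x] := bir_cod0 f; exists x.
Qed.

Lemma bir_morphism_mul (b c : A -> Bir) : bir_morphism b -> bir_morphism c ->
  bir_morphism (fun a => b a * c a)%g.
Proof.
move=> /bir_morphismP[U [V [phi [psi [[iP p1 U0 V0] bP]]]]].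
move=> /bir_morphismP[U' [V' [phi' [psi' [[iP' p1' U0' V0'] cP]]]]].
apply/bir_morphismP; have isoP := open_iso_comp iP iP'.
exists (U' `&` phi' @^-1` U), (V `&` psi @^-1` V'), (phi \o phi'), (psi' \o psi).
have E p : U' p -> phi' p = (p.1, (phi' p).2).
  by move=> U'p; rewrite [LHS]surjective_pairing p1'.
(* In the fibre over [a], the image of the map applied first and the domain of the other are
   nonempty open sets of an irreducible space, so they meet. Hence the domain of the composite still
   projects onto [A]. *)
have W0 a : exists x, U' (a, x) /\ U (phi' (a, x)).
  have [oU oV _ _] := iP; have [oU' oV' Uphi' Vpsi'] := iP'.
  have [y [/= V'y Uy]] : [set x | V' (a, x)] `&` [set x | U (a, x)] !=set0.
    by apply: hX.2; [exact: slice_open | exact: slice_open | exact: V0' | exact: U0].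
  have [Ux xy _] := Vpsi' _ V'y.
  exists (psi' (a, y)).2.
  have -> : (a, (psi' (a, y)).2) = psi' (a, y).
    by rewrite [RHS]surjective_pairing -(p1' _ Ux) xy.
  by rewrite xy.
split.
  split=> //.
  - by move=> p [U'p Up] /=; rewrite p1 // p1'.
  - move=> a; have [x [U'x Ux]] := W0 a.
    have [_ _ /(_ (a, x))[]// + _ _] := isoP.
    have -> : (phi \o phi') (a, x) = (a, ((phi \o phi') (a, x)).2).
      by rewrite [LHS]surjective_pairing /= p1 // p1'.
    by exists ((phi \o phi') (a, x)).2.
move=> a; apply: represents_ext (represents_mul (bP a) (cP a)) _.
have [oU' _ _ _] := iP'; have [x U'x] := U0' a.
exists [set y | U' (a, y)]; split; [exact: slice_open | by exists x |].
by move=> y /E /= ->.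
Qed.

Lemma bir_morphism_inv (b : A -> Bir) : bir_morphism b ->
  bir_morphism (fun a => (b a)^-1)%g.
Proof.
move=> /bir_morphismP[U [V [phi [psi [[iP p1 U0 V0] bP]]]]].
have [oU oV UP VP] := iP.
have psi1 q : V q -> (psi q).1 = q.1.
  by move=> /VP [Up pq _]; rewrite -{2}pq p1.
apply/bir_morphismP; exists V, U, psi, phi; split=> [|a].
  by split=> //; case: iP.
have [f bE fE] := bP a; exists (birV f); first by rewrite bE; exact: Bir_invE.
have Ua : generically [set x | U (a, x)].
  by apply: generically_open; [exact: slice_open | exact: U0].
apply: (generically_sub _ (generically_preimage hX (birV f)
  (generically_and hX fE Ua))).
move=> y [cy [/= fy Uy]]; have [_ ffy] := bir_codP cy.
have [Vy py _] := UP _ Uy.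
have E : (a, y) = phi (a, bir_inv f y).
  by rewrite [RHS]surjective_pairing p1 //= -fy ffy.
by rewrite /= E py.
Qed.

Hypothesis separated : forall x y : X, x <> y ->
  exists h, [/\ germ_regular x h, germ_regular y h & h x != h y].

Lemma represents1 : represents (1%g : Bir) id.
Proof.
exists (bir1 hX) => //; exists setT; split=> //; [exact: openT | exact: hX.1].
Qed.

(** Some [x] is moved by the member at [a], and a function h separates it from its image. The
    difference of h at the image and at the point is a germ that is nonzero near (a, x), so nearby
    members move points too. *)
Lemma bir_morphism_neq1 (b : A -> Bir) (a : A) : bir_morphism b ->
  b a <> 1%g -> \forall a' \near a, b a' <> 1%g.
Proof.
move=> /bir_morphismP[U [V [phi [psi [[iP p1 U0 V0] bP]]]]] ba.
have [oU _ UP _] := iP.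
have [x [Ux px]] : exists x, U (a, x) /\ (phi (a, x)).2 <> x.
  apply: contrapT => nx; apply: ba; apply: represents_uniq (bP a) represents1 _.
  exists [set y | U (a, y)]; split; [exact: slice_open | exact: U0 |].
  by move=> y Uy /=; apply: contrapT => py; apply: nx; exists y.
have [h [hr hr' hE]] := separated px.
have lAX := prod_local lA lX.
have Hr : germ_regular ((a, x) : AX) (fun p => h (phi p).2 - h p.2).
  apply: (germB lAX).
    apply: (germ_comp_near (f := fun p : AX => (phi p).2)) hr.
    apply: (morphism_near_open oU) => // p /UP[_ _ mp].
    by apply: (@morphism_comp k AX AX X phi) mp _; exact: snd_morphism.
  apply: (@germ_comp_near k AX X (fun p : AX => p.2) (a, x) h _ hr').
  by apply: (morphism_near_open openT) => // q _; exact: snd_morphism.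
have nz : h (phi (a, x)).2 - h x != 0 by rewrite subr_eq0.
have [W [oW Wx WP]] : exists W : set AX, [/\ open W, W (a, x) &
    forall p, W p -> U p /\ h (phi p).2 - h p.2 != 0].
  by apply: near_open; apply: filterI (open_nbhsP oU Ux) (germ_neq0 lAX Hr nz).
have := slice_near oW Wx; apply: filterS => a' Wa' ba'.
have := bP a'; rewrite ba' => /represents_agree/(_ represents1) ag.
have [|y [Wy /= yE]] := generically_dense hX ag (slice_open a' oW); first by exists x.
by have [_ /=] := WP _ Wy; rewrite yE subrr eqxx.
Qed.

End Slices.

Lemma irreducible_variety_local (A : spaceFun k) :
  irreducible_variety A -> local_space A.
Proof.
move=> [_ [n [U [aU UT]]] _]; apply: local_space_cover => a.
have : [set: A] a by []; rewrite -UT => -[i _ Ua].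
have [m [S [f [g fg]]]] := aU i.
by exists (affine_space S), (U i), setT, f, g; split=> //; exact: affine_local.
Qed.

(** Satisfied by words with constants. This form of continuity is stable under products of words,
    without any topology on a product of groups. *)
Definition algebraic_map (w : Bir -> Bir) : Prop :=
  forall (A : spaceFun k) (b : A -> Bir), local_space A ->
    bir_morphism b -> bir_morphism (w \o b).

Lemma algebraic_continuous w : algebraic_map w -> continuous w.
Proof.
move=> aw; apply/continuousP => F oF; rewrite -[open _]/(Bir_open _) => A b vA bm.
have := aw A b (irreducible_variety_local vA) bm.
exact: oF.
Qed.

Lemma algebraic_id : algebraic_map id.
Proof. by []. Qed.

Lemma algebraic_cst c : algebraic_map (fun=> c).
Proof. by move=> A b lA _; apply: bir_morphism_cst. Qed.

Lemma algebraic_mul w w' : algebraic_map w -> algebraic_map w' ->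
  algebraic_map (fun b => w b * w' b)%g.
Proof.
by move=> aw aw' A b lA bm; apply: bir_morphism_mul; [exact: lA | exact: aw | exact: aw'].
Qed.

Lemma algebraic_inv w : algebraic_map w -> algebraic_map (fun b => (w b)^-1)%g.
Proof. by move=> aw A b lA bm; apply: bir_morphism_inv; [exact: lA | exact: aw]. Qed.

Hypothesis separated : forall x y : X, x <> y ->
  exists h, [/\ germ_regular x h, germ_regular y h & h x != h y].

Lemma closed_algebraic_eq1 w : algebraic_map w -> closed [set b | w b = 1%g].
Proof.
move=> aw; rewrite -openC -[open _]/(Bir_open _) => A b vA bm.
have lA := irreducible_variety_local vA.
rewrite openE => a /= wa; have := bir_morphism_neq1 lA separated (aw A b lA bm) wa.
by [].
Qed.

(** An irreducible space is connected, since two nonempty open sets always meet, and [b] is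
    continuous by the very definition of the topology. *)
Lemma bir_morphism_connected (A : spaceFun k) (b : A -> Bir) :
  irreducible_variety A -> bir_morphism b -> connected (range b).
Proof.
move=> vA bm; apply: connected_continuous_connected; last first.
  apply: continuous_subspaceT; apply/continuousP => F oF.
  by apply: (oF A b vA bm).
move=> B [x Bx] [C oC BC] [D cD BD].
rewrite eqEsubset; split=> // y _; apply: contrapT => nBy.
have [[_ iA] _ _] := vA.
have C0 : C !=set0 by exists x; move: Bx; rewrite BC => -[].
have D0 : ~` D !=set0 by exists y => Dy; apply: nBy; rewrite BD.
have oD : open (~` D) by rewrite openC.
have [z [Cz nDz]] := iA C (~` D) oC oD C0 D0.
have : B z by rewrite BC.
by rewrite BD => -[_ /nDz].
Qed.

End BirMorphisms.

(** * The projective plane and families over the multiplicative group *)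

Local Notation pt := Defs.point.

Section Plane.
Variable k : closedFieldType.
Local Notation P2 := (P2 k).

Definition i0 : 'I_3 := inord 0.
Definition i1 : 'I_3 := inord 1.
Definition i2 : 'I_3 := inord 2.

Lemma I3P (P : 'I_3 -> Prop) : P i0 -> P i1 -> P i2 -> forall i, P i.
Proof.
move=> P0 P1 P2 i; have : i \in [:: i0; i1; i2].
  by rewrite !inE -!(inj_eq val_inj) /= !inordK //; case: i => -[|[|[|]]].
by rewrite !inE => /or3P[] /eqP ->.
Qed.

Definition affine_coord (x y : k) (i : 'I_3) : k := [:: x; y; 1]`_i.

Lemma affine_coordE x y : ((affine_coord x y i0 = x) * (affine_coord x y i1 = y)
  * (affine_coord x y i2 = 1))%type.
Proof. by rewrite /affine_coord /i0 /i1 /i2 !inordK. Qed.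

Lemma hcoord_pt x y : exists2 c : k, c != 0 &
  forall i, hcoord (pt x y) i = c * affine_coord x y i.
Proof.
have := P2_pick_neq0 (pt x y); have := memv_pick (val (pt x y)).
rewrite {2}/pt /= => /vlineP[c cE] v0; exists c; last first.
  by move=> i; rewrite /hcoord cE !mxE.
by apply: contraNneq v0 => c0; rewrite cE c0 scale0r.
Qed.

Definition chart : set P2 := [set p | hcoord p i2 != 0].
Definition xcoord (p : P2) : k := hcoord p i0 / hcoord p i2.
Definition ycoord (p : P2) : k := hcoord p i1 / hcoord p i2.

Lemma chart_pt x y : chart (pt x y).
Proof.
by rewrite /chart /=; have [c c0 ->] := hcoord_pt x y; rewrite affine_coordE mulr1.
Qed.

Lemma xcoord_pt x y : xcoord (pt x y) = x.
Proof.
rewrite /xcoord; have [c c0 E] := hcoord_pt x y.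
by rewrite !E !affine_coordE mulr1 mulrC mulKf.
Qed.

Lemma ycoord_pt x y : ycoord (pt x y) = y.
Proof.
rewrite /ycoord; have [c c0 E] := hcoord_pt x y.
by rewrite !E !affine_coordE mulr1 mulrC mulKf.
Qed.

Lemma hcoord_inj (p q : P2) (c : k) : c != 0 ->
  (forall i, hcoord p i = c * hcoord q i) -> p = q.
Proof.
move=> c0 E; apply/val_inj; rewrite (P2_line p) (P2_line q).
have -> : vpick (val p) = c *: vpick (val q).
  by apply/rowP => i; rewrite mxE; apply: E.
apply/eqP; rewrite eqEdim !dim_vline scaler_eq0 (negPf c0) !P2_pick_neq0 andbT.
by rewrite -memvE memvZ // memv_line.
Qed.

Lemma pt_coord p : chart p -> p = pt (xcoord p) (ycoord p).
Proof.
rewrite /chart /= => p2; have [c c0 E] := hcoord_pt (xcoord p) (ycoord p).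
apply: (@hcoord_inj p _ (hcoord p i2 / c)); first by rewrite mulf_neq0 ?invr_eq0.
move=> i; rewrite E mulrA divfK //.
by elim/I3P: i; rewrite affine_coordE ?mulr1 // mulrC divfK.
Qed.

Lemma pt_inj (x y x' y' : k) : pt x y = pt x' y' -> x = x' /\ y = y'.
Proof.
move=> E; split; first by rewrite -(xcoord_pt x y) E xcoord_pt.
by rewrite -(ycoord_pt x y) E ycoord_pt.
Qed.

Lemma germ_hcoord_ratio (p : P2) i j : hcoord p j != 0 ->
  germ_regular p (fun q : P2 => hcoord q i / hcoord q j).
Proof.
move=> pj; apply: P2_regular_germ.
exists 1%N, (mpolyX k (mnm1 i)), (mpolyX k (mnm1 j)); split.
- by rewrite /homogeneous dhomogX /= mdeg1.
- by rewrite /homogeneous dhomogX /= mdeg1.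
- by rewrite mevalXU.
by near=> q; rewrite !mevalXU.
Unshelve. all: by end_near. Qed.

Lemma open_chart : open chart.
Proof.
rewrite (_ : chart = [set p : P2 | meval (hcoord p) (mpolyX k (mnm1 i2)) != 0]).
  by apply: (@P2_open_neq0 _ 1); rewrite /homogeneous dhomogX /= mdeg1.
by apply/seteqP; split=> p /=; rewrite mevalXU.
Qed.

Lemma germ_xcoord p : chart p -> germ_regular p xcoord.
Proof. exact: germ_hcoord_ratio. Qed.

Lemma germ_ycoord p : chart p -> germ_regular p ycoord.
Proof. exact: germ_hcoord_ratio. Qed.

(** Some linear form vanishes at neither point. The quotients of the coordinates by it cannot all
    agree, for then the coordinates would be proportional. *)
Lemma P2_separated (p q : P2) : p <> q ->
  exists h, [/\ germ_regular p h, germ_regular q h & h p != h q].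
Proof.
move=> pq.
have nz (r : P2) : exists i, hcoord r i != 0.
  apply: contrapT => r0; have := P2_pick_neq0 r; case/negP; apply/eqP/rowP => i.
  rewrite mxE; apply: contrapT => ri; apply: r0; exists i; exact/eqP.
have [i pi] := nz p; have [j qj] := nz q.
have [a [b [lp lq]]] : exists a b : k,
    a * hcoord p i + b * hcoord p j != 0 /\ a * hcoord q i + b * hcoord q j != 0.
  have [qi|qi] := eqVneq (hcoord q i) 0; last by exists 1, 0; rewrite !mul1r !mul0r !addr0.
  have [pj|pj] := eqVneq (hcoord p j) 0; last by exists 0, 1; rewrite !mul1r !mul0r !add0r.
  by exists 1, 1; rewrite !mul1r qi pj addr0 add0r.
pose l (r : P2) := a * hcoord r i + b * hcoord r j.
have lr (r : P2) m : l r != 0 -> germ_regular r (fun s : P2 => hcoord s m / l s).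
  move=> r0; apply: P2_regular_germ.
  exists 1%N, (mpolyX k (mnm1 m)), (a *: mpolyX k (mnm1 i) + b *: mpolyX k (mnm1 j)); split.
  - by rewrite /homogeneous dhomogX /= mdeg1.
  - by apply: dhomogD; apply: rpredZ; rewrite dhomogX /= mdeg1.
  - by rewrite mevalD !mevalZ !mevalXU.
  by near=> s; rewrite mevalD !mevalZ !mevalXU.
have [m nE] : exists m, hcoord p m / l p != hcoord q m / l q.
  apply: contrapT => nE; apply: pq; apply: (@hcoord_inj p q (l p / l q)).
    by rewrite mulf_neq0 ?invr_eq0.
  move=> m; have : hcoord p m / l p = hcoord q m / l q.
    by apply: contrapT => /eqP E; apply: nE; exists m.
  move=> /(congr1 (fun t => t * l p)); rewrite divfK // => ->.
  by rewrite mulrC mulrA mulrAC.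
by exists (fun s : P2 => hcoord s m / l s); split; [exact: lr | exact: lr |].
Unshelve. all: by end_near. Qed.

Lemma meval_pt d (F : mpoly 3 k) x y : homogeneous d F ->
  exists2 c : k, c != 0 &
    meval (hcoord (pt x y)) F = c * meval (affine_coord x y) F.
Proof.
move=> hF; have [c c0 E] := hcoord_pt x y; exists (c ^+ d); first exact: expf_neq0.
exact: mevalZ_homog.
Qed.

Section PointMorphism.
Variables (Z : spaceFun k) (lZ : local_space Z) (sZ : saturated Z).
Variables (u v : Z -> k).

Lemma germ_affine_coord (z : Z) (F : mpoly 3 k) : germ_regular z u ->
  germ_regular z v -> germ_regular z (fun w => meval (affine_coord (u w) (v w)) F).
Proof.
move=> ur vr; apply: (germ_meval (u := fun i w => affine_coord (u w) (v w) i)) => // i.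
elim/I3P: i; rewrite /affine_coord /i0 /i1 /i2 !inordK //; exact: germ_cst.
Qed.

Lemma pt_morphism (z : Z) : germ_regular z u -> germ_regular z v ->
  morphism_at (fun w => pt (u w) (v w)) z.
Proof.
move=> ur vr.
have cpt : continuous_at z (fun w => pt (u w) (v w)).
  move=> A /near_open[O [oO Oz OA]].
  have [d [F [hF Fz FO]]] := P2_open_basic oO Oz.
  have Fz' : meval (affine_coord (u z) (v z)) F != 0.
    by have [c c0 E] := meval_pt (u z) (v z) hF; move: Fz; rewrite E mulf_eq0 negb_or => /andP[].
  have := germ_neq0 lZ (germ_affine_coord F ur vr) Fz'.
  apply: filterS => w Fw; apply/OA/FO.
  have [c c0 ->] := meval_pt (u w) (v w) hF.
  by rewrite mulf_neq0.
split=> // h [d [F [G [hF hG Gz nE]]]]; apply: sZ.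
have Gz' : meval (affine_coord (u z) (v z)) G != 0.
  by have [c c0 E] := meval_pt (u z) (v z) hG; move: Gz; rewrite E mulf_eq0 negb_or => /andP[].
have := germ_div lZ (germ_affine_coord F ur vr) (germ_affine_coord G ur vr) Gz'.
move=> /germ_eq_near; apply.
have nh : \forall w \near z, h (pt (u w) (v w)) =
    meval (hcoord (pt (u w) (v w))) F / meval (hcoord (pt (u w) (v w))) G.
  exact: cpt nE.
near=> w; have -> : (h \o (fun w => pt (u w) (v w))) w =
  meval (hcoord (pt (u w) (v w))) F / meval (hcoord (pt (u w) (v w))) G by near: w.
have [c c0 E] := hcoord_pt (u w) (v w).
rewrite (mevalZ_homog hF E) (mevalZ_homog hG E) -mulf_div divff ?mul1r //; exact: expf_neq0.
Unshelve. all: by end_near. Qed.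

End PointMorphism.

Lemma poly2_nonroot (g : {poly {poly k}}) : g != 0 ->
  exists x y : k, (g.[x%:P]).[y] != 0.
Proof.
(* With the variables exchanged, [x] is chosen off the roots of the leading coefficient, so that the
   specialised polynomial in [y] is nonzero. *)
rewrite -swapXY_eq0 -lead_coef_eq0 => /closed_nonrootP[x qx].
suff /closed_nonrootP[y gy] : g.[x%:P] != 0 by exists x, y.
rewrite -(swapXYK g) horner_swapXY; apply: contraNneq qx => g0.
rewrite /root lead_coefE; have := congr1 (fun p : {poly k} => p`_(size (swapXY g)).-1) g0.
by rewrite coef_map /= coef0 /horner_eval => ->.
Qed.

Lemma pt_chart_generic (g : {poly {poly k}}) : g != 0 ->
  generically [set p : P2 | chart p /\ (g.[(xcoord p)%:P]).[ycoord p] != 0].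
Proof.
move=> g0; exists (chart `&` [set p | (g.[(xcoord p)%:P]).[ycoord p] != 0]); split=> //.
- apply: open_germ_neq0 (@P2_local k) open_chart _ => p cp.
  apply: germ_horner2 (@P2_local k) _ _; [exact: germ_xcoord | exact: germ_ycoord].
have [x [y gxy]] := poly2_nonroot g0.
by exists (pt x y); split=> /=; [exact: chart_pt | rewrite xcoord_pt ycoord_pt].
Qed.

End Plane.

Section Mobius.
Variable k : closedFieldType.
Implicit Types a b c d x y : k.

Lemma mobiusK a b c d x : a * d - b * c != 0 -> c * x + d != 0 ->
  - c * mobius a b c d x + a != 0 /\
  mobius d (- b) (- c) a (mobius a b c d x) = x.
Proof.
move=> D0 x0.
have E : - c * mobius a b c d x + a = (a * d - b * c) / (c * x + d).
  by rewrite /mobius; field.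
split; first by rewrite E mulf_neq0 ?invr_eq0.
by rewrite {1}/mobius E /mobius; field; rewrite D0 x0.
Qed.

End Mobius.

Section AffineBasis.
Variables (k : fieldType) (n : nat) (S : set (mpoly n k)).

Lemma affine_open_basic (O : set (affine_space S)) (p : affine_space S) :
  open O -> O p -> exists2 F : mpoly n k, meval (sval p) F != 0 &
    forall w : affine_space S, meval (sval w) F != 0 -> O w.
Proof.
move=> [D' sD' <-] [A DA Ap].
have [E ED EA] := sD' _ DA.
pose s : seq (set (affine_space S)) := finmap.enum_fset E.
have sD (B : set (affine_space S)) : B \in s -> exists F : mpoly n k,
    B = [set w | meval (sval w) F != 0].
  by move=> /ED /set_mem [F _ <-]; exists F.
have sp B : B \in s -> B p by move=> Bs; move: Ap; rewrite -EA; apply.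
suff [F Fp FE] : exists2 F : mpoly n k, meval (sval p) F != 0 &
    forall w : affine_space S, meval (sval w) F != 0 -> forall B, B \in s -> B w.
  exists F => // w Fw; exists A => //=.
  by rewrite -EA => i iE; apply: FE Fw _ iE.
move: s sD sp {D' sD' DA A Ap ED EA} => /= s.
elim: s {E} => [|B s IHs] sD sp; first by exists 1; rewrite ?meval1 ?oner_neq0.
have [B' Bs|B' Bs|F Fp FE] := IHs.
- by apply: sD; rewrite inE Bs orbT.
- by apply: sp; rewrite inE Bs orbT.
have [G BE] := sD B (mem_head _ _).
have := sp B (mem_head _ _); rewrite BE /= => Gp.
exists (F * G); first by rewrite mevalM mulf_neq0.
move=> w; rewrite mevalM mulf_eq0 negb_or => /andP[Fw Gw] B'.
by rewrite inE => /predU1P[->|]; [exact: Gw | exact: FE].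
Qed.

End AffineBasis.

(** * The multiplicative group as the hyperbola x y = 1 *)

Section MultiplicativeGroup.
Variable k : closedFieldType.

Definition Gm_eqs : set (mpoly 2 k) :=
  [set mpolyX k (mnm1 ord0) * mpolyX k (mnm1 ord_max) - 1].
Definition Gm : spaceFun k := affine_space Gm_eqs.

Definition Gm_coord (v : Gm) : k := sval v ord0.

Lemma Gm_eq (v : Gm) : Gm_coord v * sval v ord_max = 1.
Proof.
have := svalP v _ erefl; rewrite mevalB mevalM !mevalXU meval1.
by move=> /eqP; rewrite subr_eq0 => /eqP.
Qed.

Lemma Gm_coord_neq0 v : Gm_coord v != 0.
Proof.
apply/eqP => v0; have := Gm_eq v; rewrite v0 mul0r => /eqP.
by rewrite eq_sym oner_eq0.
Qed.

Lemma Gm_val v : sval v = fun i => if i == ord0 then Gm_coord v else (Gm_coord v)^-1.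
Proof.
apply/funext => i; case: eqP => [->//|/eqP i0].
have -> : i = ord_max by apply/val_inj; case: i i0 => -[|[|]].
by apply: (mulfI (Gm_coord_neq0 v)); rewrite Gm_eq divff // Gm_coord_neq0.
Qed.

Lemma Gm_of_proof t : t != 0 -> forall F, Gm_eqs F ->
  meval (fun i : 'I_2 => if i == ord0 then t else t^-1) F = 0.
Proof.
by move=> t0 _ ->; rewrite mevalB mevalM !mevalXU meval1 /= divff // subrr.
Qed.

Definition Gm_of t (t0 : t != 0) : Gm := exist _ _ (Gm_of_proof t0).

Lemma Gm_coordK t (t0 : t != 0) : Gm_coord (Gm_of t0) = t.
Proof. by []. Qed.

Lemma Gm_inj v w : Gm_coord v = Gm_coord w -> v = w.
Proof. by move=> E; apply: eq_sig_hprop => [x p q|]; [exact: Prop_irrelevance | rewrite Gm_val E -Gm_val]. Qed.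

Lemma germ_Gm_coord (v : Gm) : germ_regular v Gm_coord.
Proof.
apply: affine_regular_germ; exists (mpolyX k (mnm1 ord0)), 1.
by rewrite meval1 oner_neq0; split=> //; near=> w; rewrite mevalXU meval1 divr1.
Unshelve. all: by end_near. Qed.

(** F(t, 1/t) multiplied by t to the power [msize F]. The power clears all denominators, so that
    nonvanishing on the hyperbola becomes nonvanishing of a polynomial in t. *)
Definition Gm_poly (F : mpoly 2 k) : {poly k} :=
  \sum_(m <- msupp F) mcoeff m F *: 'X^(m ord0 + (msize F - m ord_max)).

Lemma Gm_polyE F (v : Gm) :
  (Gm_poly F).[Gm_coord v] = Gm_coord v ^+ msize F * meval (sval v) F.
Proof.
rewrite mevalE horner_sum big_distrr /= big_seq [RHS]big_seq; apply: eq_bigr => m mF.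
rewrite hornerZ hornerXn mulrCA; congr (_ * _).
rewrite Gm_val !big_ord_recl big_ord0 /= mulr1.
rewrite (_ : lift ord0 ord0 = ord_max); last exact/val_inj.
have mN : (m ord_max <= msize F)%N.
  apply: leq_trans (ltnW (msize_mdeg_lt mF)).
  by rewrite mdegE (bigD1 ord_max) //= leq_addr.
rewrite exprD mulrCA; congr (_ * _).
by rewrite expfB_cond ?(negPf (Gm_coord_neq0 v)) // exprVn.
Qed.

Lemma Gm_irreducible : irreducible Gm.
Proof.
split; first by exists (Gm_of (oner_neq0 k)).
move=> U V oU oV [p Up] [q Vq].
have [F Fp FU] := affine_open_basic oU Up.
have [G Gq GV] := affine_open_basic oV Vq.
have nz H (v : Gm) : meval (sval v) H != 0 -> Gm_poly H != 0.
  move=> Hv; apply/eqP => H0; have := Gm_polyE H v; rewrite H0 horner0 => /eqP.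
  by rewrite eq_sym mulf_eq0 (negPf Hv) orbF expf_eq0 (negPf (Gm_coord_neq0 v)) andbF.
have /closed_nonrootP[t] : 'X * (Gm_poly F * Gm_poly G) != 0.
  by rewrite !mulf_neq0 ?polyX_eq0 ?(nz F p) ?(nz G q).
rewrite /root !hornerM hornerX !mulf_eq0 !negb_or => /and3P[t0 Ft Gt].
have E H : (Gm_poly H).[t] != 0 -> meval (sval (Gm_of t0)) H != 0.
  by rewrite -{1}(Gm_coordK t0) Gm_polyE mulf_eq0 negb_or => /andP[].
by exists (Gm_of t0); split; [apply/FU/E | apply/GV/E].
Qed.

Lemma Gm_variety : irreducible_variety Gm.
Proof.
split; first exact: Gm_irreducible.
  exists 1%N, (fun=> setT); split; last first.
    by apply/seteqP; split=> // v _; exists ord0.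
  move=> _; exists 2%N, Gm_eqs, id, id; split; try exact: openT.
    by move=> v _; split=> //; exact: morphism_at_id.
  by move=> v _; split=> //; exact: morphism_at_id.
have lG := affine_local Gm_eqs; have lGG := prod_local lG lG.
rewrite -openC openE => p /= p12.
have nE : Gm_coord p.1 - Gm_coord p.2 != 0.
  by rewrite subr_eq0; apply/eqP => /Gm_inj.
have r1 : germ_regular p (fun q : prod_space Gm Gm => Gm_coord q.1).
  apply: (@germ_comp_near k (prod_space Gm Gm) Gm (fun q => q.1) p).
    by apply: (morphism_near_open openT) => // q _; exact: fst_morphism.
  exact: germ_Gm_coord.
have r2 : germ_regular p (fun q : prod_space Gm Gm => Gm_coord q.2).
  apply: (@germ_comp_near k (prod_space Gm Gm) Gm (fun q => q.2) p).
    by apply: (morphism_near_open openT) => // q _; exact: snd_morphism.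
  exact: germ_Gm_coord.
have := germ_neq0 lGG (germB lGG r1 r2) nE.
by apply: filterS => q; apply: contraNnot => ->; rewrite subrr.
Qed.

End MultiplicativeGroup.

(** * Families of Jonquieres maps with polynomial coefficients *)

Section Families.
Variable k : closedFieldType.
Local Notation AP := (prod_space (Gm k) (P2 k)).
Local Notation Cr := (Cremona k).

Definition pt_map (F G : k -> k -> k) (p : P2 k) : P2 k :=
  pt (F (xcoord p) (ycoord p)) (G (xcoord p) (ycoord p)).

Lemma linear_poly_neq0 (u v u' v' : k) : u' * v - v' * u != 0 ->
  u *: 'X + v%:P != 0.
Proof.
apply: contraNneq => E.
have : (u *: 'X + v%:P)`_1 = 0 by rewrite E coef0.
have : (u *: 'X + v%:P)`_0 = 0 by rewrite E coef0.
rewrite !coefD !coefZ !coefX !coefC /= mulr1 mulr0 addr0 add0r => -> ->.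
by rewrite !mulr0 subrr.
Qed.

Lemma represents_in_coords (b : Cr) F G :
  represents b (pt_map F G) -> in_coords b F G.
Proof.
move=> [f -> fE]; exists f => //; apply: generically_sub fE => p /= fp x y pE.
by rewrite fp /pt_map pE xcoord_pt ycoord_pt.
Qed.

Lemma in_coords_represents (b : Cr) F G :
  in_coords b F G -> represents b (pt_map F G).
Proof.
move=> [f -> fE]; exists f => //.
have := @pt_chart_generic k 1 (oner_neq0 _).
move=> /(generically_and (@P2_irreducible k) fE); apply: generically_sub.
by move=> p /= [fp [cp _]]; apply: fp; apply: pt_coord.
Qed.

Definition eval2 (P : {poly {poly k}}) (t y : k) : k := (P.[t%:P]).[y].

Variables (A B C D : {poly {poly k}}) (a b c d : {poly k}).
Hypothesis det_fiber : forall t, t != 0 -> (A * D - B * C).[t%:P] != 0.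
Hypothesis det_base : forall t, t != 0 -> (a * d - b * c).[t] != 0.

Definition family_x t x y :=
  mobius (eval2 A t y) (eval2 B t y) (eval2 C t y) (eval2 D t y) x.
Definition family_y t y := mobius a.[t] b.[t] c.[t] d.[t] y.
Definition family_y' t y := mobius d.[t] (- b.[t]) (- c.[t]) a.[t] y.
Definition family_x' t x y :=
  mobius (eval2 D t y) (- eval2 B t y) (- eval2 C t y) (eval2 A t y) x.

Let T (q : AP) : k := Gm_coord q.1.
Let X (q : AP) : k := xcoord q.2.
Let Y (q : AP) : k := ycoord q.2.
Let W0 : set AP := [set q | [set: Gm k] q.1 /\ @chart k q.2].
Let den (q : AP) : k := c.[T q] * Y q + d.[T q].
Let den' (q : AP) : k := - c.[T q] * Y q + a.[T q].
(** The determinant is a factor because [det_fiber] only makes it a nonzero polynomial in y. Its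
    zeros have to be removed for the Moebius map in x to be invertible. *)
Let fden t x y : k := (eval2 C t y * x + eval2 D t y) * eval2 (A * D - B * C) t y.
Let fden' t x y : k := (- eval2 C t y * x + eval2 A t y) * eval2 (A * D - B * C) t y.
Let Y' (q : AP) : k := family_y' (T q) (Y q).

Let U : set AP := W0 `&` [set q | den q * fden (T q) (X q) (Y q) != 0].
Let W1 : set AP := W0 `&` [set q | den' q != 0].
Let V : set AP := W1 `&` [set q | fden' (T q) (X q) (Y' q) != 0].
Let Phi (q : AP) : AP :=
  (q.1, pt (family_x (T q) (X q) (Y q)) (family_y (T q) (Y q))).
Let Psi (q : AP) : AP := (q.1, pt (family_x' (T q) (X q) (Y' q)) (Y' q)).

Let lG : local_space (Gm k) := affine_local (@Gm_eqs k).
Let lP : local_space (P2 k) := @P2_local k.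
Let lAP : local_space AP := prod_local lG lP.
Let sAP : saturated AP := prod_saturated lG lP.

Let germ_T q : germ_regular q T.
Proof.
apply: (@germ_comp_near k AP (Gm k) (fun q => q.1) q); last exact: germ_Gm_coord.
by apply: (morphism_near_open openT) => // r _; exact: fst_morphism.
Qed.

Let germ_snd (q : AP) (h : P2 k -> k) : germ_regular q.2 h -> germ_regular q (fun r : AP => h r.2).
Proof.
move=> hr; apply: (@germ_comp_near k AP (P2 k) (fun q => q.2) q h _ hr).
by apply: (morphism_near_open openT) => // r _; exact: snd_morphism.
Qed.

Let germ_X q : W0 q -> germ_regular q X.
Proof. by move=> [_ cq]; apply: germ_snd; exact: germ_xcoord. Qed.

Let germ_Y q : W0 q -> germ_regular q Y.
Proof. by move=> [_ cq]; apply: germ_snd; exact: germ_ycoord. Qed.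

Let oW0 : open W0.
Proof. by apply: prod_open_box => //; [exact: openT | exact: open_chart]. Qed.

Let germ_poly (q : AP) (p : {poly k}) : germ_regular q (fun r => p.[T r]).
Proof. exact: germ_horner. Qed.

Let germ_eval2 (q : AP) (P : {poly {poly k}}) v : germ_regular q v ->
  germ_regular q (fun r => eval2 P (T r) (v r)).
Proof. by move=> vr; exact: germ_horner2. Qed.

Let germ_mobius (q : AP) u1 u2 u3 u4 v : germ_regular q u1 -> germ_regular q u2 ->
  germ_regular q u3 -> germ_regular q u4 -> germ_regular q v ->
  u3 q * v q + u4 q != 0 ->
  germ_regular q (fun r => mobius (u1 r) (u2 r) (u3 r) (u4 r) (v r)).
Proof.
by move=> r1 r2 r3 r4 rv nz; apply: germ_div => //; apply: germD => //; apply: germM.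
Qed.

Let germ_den q : W0 q -> germ_regular q den.
Proof. by move=> Wq; apply: germD => //; apply: germM => //; exact: germ_Y. Qed.

Let germ_den' q : W0 q -> germ_regular q den'.
Proof.
by move=> Wq; apply: germD => //; apply: germM => //; [exact: germN | exact: germ_Y].
Qed.

Let germ_fden (q : AP) x y : germ_regular q x -> germ_regular q y ->
  germ_regular q (fun r => fden (T r) (x r) (y r)).
Proof.
move=> xr yr; apply: germM => //; last exact: germ_eval2.
by apply: germD => //; [apply: germM => //|]; exact: germ_eval2.
Qed.

Let germ_fden' (q : AP) x y : germ_regular q x -> germ_regular q y ->
  germ_regular q (fun r => fden' (T r) (x r) (y r)).
Proof.
move=> xr yr; apply: germM => //; last exact: germ_eval2.
apply: germD => //; last exact: germ_eval2.
by apply: germM => //; apply: germN => //; exact: germ_eval2.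
Qed.

Let germ_Y' q : W1 q -> germ_regular q Y'.
Proof.
move=> [W0q nz]; apply: germ_mobius => //; try exact: germN.
exact: germ_Y.
Qed.

Let oU : open U.
Proof.
apply: open_germ_neq0 => // q W0q; apply: germM => //; first exact: germ_den.
by apply: germ_fden; [exact: germ_X | exact: germ_Y].
Qed.

Let oW1 : open W1.
Proof. by apply: open_germ_neq0 => // q W0q; exact: germ_den'. Qed.

Let oV : open V.
Proof.
apply: open_germ_neq0 => // q W1q; apply: germ_fden'; last exact: germ_Y'.
by case: W1q => W0q _; exact: germ_X.
Qed.

Let pair_pt_morphism (O : set AP) u v : open O ->
  (forall q, O q -> germ_regular q u) -> (forall q, O q -> germ_regular q v) ->
  forall q, O q -> @morphism_at k AP AP (fun r => (r.1, pt (u r) (v r))) q.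
Proof.
move=> oO ur vr q Oq; apply: pair_morphism => //.
  by apply: (morphism_near_open openT) => // r _; exact: fst_morphism.
apply: (morphism_near_open oO) => // r Or.
by apply: pt_morphism => //; [exact: ur | exact: vr].
Qed.

Let mPhi q : U q -> morphism_at Phi q.
Proof.
apply: (pair_pt_morphism oU) => {}q [W0q /=]; rewrite /fden !mulf_eq0 !negb_or
  => /and3P[d0 f0 _].
  apply: germ_mobius => //; try exact: germ_X; try exact: germ_eval2 (germ_Y W0q).
by apply: germ_mobius => //; exact: germ_Y.
Qed.

Let mPsi q : V q -> morphism_at Psi q.
Proof.
apply: (pair_pt_morphism oV) => {}q [W1q /=]; last by move=> _; exact: germ_Y'.
rewrite /fden' mulf_eq0 negb_or => /andP[f0 _].
have [W0q _] := W1q; have yr := germ_Y' W1q.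
apply: germ_mobius => //; try exact: germ_X; try apply: germN => //; exact: germ_eval2.
Qed.

Let det2 t y : eval2 (A * D - B * C) t y =
  eval2 A t y * eval2 D t y - eval2 B t y * eval2 C t y.
Proof. by rewrite /eval2 !hornerE. Qed.

Let det1 t : t != 0 -> a.[t] * d.[t] - b.[t] * c.[t] != 0.
Proof. by move=> /det_base; rewrite !hornerE. Qed.

Let PhiP q : U q -> V (Phi q) /\ Psi (Phi q) = q.
Proof.
case: q => v p [[_ cp] /=]; rewrite !mulf_eq0 !negb_or => /and3P[d0 f0 D0].
have [n1 e1] := mobiusK (det1 (Gm_coord_neq0 v)) d0.
have := D0; rewrite det2 => D0'.
have [n2 e2] := mobiusK D0' f0.
have EY : Y' (Phi (v, p)) = ycoord p.
  by rewrite /Y' /Y /Phi /= ycoord_pt /T /=; exact: e1.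
split; last first.
  rewrite /Psi EY /X /Phi /= xcoord_pt /T /= [RHS]surjective_pairing /=; congr (_, _).
  rewrite [RHS](pt_coord cp); congr (pt _ _); exact: e2.
split; last first.
  rewrite /= EY /X /Phi /= xcoord_pt /T /= /fden' mulf_neq0 //; exact: n2.
split; first by split=> //=; exact: chart_pt.
rewrite /= /den' /T /Y /Phi /= ycoord_pt; exact: n1.
Qed.

Let PsiP q : V q -> U (Psi q) /\ Phi (Psi q) = q.
Proof.
case: q => v p [[[_ cp] /= d0]]; rewrite /fden' mulf_eq0 negb_or => /andP[f0 D0].
have D1 : d.[Gm_coord v] * a.[Gm_coord v] - - b.[Gm_coord v] * - c.[Gm_coord v] != 0.
  by rewrite mulrNN mulrC det1 // Gm_coord_neq0.
have [n1] := mobiusK D1 d0; rewrite !opprK => e1.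
have := D0; rewrite det2 => D0'.
have D2 : eval2 D (T (v, p)) (Y' (v, p)) * eval2 A (T (v, p)) (Y' (v, p)) -
    - eval2 B (T (v, p)) (Y' (v, p)) * - eval2 C (T (v, p)) (Y' (v, p)) != 0.
  by rewrite mulrNN mulrC.
have [n2] := mobiusK D2 f0; rewrite !opprK => e2.
split; last first.
  rewrite /Phi /Psi /T /X /Y /= xcoord_pt ycoord_pt; congr (_, _).
  rewrite [RHS](pt_coord cp); congr (pt _ _); [exact: e2 | exact: e1].
split; first by split=> //=; exact: chart_pt.
rewrite /= /den /Psi /T /X /Y /= xcoord_pt ycoord_pt !mulf_neq0 //.
- by move: n1; rewrite opprK.
- by move: n2; rewrite opprK.
Qed.

(** The matrices and their adjugates give mutually inverse maps [Phi] and [Psi] over [Gm], on the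
    open sets where the denominators and the determinant do not vanish. *)
Lemma family_of_polys : exists2 beta : Gm k -> Cr, bir_morphism beta &
  forall v, in_coords (beta v) (family_x (Gm_coord v))
    (fun _ y => family_y (Gm_coord v) y).
Proof.
have isoP : open_iso U V Phi Psi.
  split=> // q Oq.
  - by have [? ?] := PhiP Oq; split=> //; exact: mPhi.
  - by have [? ?] := PsiP Oq; split=> //; exact: mPsi.
(* First [y] is chosen off the zeros of the base denominator and of the determinant, then [x] off
   the zero of the fibre denominator. *)
have U0 v : exists p, U (v, p).
  have t0 := Gm_coord_neq0 v; set t := Gm_coord v in t0.
  have nz : (c.[t] *: 'X + (d.[t])%:P) * (A * D - B * C).[t%:P] != 0.
    by rewrite mulf_neq0 ?det_fiber // (linear_poly_neq0 (det1 t0)).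
  have /closed_nonrootP[y] := nz; rewrite /root hornerM mulf_eq0 negb_or.
  rewrite hornerD hornerZ hornerX hornerC => /andP[y1 y2].
  have D0 : eval2 A t y * eval2 D t y - eval2 B t y * eval2 C t y != 0.
    by rewrite -det2.
  have nx := linear_poly_neq0 D0.
  have /closed_nonrootP[x] := nx; rewrite /root !hornerE => xn.
  exists (pt x y); split; first by split=> //; exact: chart_pt.
  rewrite /= /den /fden /T /X /Y /= xcoord_pt ycoord_pt -/t.
  by rewrite !mulf_neq0.
have fam : family U V Phi Psi.
  split=> // v; have [p Up] := U0 v; have [Vp _] := PhiP Up.
  by exists (Phi (v, p)).2.
have [beta bm bP] := family_bir_morphism (@P2_irreducible k) lP (@P2_saturated k) lG fam.
by exists beta => // v; apply: represents_in_coords; exact: bP.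
Qed.

End Families.

(** * Substitutions in rational functions *)

Section FractionEvaluation.
Variables (F L : fieldType) (iota : {rmorphism F -> L}) (u : L).
Local Notation tofrac := (@FracField.tofrac {poly F}).

Lemma frac_numden (R : idomainType) (h : {fraction R}) :
  h = FracField.tofrac \n_(repr h) / FracField.tofrac \d_(repr h).
Proof.
have dE : FracField.tofrac \d_(repr h) != 0 by rewrite tofrac_eq0 denom_ratioP.
apply: (mulIf dE); rewrite divfK // -{1}[h]reprK; unlock FracField.tofrac.
rewrite -[LHS]FracField.pi_mul; apply/eqmodP; rewrite /= FracField.equivfE /FracField.mulf.
by rewrite !numden_Ratio ?mulf_neq0 ?oner_neq0 ?denom_ratioP // !mulr1 mulrC.
Qed.

Lemma frac_ex (h : {fraction {poly F}}) :
  exists p q : {poly F}, q != 0 /\ h = tofrac p / tofrac q.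
Proof.
by exists \n_(repr h), \d_(repr h); split; [exact: denom_ratioP | exact: frac_numden].
Qed.

Lemma frac_cross (p q p' q' : {poly F}) : q != 0 -> q' != 0 ->
  tofrac p / tofrac q = tofrac p' / tofrac q' -> p * q' = p' * q.
Proof.
move=> q0 q'0 /eqP; rewrite eqr_div ?tofrac_eq0 // -!tofracM tofrac_eq => /eqP ->.
by rewrite mulrC.
Qed.

Definition poly_eval (p : {poly F}) : L := (map_poly iota p).[u].
Definition frac_eval (h : {fraction {poly F}}) : L :=
  poly_eval \n_(repr h) / poly_eval \d_(repr h).

Definition transcendental : Prop := forall p, p != 0 -> poly_eval p != 0.

Hypothesis tr : transcendental.

Lemma poly_evalD p q : poly_eval (p + q) = poly_eval p + poly_eval q.
Proof. by rewrite /poly_eval rmorphD hornerD. Qed.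

Lemma poly_evalN p : poly_eval (- p) = - poly_eval p.
Proof. by rewrite /poly_eval rmorphN hornerN. Qed.

Lemma poly_evalM p q : poly_eval (p * q) = poly_eval p * poly_eval q.
Proof. by rewrite /poly_eval rmorphM hornerM. Qed.

Lemma poly_evalC c : poly_eval c%:P = iota c.
Proof. by rewrite /poly_eval map_polyC hornerC. Qed.

Lemma poly_evalX : poly_eval 'X = u.
Proof. by rewrite /poly_eval map_polyX hornerX. Qed.

Lemma frac_evalE p q : q != 0 ->
  frac_eval (tofrac p / tofrac q) = poly_eval p / poly_eval q.
Proof.
move=> q0; rewrite /frac_eval; set h := tofrac p / tofrac q.
have d0 : \d_(repr h) != 0 by exact: denom_ratioP.
have := frac_cross d0 q0 (esym (frac_numden h)) => E.
apply/eqP; rewrite eqr_div; [|exact: tr|exact: tr].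
by rewrite -!poly_evalM E.
Qed.

Lemma frac_evalF p : frac_eval (tofrac p) = poly_eval p.
Proof.
have := @frac_evalE p 1 (oner_neq0 _); rewrite tofrac1 divr1 => ->.
by rewrite -[1]/(1%:P) poly_evalC rmorph1 divr1.
Qed.

(** The proof of transcendence is an argument so that the morphism structure can be attached to the
    name: evaluation is multiplicative and additive only if no denominator vanishes at [u]. *)
Definition frac_morph (_ : transcendental) := frac_eval.

Lemma frac_morph_zmod : zmod_morphism (frac_morph tr).
Proof.
move=> g h; rewrite /frac_morph; have [p [q [q0 ->]]] := frac_ex g.
have [p' [q' [q'0 ->]]] := frac_ex h.
rewrite -mulNr addf_div ?tofrac_eq0 // -tofracN -!tofracM -tofracD.
rewrite !frac_evalE ?mulf_neq0 // poly_evalD !poly_evalM poly_evalN -mulNr.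
by rewrite addf_div ?tr.
Qed.

Lemma frac_morph_monoid : monoid_morphism (frac_morph tr).
Proof.
split=> [|g h]; rewrite /frac_morph.
  by rewrite -tofrac1 frac_evalF -[1]/(1%:P) poly_evalC rmorph1.
have [p [q [q0 ->]]] := frac_ex g; have [p' [q' [q'0 ->]]] := frac_ex h.
rewrite mulf_div -!tofracM !frac_evalE ?mulf_neq0 // !poly_evalM.
by rewrite mulf_div.
Qed.

HB.instance Definition _ := GRing.isZmodMorphism.Build _ _ (frac_morph tr) frac_morph_zmod.
HB.instance Definition _ := GRing.isMonoidMorphism.Build _ _ (frac_morph tr) frac_morph_monoid.

End FractionEvaluation.

(** * Values of rational functions at generic points *)

Section GenericValues.
Variable k : closedFieldType.
Local Notation K := {fraction {poly k}}.
Local Notation tofrac := (@FracField.tofrac {poly k}).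

(** That is, off finitely many y. Identities between rational functions pass to [rat_eval] only in
    this sense, because it depends on the chosen numerators and denominators. *)
Definition gen1 (P : k -> Prop) : Prop :=
  exists2 q : {poly k}, q != 0 & forall y, q.[y] != 0 -> P y.

Lemma gen1_sub (P Q : k -> Prop) : (forall y, P y -> Q y) -> gen1 P -> gen1 Q.
Proof. by move=> PQ [q q0 qP]; exists q => // y /qP /PQ. Qed.

Lemma gen1_and (P Q : k -> Prop) : gen1 P -> gen1 Q -> gen1 (fun y => P y /\ Q y).
Proof.
move=> [q q0 qP] [r r0 rQ]; exists (q * r); first exact: mulf_neq0.
by move=> y; rewrite hornerM mulf_eq0 negb_or => /andP[/qP ? /rQ].
Qed.

Lemma gen1_neq0 (q : {poly k}) : q != 0 -> gen1 (fun y => q.[y] != 0).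
Proof. by exists q. Qed.

Lemma rat_evalE (p q : {poly k}) : q != 0 ->
  gen1 (fun y => rat_eval (tofrac p / tofrac q) y = p.[y] / q.[y]).
Proof.
move=> q0; set h := tofrac p / tofrac q.
have d0 : \d_(repr h) != 0 by exact: denom_ratioP.
have E := frac_cross d0 q0 (esym (frac_numden h)).
apply: gen1_sub (gen1_and (gen1_neq0 d0) (gen1_neq0 q0)) => y [dy qy].
by apply/eqP; rewrite eqr_div // -!hornerM E.
Qed.

Lemma rat_evalF (p : {poly k}) : gen1 (fun y => rat_eval (tofrac p) y = p.[y]).
Proof.
have := @rat_evalE p 1 (oner_neq0 _); rewrite tofrac1 divr1.
by apply: gen1_sub => y ->; rewrite hornerC divr1.
Qed.

Lemma rat_evalC c : gen1 (fun y => rat_eval (rat_const c) y = c).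
Proof. by apply: gen1_sub (rat_evalF c%:P) => y ->; rewrite hornerC. Qed.

Lemma rat_evalD (g h : K) :
  gen1 (fun y => rat_eval (g + h) y = rat_eval g y + rat_eval h y).
Proof.
have [p [q [q0 gE]]] := frac_ex g; have [p' [q' [q'0 hE]]] := frac_ex h.
have := @rat_evalE (p * q' + p' * q) (q * q') (mulf_neq0 q0 q'0).
rewrite tofracD !tofracM -addf_div ?tofrac_eq0 // -gE -hE.
have := gen1_and (rat_evalE p q0) (rat_evalE p' q'0); rewrite -gE -hE => R.
have R' := gen1_and (gen1_neq0 q0) (gen1_neq0 q'0).
move=> /(gen1_and (gen1_and R R')); apply: gen1_sub => y [[[-> ->] [qy q'y]] ->].
by rewrite hornerD !hornerM addf_div.
Qed.

Lemma rat_evalM (g h : K) :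
  gen1 (fun y => rat_eval (g * h) y = rat_eval g y * rat_eval h y).
Proof.
have [p [q [q0 gE]]] := frac_ex g; have [p' [q' [q'0 hE]]] := frac_ex h.
have := @rat_evalE (p * p') (q * q') (mulf_neq0 q0 q'0).
rewrite !tofracM -mulf_div -gE -hE.
have := gen1_and (rat_evalE p q0) (rat_evalE p' q'0); rewrite -gE -hE => R.
move=> /(gen1_and R); apply: gen1_sub => y [[-> ->] ->].
by rewrite !hornerM mulf_div.
Qed.

Lemma rat_evalN (h : K) : gen1 (fun y => rat_eval (- h) y = - rat_eval h y).
Proof.
have [p [q [q0 hE]]] := frac_ex h.
have := rat_evalE (- p) q0; rewrite tofracN mulNr -hE.
have R := rat_evalE p q0; rewrite -hE in R.
by move=> /(gen1_and R); apply: gen1_sub => y [-> ->]; rewrite hornerN mulNr.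
Qed.

Lemma rat_evalB (g h : K) :
  gen1 (fun y => rat_eval (g - h) y = rat_eval g y - rat_eval h y).
Proof.
by apply: gen1_sub (gen1_and (rat_evalD g (- h)) (rat_evalN h)) => y [-> ->].
Qed.

Lemma rat_eval_neq0 (h : K) : h != 0 -> gen1 (fun y => rat_eval h y != 0).
Proof.
have [p [q [q0 ->]]] := frac_ex h => h0.
have p0 : p != 0 by apply: contraNneq h0 => ->; rewrite tofrac0 mul0r.
apply: gen1_sub (gen1_and (rat_evalE p q0) (gen1_and (gen1_neq0 p0) (gen1_neq0 q0))).
by move=> y [-> [py qy]]; rewrite mulf_neq0 ?invr_eq0.
Qed.

Lemma rat_evalV (h : K) : gen1 (fun y => rat_eval h^-1 y = (rat_eval h y)^-1).
Proof.
have [->|h0] := eqVneq h 0.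
  have E := rat_evalC 0; rewrite /rat_const polyC0 tofrac0 in E.
  by apply: gen1_sub E => y; rewrite invr0 => ->; rewrite invr0.
have := gen1_and (rat_evalM h h^-1) (gen1_and (rat_eval_neq0 h0) (rat_evalC 1)).
rewrite divff //; apply: gen1_sub => y []; rewrite /rat_const polyC1 tofrac1.
move=> E [hy E1]; apply: (mulfI hy); rewrite -E E1 divff //.
Qed.

End GenericValues.

(** * Substituting a Moebius map into a rational function *)

Section Substitution.
Variable k : closedFieldType.
Local Notation K := {fraction {poly k}}.
Local Notation tofrac := (@FracField.tofrac {poly k}).

Implicit Types m : 'M[k]_2.

Definition const_frac : {rmorphism k -> K} := tofrac \o polyC.

(** Over an algebraically closed field a polynomial is a product of linear factors, and none of
    these vanishes at a nonconstant element. *)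
Lemma transcendental_nonconst (L : fieldType) (iota : {rmorphism k -> L}) (u : L) :
  (forall c, u != iota c) -> transcendental iota u.
Proof.
move=> uc p p0; have [r pE] := closed_field_poly_normal p.
rewrite pE -mul_polyC poly_evalM poly_evalC mulf_neq0 ?fmorph_eq0 ?lead_coef_eq0 //.
elim: r {pE} => [|c r IHr]; first by rewrite big_nil -[1]/(1%:P) poly_evalC rmorph1 oner_neq0.
rewrite big_cons poly_evalM mulf_neq0 // poly_evalD poly_evalX poly_evalN poly_evalC.
by rewrite subr_eq0.
Qed.

Lemma frac_rmorph_ext (L : fieldType) (f g : {rmorphism K -> L}) :
  (forall c, f (rat_const c) = g (rat_const c)) -> f (rat_y k) = g (rat_y k) ->
  f =1 g.
Proof.
move=> fgC fgX h.
have fgF p : f (tofrac p) = g (tofrac p).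
  elim/poly_ind: p => [|p c IHp]; first by rewrite tofrac0 !rmorph0.
  by rewrite tofracD tofracM !rmorphD !rmorphM IHp [f (tofrac 'X)]fgX [f (tofrac c%:P)]fgC.
by have [p [q [_ ->]]] := frac_ex h; rewrite !rmorphM !fmorphV !fgF.
Qed.

Lemma det2E (R : comPzRingType) (m : 'M[R]_2) :
  \det m = m 0 0 * m 1 1 - m 0 1 * m 1 0.
Proof.
rewrite (expand_det_row _ 0) !big_ord_recl big_ord0 addr0 /cofactor /=.
rewrite !det_mx11 !mxE /= expr0 expr1 mul1r.
have E1 : lift ord0 ord0 = 1 :> 'I_2 by exact/val_inj.
have E0 : lift (1 : 'I_2) ord0 = 0 by exact/val_inj.
by rewrite E1 E0 mulN1r mulrN.
Qed.

Definition mob (m : 'M[k]_2) : k -> k := mobius (m 0 0) (m 0 1) (m 1 0) (m 1 1).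

Definition mob_frac (m : 'M[k]_2) : K :=
  (rat_const (m 0 0) * rat_y k + rat_const (m 0 1)) /
  (rat_const (m 1 0) * rat_y k + rat_const (m 1 1)).

Definition subst (m : 'M[k]_2) : K -> K := frac_eval const_frac (mob_frac m).

Lemma linear_frac_neq0 (a b : k) : (a, b) != (0, 0) ->
  rat_const a * rat_y k + rat_const b != 0.
Proof.
rewrite /rat_const /rat_y -tofracM -tofracD tofrac_eq0; apply: contraNneq => E.
have : (a%:P * 'X + b%:P)`_1 = 0 by rewrite E coef0.
have : (a%:P * 'X + b%:P)`_0 = 0 by rewrite E coef0.
rewrite !coefD !coefCM !coefX !coefC /= mulr1 mulr0 addr0 add0r => -> ->.
by [].
Qed.

Lemma unitmx2P (m : 'M[k]_2) : (m \in unitmx) = (m 0 0 * m 1 1 - m 0 1 * m 1 0 != 0).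
Proof. by rewrite unitmxE unitfE det2E. Qed.

Lemma mob_den_neq0 m : m \in unitmx ->
  rat_const (m 1 0) * rat_y k + rat_const (m 1 1) != 0.
Proof.
rewrite unitmx2P => m0; apply: linear_frac_neq0; apply: contraNneq m0.
by move=> [-> ->]; rewrite !mulr0 subrr.
Qed.

Lemma mob_frac_nonconst m : m \in unitmx -> forall c, mob_frac m != const_frac c.
Proof.
move=> mu c; have d0 := mob_den_neq0 mu; move: mu; rewrite unitmx2P.
apply: contraNneq => E.
have : mob_frac m * (rat_const (m 1 0) * rat_y k + rat_const (m 1 1)) =
       rat_const c * (rat_const (m 1 0) * rat_y k + rat_const (m 1 1)) by rewrite E.
rewrite /mob_frac divfK // /rat_const /rat_y -!tofracM -!tofracD -!tofracM => /eqP.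
rewrite tofrac_eq => /eqP {}E.
have := congr1 (fun p : {poly k} => p`_1) E; have := congr1 (fun p : {poly k} => p`_0) E.
rewrite !(coefCM, coefD, coefX, coefC) /= !mulr1 !mulr0 !addr0 !add0r => -> ->.
by rewrite mulrAC subrr.
Qed.

Lemma mob_frac_tr m : m \in unitmx -> transcendental const_frac (mob_frac m).
Proof. by move=> /mob_frac_nonconst; exact: transcendental_nonconst. Qed.

Definition subst_morph m (mu : m \in unitmx) : {rmorphism K -> K} :=
  frac_morph (mob_frac_tr mu).

Lemma subst_morphE m (mu : m \in unitmx) h : subst_morph mu h = subst m h.
Proof. by []. Qed.

Lemma substC m c : m \in unitmx -> subst m (rat_const c) = rat_const c.
Proof. by move=> mu; rewrite /subst frac_evalF ?poly_evalC //; exact: mob_frac_tr. Qed.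

Lemma substX m : m \in unitmx -> subst m (rat_y k) = mob_frac m.
Proof. by move=> mu; rewrite /subst frac_evalF ?poly_evalX //; exact: mob_frac_tr. Qed.

Lemma mobius_comp (F : fieldType) (a b c d a' b' c' d' y : F) : c * y + d != 0 ->
  (a' * ((a * y + b) / (c * y + d)) + b') / (c' * ((a * y + b) / (c * y + d)) + d') =
  ((a' * a + b' * c) * y + (a' * b + b' * d)) /
  ((c' * a + d' * c) * y + (c' * b + d' * d)).
Proof.
move=> n0.
have E u v : u * ((a * y + b) / (c * y + d)) + v =
    ((u * a + v * c) * y + (u * b + v * d)) / (c * y + d).
  by field.
by rewrite !E invf_div mulrA divfK.
Qed.

Lemma mulmx2E (R : pzRingType) (m n : 'M[R]_2) i j :
  (m *m n) i j = m i 0 * n 0 j + m i 1 * n 1 j.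
Proof.
rewrite mxE !big_ord_recl big_ord0 addr0.
have E1 : lift ord0 ord0 = 1 :> 'I_2 by exact/val_inj.
by rewrite E1.
Qed.

Lemma subst_mob m m' : m \in unitmx -> m' \in unitmx ->
  subst m (mob_frac m') = mob_frac (m' *m m).
Proof.
move=> mu mu'; rewrite -(subst_morphE mu) /mob_frac.
rewrite !(rmorphM, fmorphV, rmorphD) !subst_morphE substX // !substC //.
rewrite /mob_frac mobius_comp ?mob_den_neq0 // !mulmx2E.
by rewrite /rat_const !polyCD !polyCM !tofracD !tofracM.
Qed.

(** Both sides are field morphisms, so constants and y suffice. The matrices come in reverse order
    because substitution is contravariant. *)
Lemma subst_comp m m' h : m \in unitmx -> m' \in unitmx ->
  subst m (subst m' h) = subst (m' *m m) h.
Proof.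
move=> mu mu'; have mu'' : m' *m m \in unitmx by rewrite unitmx_mul mu' mu.
have := @frac_rmorph_ext _ (subst_morph mu \o subst_morph mu') (subst_morph mu'').
apply => [c|] /=; rewrite !subst_morphE; first by rewrite !substC.
by rewrite !substX // subst_mob.
Qed.

Lemma subst1 h : subst 1%:M h = h.
Proof.
have mu := unitmx1 k 2.
have := @frac_rmorph_ext _ (subst_morph mu) idfun; apply => [c|] /=.
  by rewrite subst_morphE substC.
rewrite subst_morphE substX // /mob_frac !mxE /= /rat_const polyC0 polyC1 tofrac0 tofrac1.
by rewrite mul1r mul0r addr0 add0r divr1.
Qed.

Lemma subst_scale m (c : k) h : c != 0 -> subst (c *: m) h = subst m h.
Proof.
move=> c0; rewrite /subst (_ : mob_frac (c *: m) = mob_frac m) //.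
rewrite /mob_frac !mxE /rat_const !polyCM !tofracM -!mulrA -!mulrDr -mulf_div divff ?mul1r //.
by rewrite tofrac_eq0 polyC_eq0.
Qed.

Lemma rat_eval_mob m : m \in unitmx ->
  gen1 (fun y => rat_eval (mob_frac m) y = mob m y).
Proof.
move=> mu; rewrite /mob_frac /rat_const /rat_y -!tofracM -!tofracD.
have d0 := mob_den_neq0 mu; rewrite /rat_const /rat_y -tofracM -tofracD tofrac_eq0 in d0.
apply: gen1_sub (rat_evalE ((m 0 0)%:P * 'X + (m 0 1)%:P) d0) => y ->.
by rewrite !hornerE.
Qed.

Lemma rat_eval_poly_eval (u : K) p :
  gen1 (fun y => rat_eval (poly_eval const_frac u p) y = p.[rat_eval u y]).
Proof.
elim/poly_ind: p => [|p c IHp].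
  by apply: gen1_sub (rat_evalC 0) => y; rewrite -polyC0 poly_evalC hornerC.
rewrite poly_evalD poly_evalM poly_evalX poly_evalC.
have R1 := rat_evalD (poly_eval const_frac u p * u) (const_frac c).
have R2 := rat_evalM (poly_eval const_frac u p) u.
apply: gen1_sub (gen1_and (gen1_and R1 R2) (gen1_and (rat_evalC c) IHp)).
by move=> y [[-> ->] [cE ->]]; rewrite [rat_eval (const_frac c) y]cE hornerMXaddC.
Qed.

(** The exceptional polynomial, evaluated at the nonconstant function [mob_frac m], is a nonzero
    rational function. *)
Lemma gen1_mob m (P : k -> Prop) : m \in unitmx -> gen1 P ->
  gen1 (fun y => P (mob m y)).
Proof.
move=> mu [q q0 qP].
have := rat_eval_neq0 (mob_frac_tr mu q0).
move=> /(gen1_and (gen1_and (rat_eval_poly_eval (mob_frac m) q) (rat_eval_mob mu))).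
by apply: gen1_sub => y [[-> ->] /qP].
Qed.

Lemma rat_eval_subst m h : m \in unitmx ->
  gen1 (fun y => rat_eval (subst m h) y = rat_eval h (mob m y)).
Proof.
move=> mu; have [p [q [q0 ->]]] := frac_ex h.
rewrite /subst frac_evalE //; last exact: mob_frac_tr.
have R1 := rat_evalM (poly_eval const_frac (mob_frac m) p)
  (poly_eval const_frac (mob_frac m) q)^-1.
have R2 := rat_evalV (poly_eval const_frac (mob_frac m) q).
have R3 := gen1_and (rat_eval_poly_eval (mob_frac m) p) (rat_eval_poly_eval (mob_frac m) q).
have R4 := gen1_and (rat_eval_mob mu) (gen1_mob mu (rat_evalE p q0)).
apply: gen1_sub (gen1_and (gen1_and R1 R2) (gen1_and R3 R4)).
by move=> y [[-> ->] [[-> ->] [-> ->]]].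
Qed.

End Substitution.

(** * The Jonquieres group *)

Section JonquieresElements.
Variable k : closedFieldType.
Local Notation K := {fraction {poly k}}.
Local Notation tofrac := (@FracField.tofrac {poly k}).
Local Notation Cr := (Cremona k).
Implicit Types (A B C D : K) (m : 'M[k]_2).

Definition gen2 (P : k -> k -> Prop) : Prop :=
  exists2 g : {poly {poly k}}, g != 0 & forall x y, (g.[x%:P]).[y] != 0 -> P x y.

Lemma gen2_sub (P Q : k -> k -> Prop) :
  (forall x y, P x y -> Q x y) -> gen2 P -> gen2 Q.
Proof. by move=> PQ [q q0 qP]; exists q => // x y /qP /PQ. Qed.

Lemma gen2_and (P Q : k -> k -> Prop) :
  gen2 P -> gen2 Q -> gen2 (fun x y => P x y /\ Q x y).
Proof.
move=> [q q0 qP] [r r0 rQ]; exists (q * r); first exact: mulf_neq0.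
by move=> x y; rewrite !hornerM mulf_eq0 negb_or => /andP[/qP ? /rQ].
Qed.

Lemma gen1_gen2 (P : k -> Prop) : gen1 P -> gen2 (fun _ y => P y).
Proof.
move=> [q q0 qP]; exists q%:P; first by rewrite polyC_eq0.
by move=> x y; rewrite hornerC => /qP.
Qed.

Lemma common_denominator (s : seq K) : exists2 q : {poly k}, q != 0 &
  forall h, h \in s -> exists p, h = tofrac p / tofrac q.
Proof.
elim: s => [|h s [q q0 IHs]]; first by exists 1; rewrite ?oner_neq0.
have [p [r [r0 hE]]] := frac_ex h.
have r0' : tofrac r != 0 by rewrite tofrac_eq0.
have q0' : tofrac q != 0 by rewrite tofrac_eq0.
exists (q * r); first exact: mulf_neq0.
move=> g; rewrite inE => /predU1P[->|/IHs[p' ->]].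
  by exists (q * p); rewrite hE !tofracM -mulf_div divff // mul1r.
by exists (p' * r); rewrite !tofracM -mulf_div (divff r0') mulr1.
Qed.

(** Two Moebius maps in x agree where a quadratic in x vanishes. Generic agreement thus forces all
    three coefficients to be zero. *)
Lemma gen2_quadratic (e0 e1 e2 : K) : [|| e0 != 0, e1 != 0 | e2 != 0] ->
  gen2 (fun x y => rat_eval e2 y * x ^+ 2 + rat_eval e1 y * x + rat_eval e0 y != 0).
Proof.
move=> e_neq0; have [q q0 qE] := common_denominator [:: e0; e1; e2].
have [p0 E0] := qE e0 (mem_head _ _).
have [p1 E1] : exists p, e1 = tofrac p / tofrac q by apply: qE; rewrite !inE eqxx orbT.
have [p2 E2] : exists p, e2 = tofrac p / tofrac q by apply: qE; rewrite !inE eqxx !orbT.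
have nz (p : {poly k}) : tofrac p / tofrac q != 0 -> p != 0.
  by apply: contraNneq => ->; rewrite tofrac0 mul0r.
pose g : {poly {poly k}} := Poly [:: p0; p1; p2].
have gE x y : (g.[x%:P]).[y] = p2.[y] * x ^+ 2 + p1.[y] * x + p0.[y].
  by rewrite /g horner_Poly /= !hornerE /=; ring.
have g0 : g != 0.
  apply: contraTneq e_neq0 => g0.
  have c i : g`_i = 0 by rewrite g0 coef0.
  have := c 0%N; have := c 1%N; have := c 2%N; rewrite /g !coef_Poly /= => c2 c1 c0.
  by rewrite E0 E1 E2 c0 c1 c2 tofrac0 mul0r eqxx.
have gg : gen2 (fun x y => (g.[x%:P]).[y] != 0) by exists g.
have R0 := gen1_gen2 (rat_evalE p0 q0); rewrite -E0 in R0.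
have R1 := gen1_gen2 (rat_evalE p1 q0); rewrite -E1 in R1.
have R2 := gen1_gen2 (rat_evalE p2 q0); rewrite -E2 in R2.
have R := gen2_and gg (gen1_gen2 (gen1_neq0 q0)).
apply: gen2_sub (gen2_and R (gen2_and R0 (gen2_and R1 R2))).
move=> x y [[gxy qy] [-> [-> ->]]].
rewrite (_ : _ + _ = (g.[x%:P]).[y] / q.[y]); last by rewrite gE; field.
by rewrite mulf_neq0 ?invr_eq0.
Qed.

Lemma gen2_linear (e0 e1 : K) : (e0 != 0) || (e1 != 0) ->
  gen2 (fun x y => rat_eval e1 y * x + rat_eval e0 y != 0).
Proof.
have or3 (a b c : bool) : a || b -> [|| a, b | c] by case: a => //= ->.
move=> e_neq0; have := @gen2_quadratic e0 e1 0 (or3 _ _ _ e_neq0).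
have E0 := gen1_gen2 (rat_evalC (0 : k)); rewrite /rat_const polyC0 tofrac0 in E0.
by move=> /(gen2_and E0); apply: gen2_sub => x y [->]; rewrite mul0r add0r.
Qed.

Lemma gen2_generically (P : k -> k -> Prop) : gen2 P ->
  generically [set p : P2 k | chart p /\ P (xcoord p) (ycoord p)].
Proof.
move=> [g g0 gP]; apply: generically_sub (pt_chart_generic g0) => p [cp gp].
by split=> //; apply: gP.
Qed.

Lemma in_coords_uniq (b c : Cr) F G F' G' : in_coords b F G ->
  in_coords c F' G' -> gen2 (fun x y => F x y = F' x y /\ G x y = G' x y) -> b = c.
Proof.
move=> /in_coords_represents br /in_coords_represents cr E.
apply: represents_uniq br cr _; apply: generically_sub (gen2_generically E).
by move=> p /= [_ [FE GE]]; rewrite /pt_map FE GE.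
Qed.

Lemma in_coords_eq (b : Cr) F G F' G' : in_coords b F G ->
  gen2 (fun x y => F x y = F' x y /\ G x y = G' x y) -> in_coords b F' G'.
Proof.
move=> /in_coords_represents br E; apply: represents_in_coords.
apply: represents_ext br _; apply: generically_sub (gen2_generically E).
by move=> p /= [_ [FE GE]]; rewrite /pt_map FE GE.
Qed.

Lemma in_coords_agree (b : Cr) F G F' G' (Q : k -> k -> Prop) : in_coords b F G ->
  in_coords b F' G' -> gen2 Q ->
  exists x y, [/\ Q x y, F x y = F' x y & G x y = G' x y].
Proof.
move=> /in_coords_represents br /in_coords_represents br' /gen2_generically Qg.
have [O [oO O0 OP]] := generically_and (@P2_irreducible k) (represents_agree br br') Qg.
have [p /OP[/= E [_ Qp]]] := O0.
by exists (xcoord p), (ycoord p); have [] := pt_inj E.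
Qed.

Lemma in_coords_mul (b c : Cr) F G F' G' : in_coords b F G -> in_coords c F' G' ->
  in_coords (b * c)%g (fun x y => F (F' x y) (G' x y)) (fun x y => G (F' x y) (G' x y)).
Proof.
move=> /in_coords_represents br /in_coords_represents cr.
apply: represents_in_coords; apply: represents_ext (represents_mul br cr) _.
exists setT; split; [exact: openT | exact: (@P2_irreducible k).1 |].
by move=> p _; rewrite /pt_map /= xcoord_pt ycoord_pt.
Qed.

Definition jonq_coords (b : Cr) A B C D m : Prop :=
  in_coords b (rat_mobius A B C D) (fun _ y => mob m y).

Lemma mobius_scale (F : fieldType) (l a b c d x : F) : l != 0 ->
  ((l * a) * x + l * b) / ((l * c) * x + l * d) = (a * x + b) / (c * x + d).
Proof. by move=> l0; rewrite -!mulrA -!mulrDr -mulf_div divff // mul1r. Qed.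

Lemma jonq_coords_scale b A B C D m (l : K) (u : k) : l != 0 -> u != 0 ->
  jonq_coords b A B C D m -> jonq_coords b (l * A) (l * B) (l * C) (l * D) (u *: m).
Proof.
move=> l0 u0 bP; apply: in_coords_eq bP _.
have R1 := gen1_and (rat_evalM l A) (rat_evalM l B).
have R2 := gen1_and (rat_evalM l C) (rat_evalM l D).
have := gen1_gen2 (gen1_and (rat_eval_neq0 l0) (gen1_and R1 R2)).
apply: gen2_sub => x y [ly [[EA EB] [EC ED]]]; split.
  by rewrite /rat_mobius /mobius EA EB EC ED mobius_scale.
by rewrite /mob /mobius !mxE mobius_scale.
Qed.

Lemma mobius_comp_eq (a b c d a' b' c' d' e1 e2 e3 e4 x : k) : c * x + d != 0 ->
  e1 = a' * a + b' * c -> e2 = a' * b + b' * d ->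
  e3 = c' * a + d' * c -> e4 = c' * b + d' * d ->
  mobius a' b' c' d' (mobius a b c d x) = mobius e1 e2 e3 e4 x.
Proof. by move=> n0 -> -> -> ->; rewrite /mobius mobius_comp. Qed.

(** Composing substitutes m into the coefficients of the outer map before the matrices are
    multiplied. The formula holds wherever the inner denominators do not vanish, which is
    generic. *)
Lemma jonq_coords_mul b b' A B C D m A' B' C' D' m' :
  m \in unitmx -> (C != 0) || (D != 0) ->
  jonq_coords b' A' B' C' D' m' -> jonq_coords b A B C D m ->
  jonq_coords (b' * b)%g
    (subst m A' * A + subst m B' * C) (subst m A' * B + subst m B' * D)
    (subst m C' * A + subst m D' * C) (subst m C' * B + subst m D' * D) (m' *m m).
Proof.
move=> mu CD b'P bP; apply: in_coords_eq (in_coords_mul b'P bP) _.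
have RA := gen1_and (rat_eval_subst A' mu) (rat_eval_subst B' mu).
have RC := gen1_and (rat_eval_subst C' mu) (rat_eval_subst D' mu).
have comb (u v w z : K) : gen1 (fun y => rat_eval (u * v + w * z) y =
    rat_eval u y * rat_eval v y + rat_eval w y * rat_eval z y).
  apply: gen1_sub (gen1_and (rat_evalD (u * v) (w * z))
    (gen1_and (rat_evalM u v) (rat_evalM w z))) => y [-> [-> ->]]; reflexivity.
have R1 := gen1_and (comb (subst m A') A (subst m B') C) (comb (subst m A') B (subst m B') D).
have R2 := gen1_and (comb (subst m C') A (subst m D') C) (comb (subst m C') B (subst m D') D).
have R3 : gen1 (fun y => m 1 0 * y + m 1 1 != 0).
  have d0 := mob_den_neq0 mu; have := rat_eval_neq0 d0.
  rewrite /rat_const /rat_y -tofracM -tofracD.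
  move=> /(gen1_and (rat_evalF ((m 1 0)%:P * 'X + (m 1 1)%:P))).
  by apply: gen1_sub => y [->]; rewrite !hornerE.
have L : gen2 (fun x y => rat_eval C y * x + rat_eval D y != 0).
  by apply: gen2_linear; rewrite orbC.
apply: gen2_sub (gen2_and L (gen1_gen2 (gen1_and R3 (gen1_and (gen1_and RA RC) (gen1_and R1 R2))))).
move=> x y [n0 [d0 [[[EA EB] [EC ED]] [[E1 E2] [E3 E4]]]]]; split.
  rewrite /rat_mobius -EA -EB -EC -ED; exact: (mobius_comp_eq n0 E1 E2 E3 E4).
by rewrite /mob; apply: mobius_comp_eq d0 _ _ _ _; rewrite mulmx2E.
Qed.

(** The three equations compare coefficients in (a x + b)(c' x + d') = (a' x + b')(c x + d). After
    multiplication by the determinant D they yield [ab], [cd] and [bc]; each primed entry times D is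
    then (a' d - b' c) times the unprimed one. *)
Lemma proportional4 (F : fieldType) (a b c d a' b' c' d' : F) :
  a * d - b * c != 0 -> a' * d' - b' * c' != 0 ->
  a * c' = a' * c -> b * d' = b' * d -> a * d' + b * c' = a' * d + b' * c ->
  exists l, [/\ l != 0, a' = l * a, b' = l * b, c' = l * c & d' = l * d].
Proof.
move=> D0 D0' e2 e0 e1; set D := a * d - b * c in D0 *.
have ab : b' * a - a' * b = 0.
  apply: (mulIf D0); rewrite mul0r.
  rewrite (_ : _ * D = - (a * c' - a' * c) * b ^+ 2 +
    (a * d' + b * c' - (a' * d + b' * c)) * a * b - (b * d' - b' * d) * a ^+ 2).
    by rewrite e2 e1 e0 !subrr oppr0 !mul0r addr0 subrr.
  by rewrite /D; ring.
have cd : d' * c - c' * d = 0.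
  apply: (mulIf D0); rewrite mul0r.
  rewrite (_ : _ * D = (a * c' - a' * c) * - d ^+ 2 +
    (a * d' + b * c' - (a' * d + b' * c)) * c * d - (b * d' - b' * d) * c ^+ 2).
    by rewrite e2 e1 e0 !subrr !mul0r addr0 subrr.
  by rewrite /D; ring.
pose e1' : F := a * d' + b * c' - (a' * d + b' * c).
have e1'0 : e1' = 0 by rewrite /e1' e1 subrr.
have e0' : b * d' - b' * d = 0 by rewrite e0 subrr.
have e2' : a * c' - a' * c = 0 by rewrite e2 subrr.
have bc : b' * c - b * c' = 0.
  apply: (mulIf D0); rewrite mul0r.
  rewrite (_ : _ * D = - (a * c) * (b * d' - b' * d) + a * b * (d' * c - c' * d) -
    (a * c * (b * d' - b' * d) + c * d * (b' * a - a' * b)) + b * c * e1').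
    by rewrite e0' ab cd e1'0 !(mulr0, addr0, subr0).
  by rewrite /D /e1'; ring.
have aE : a' * D = (a' * d - b' * c) * a.
  apply/eqP; rewrite -subr_eq0.
  rewrite (_ : _ - _ = c * (b' * a - a' * b)); first by rewrite ab mulr0.
  by rewrite /D; ring.
have bE : b' * D = (a' * d - b' * c) * b.
  apply/eqP; rewrite -subr_eq0.
  rewrite (_ : _ - _ = d * (b' * a - a' * b)); first by rewrite ab mulr0.
  by rewrite /D; ring.
have cE : c' * D = (a' * d - b' * c) * c.
  apply/eqP; rewrite -subr_eq0.
  rewrite (_ : _ - _ = d * (a * c' - a' * c) + c * (b' * c - b * c')).
    by rewrite e2' bc !mulr0 addr0.
  by rewrite /D; ring.
have dE : d' * D = (a' * d - b' * c) * d.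
  apply/eqP; rewrite -subr_eq0.
  rewrite (_ : _ - _ = d * (e1' + (b' * c - b * c')) - c * (b * d' - b' * d)).
    by rewrite e1'0 bc e0' addr0 !mulr0 subrr.
  by rewrite /D /e1'; ring.
pose l := (a' * d - b' * c) / D.
have lE z z' : z' * D = (a' * d - b' * c) * z -> z' = l * z.
  by move=> E; rewrite /l mulrAC -E mulfK.
exists l; split; try exact: lE.
apply: contraNneq D0' => l0.
by rewrite (lE _ _ aE) (lE _ _ bE) l0 !mul0r subrr.
Qed.

End JonquieresElements.

(** * Existence, uniqueness and products of Jonquieres maps with given coefficients *)

Section JonquieresGroup.
Variable k : closedFieldType.
Local Notation K := {fraction {poly k}}.
Local Notation tofrac := (@FracField.tofrac {poly k}).
Local Notation Cr := (Cremona k).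
Implicit Types (A B C D : K) (m : 'M[k]_2).

Definition mx2 (R : Type) (a b c d : R) : 'M[R]_2 :=
  \matrix_(i < 2, j < 2) if i == 0 then (if j == 0 then a else b)
                         else (if j == 0 then c else d).

Lemma mx2E (R : Type) (a b c d : R) : ((mx2 a b c d 0 0 = a) * (mx2 a b c d 0 1 = b)
  * (mx2 a b c d 1 0 = c) * (mx2 a b c d 1 1 = d))%type.
Proof. by rewrite /mx2 !mxE. Qed.

Lemma mx2_eq (R : Type) (m n : 'M[R]_2) : m 0 0 = n 0 0 -> m 0 1 = n 0 1 ->
  m 1 0 = n 1 0 -> m 1 1 = n 1 1 -> m = n.
Proof.
have I2 (i : 'I_2) : i = 0 \/ i = 1.
  by case: i => -[|[|]] // i; [left | right]; exact/val_inj.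
by move=> ? ? ? ?; apply/matrixP => i j; have [->|->] := I2 i; have [->|->] := I2 j.
Qed.

Lemma det_row_neq0 (F : fieldType) (a b c d : F) : a * d - b * c != 0 ->
  (c != 0) || (d != 0).
Proof.
apply: contraNT; rewrite negb_or !negbK.
by move=> /andP[/eqP -> /eqP ->]; rewrite !mulr0 subrr.
Qed.

Lemma mx2_unit (a b c d : k) : (mx2 a b c d \in unitmx) = (a * d - b * c != 0).
Proof. by rewrite unitmx2P !mx2E. Qed.

Lemma cross_eq (F : fieldType) (a b c d a' b' c' d' x : F) :
  c * x + d != 0 -> c' * x + d' != 0 ->
  (a * x + b) / (c * x + d) = (a' * x + b') / (c' * x + d') ->
  (a * c' - a' * c) * x ^+ 2 + (a * d' + b * c' - (a' * d + b' * c)) * x +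
  (b * d' - b' * d) = 0.
Proof.
move=> n0 n0' /eqP; rewrite eqr_div // => /eqP E.
rewrite (_ : _ + _ = (a * x + b) * (c' * x + d') - (a' * x + b') * (c * x + d)).
  by rewrite E subrr.
by ring.
Qed.

Lemma proportional_or_cross (F : fieldType) (a b c d a' b' c' d' : F) :
  a * d - b * c != 0 -> a' * d' - b' * c' != 0 ->
  (exists l, [/\ l != 0, a' = l * a, b' = l * b, c' = l * c & d' = l * d]) \/
  [|| b * d' - b' * d != 0, a * d' + b * c' - (a' * d + b' * c) != 0
    | a * c' - a' * c != 0].
Proof.
move=> D0 D0'; case E: [|| _, _ | _]; [by right | left].
move/negbT: E; rewrite !negb_or !negbK => /and3P[].
rewrite !subr_eq0 => /eqP c0 /eqP c1 /eqP c2.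
exact: proportional4 D0 D0' c2 c0 c1.
Qed.

(** Cross multiplication turns an agreement at y into a root of e2 y^2 + e1 y + e0. As every generic
    set contains such a y, this polynomial is zero and the matrices are proportional. *)
Lemma mob_frac_inj m m' : m \in unitmx -> m' \in unitmx ->
  (forall P, gen1 P -> exists y, P y /\ mob m y = mob m' y) ->
  exists2 u, u != 0 & m' = u *: m.
Proof.
rewrite !unitmx2P => mu mu' agree.
have dn (n : 'M[k]_2) : n 0 0 * n 1 1 - n 0 1 * n 1 0 != 0 ->
    gen1 (fun y => n 1 0 * y + n 1 1 != 0).
  move=> /linear_poly_neq0 n0; exists (n 1 0 *: 'X + (n 1 1)%:P) => // y.
  by rewrite !hornerE.
pose e2 := m 0 0 * m' 1 0 - m' 0 0 * m 1 0.
pose e1 := m 0 0 * m' 1 1 + m 0 1 * m' 1 0 - (m' 0 0 * m 1 1 + m' 0 1 * m 1 0).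
pose e0 := m 0 1 * m' 1 1 - m' 0 1 * m 1 1.
have E : Poly [:: e0; e1; e2] = 0.
  apply/eqP; apply: contrapT => /negP /gen1_neq0 g.
  have [y [[gy [d0 d0']] /(cross_eq d0 d0') ye]] := agree _ (gen1_and g (gen1_and (dn m mu) (dn m' mu'))).
  move/negP: gy; apply; apply/eqP; rewrite horner_Poly /= -[RHS]ye.
  by rewrite /e0 /e1 /e2; ring.
have c i : (Poly [:: e0; e1; e2])`_i = 0 by rewrite E coef0.
have := c 2%N; have := c 1%N; have := c 0%N; rewrite !coef_Poly /=.
move=> /eqP; rewrite subr_eq0 => /eqP c0 /eqP; rewrite subr_eq0 => /eqP c1.
move=> /eqP; rewrite subr_eq0 => /eqP c2.
have [u [u0 E1 E2 E3 E4]] := proportional4 mu mu' c2 c0 c1.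
by exists u => //; apply: mx2_eq; rewrite mxE.
Qed.

(** If the fibre matrices were not proportional, the quadratic in x from cross multiplication would
    be generically nonzero, yet both descriptions of [b] agree at some point of any generic set. *)
Lemma jonq_coords_inj b A B C D m A' B' C' D' m' :
  A * D - B * C != 0 -> A' * D' - B' * C' != 0 -> m \in unitmx -> m' \in unitmx ->
  jonq_coords b A B C D m -> jonq_coords b A' B' C' D' m' ->
  (exists l, [/\ l != 0, A' = l * A, B' = l * B, C' = l * C & D' = l * D]) /\
  exists2 u, u != 0 & m' = u *: m.
Proof.
move=> D0 D0' mu mu' bP bP'; split; last first.
  apply: mob_frac_inj => // P Pg.
  by have [x [y [Py _ E]]] := in_coords_agree bP bP' (gen1_gen2 Pg); exists y.
have dn C1 D1 A1 B1 : A1 * D1 - B1 * C1 != 0 ->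
    gen2 (fun x y => rat_eval C1 y * x + rat_eval D1 y != 0).
  by move=> /det_row_neq0; rewrite orbC; exact: gen2_linear.
pose e2 := A * C' - A' * C.
pose e1 := A * D' + B * C' - (A' * D + B' * C).
pose e0 := B * D' - B' * D.
have ev (u v w z : K) : gen2 (fun _ y => rat_eval (u * v - w * z) y =
    rat_eval u y * rat_eval v y - rat_eval w y * rat_eval z y).
  apply: gen1_gen2; have := rat_evalB (u * v) (w * z).
  move=> /(gen1_and (gen1_and (rat_evalM u v) (rat_evalM w z))).
  by apply: gen1_sub => y [[-> ->] ->].
have ev1 : gen2 (fun _ y => rat_eval e1 y =
    rat_eval A y * rat_eval D' y + rat_eval B y * rat_eval C' y -
    (rat_eval A' y * rat_eval D y + rat_eval B' y * rat_eval C y)).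
  have E1 : e1 = (A * D' - A' * D) + (B * C' - B' * C) by rewrite /e1 opprD addrACA.
  have := gen2_and (gen1_gen2 (rat_evalD (A * D' - A' * D) (B * C' - B' * C)))
    (gen2_and (ev A D' A' D) (ev B C' B' C)); rewrite -E1.
  by apply: gen2_sub => x y [-> [-> ->]]; rewrite opprD addrACA.
have [El|E] := proportional_or_cross D0 D0'; first exact: El.
have g := gen2_quadratic E.
have := gen2_and (gen2_and (dn _ _ _ _ D0) (dn _ _ _ _ D0'))
  (gen2_and (ev B D' B' D) (gen2_and ev1 (ev A C' A' C))).
move=> /(gen2_and g) /(in_coords_agree bP bP')[x [y [[gxy [[n0 n0'] [E0 [E1 E2]]]] /(cross_eq n0 n0') ye _]]].
by move/negP: gxy; case; apply/eqP; rewrite [X in X * x ^+ 2]E2 [X in X * x]E1 [X in _ + X]E0.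
Qed.

(** A common denominator q makes the fibre coefficients polynomial in t and y, and scaling all four
    by q leaves the Moebius map unchanged. Fibre coefficients affine in t are enough for all the
    families below. *)
Lemma family_frac A0 B0 C0 D0 A1 B1 C1 D1 (a b c d : {poly k}) :
  (forall t, t != 0 -> (A0 + rat_const t * A1) * (D0 + rat_const t * D1) -
    (B0 + rat_const t * B1) * (C0 + rat_const t * C1) != 0) ->
  (forall t, t != 0 -> (a * d - b * c).[t] != 0) ->
  exists2 beta : Gm k -> Cr, bir_morphism beta & forall v, let t := Gm_coord v in
    jonq_coords (beta v) (A0 + rat_const t * A1) (B0 + rat_const t * B1)
      (C0 + rat_const t * C1) (D0 + rat_const t * D1) (mx2 a.[t] b.[t] c.[t] d.[t]).
Proof.
move=> det_fiber det_base.
have [q q0 qE] := common_denominator [:: A0; B0; C0; D0; A1; B1; C1; D1].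
have q0' : tofrac q != 0 by rewrite tofrac_eq0.
have lin h0 h1 : h0 \in [:: A0; B0; C0; D0; A1; B1; C1; D1] ->
    h1 \in [:: A0; B0; C0; D0; A1; B1; C1; D1] ->
    exists P : {poly {poly k}}, forall t,
      h0 + rat_const t * h1 = tofrac P.[t%:P] / tofrac q.
  move=> /qE[p0 ->] /qE[p1 ->]; exists (p1 *: 'X + p0%:P) => t.
  have -> : (p1 *: 'X + p0%:P).[t%:P] = p1 * t%:P + p0 by rewrite !hornerE.
  have aux (F : fieldType) (x y z r : F) : x / r + z * (y / r) = (y * z + x) / r by ring.
  rewrite tofracD tofracM; exact: aux.
have [A AE] : exists P : {poly {poly k}}, forall t, A0 + rat_const t * A1 = tofrac P.[t%:P] / tofrac q.
  by apply: lin; rewrite !inE eqxx ?orbT.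
have [B BE] : exists P : {poly {poly k}}, forall t, B0 + rat_const t * B1 = tofrac P.[t%:P] / tofrac q.
  by apply: lin; rewrite !inE eqxx ?orbT.
have [C CE] : exists P : {poly {poly k}}, forall t, C0 + rat_const t * C1 = tofrac P.[t%:P] / tofrac q.
  by apply: lin; rewrite !inE eqxx ?orbT.
have [D DE] : exists P : {poly {poly k}}, forall t, D0 + rat_const t * D1 = tofrac P.[t%:P] / tofrac q.
  by apply: lin; rewrite !inE eqxx ?orbT.
have det_fiber' t : t != 0 -> (A * D - B * C).[t%:P] != 0.
  move=> /det_fiber; rewrite AE BE CE DE; apply: contraNneq => E.
  rewrite !mulf_div -mulrBl -!tofracM -tofracB -!hornerM -hornerN -hornerD E tofrac0.
  by rewrite mul0r.
have [beta bm bP] := family_of_polys det_fiber' det_base.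
exists beta => // v t; apply: in_coords_eq (bP v) _; rewrite -/t.
have RA := rat_evalE A.[t%:P] q0; rewrite -AE in RA.
have RB := rat_evalE B.[t%:P] q0; rewrite -BE in RB.
have RC := rat_evalE C.[t%:P] q0; rewrite -CE in RC.
have RD := rat_evalE D.[t%:P] q0; rewrite -DE in RD.
have := gen1_gen2 (gen1_and (gen1_neq0 q0) (gen1_and (gen1_and RA RB) (gen1_and RC RD))).
apply: gen2_sub => x y [qy [[EA EB] [EC ED]]]; split.
  rewrite /family_x /rat_mobius EA EB EC ED /mobius ![_ / q.[y]]mulrC.
  by rewrite mobius_scale // invr_eq0.
by rewrite /family_y /mob !mx2E.
Qed.

(** A total function of the coefficients. The default 1 is the value when no map has these
    coordinates, which does not occur for invertible matrices ([jel_coords]). *)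
Definition jel A B C D m : Cr := xget 1%g [set b | jonq_coords b A B C D m].

Lemma jonq_coords_uniq b b' A B C D m :
  jonq_coords b A B C D m -> jonq_coords b' A B C D m -> b = b'.
Proof.
move=> bP bP'; apply: (in_coords_uniq bP bP').
by exists 1; [exact: oner_neq0 |].
Qed.

Lemma jelE b A B C D m : jonq_coords b A B C D m -> b = jel A B C D m.
Proof.
by move=> bP; rewrite /jel; case: xgetP => [b' _ /= |/(_ b)/(_ bP)//]; apply: jonq_coords_uniq.
Qed.

Lemma jel_coords A B C D m : A * D - B * C != 0 -> m \in unitmx ->
  jonq_coords (jel A B C D m) A B C D m.
Proof.
move=> D0 mu; suff [b bP] : exists b, jonq_coords b A B C D m by rewrite -(jelE bP).
(* A constant family, taken at t = 1, provides the element. *)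
have := @family_frac A B C D 0 0 0 0 (m 0 0)%:P (m 0 1)%:P (m 1 0)%:P (m 1 1)%:P.
case=> [t _|t _|beta _ /(_ (Gm_of (oner_neq0 k)))/=].
- by rewrite !mulr0 !addr0.
- by rewrite !hornerE -unitmx2P.
rewrite !mulr0 !addr0 !hornerC => bP; exists (beta (Gm_of (oner_neq0 k))).
by rewrite (_ : m = mx2 (m 0 0) (m 0 1) (m 1 0) (m 1 1)) //; apply: mx2_eq; rewrite mx2E.
Qed.

Lemma jelM A B C D m A' B' C' D' m' :
  A * D - B * C != 0 -> A' * D' - B' * C' != 0 -> m \in unitmx -> m' \in unitmx ->
  (jel A' B' C' D' m' * jel A B C D m)%g =
  jel (subst m A' * A + subst m B' * C) (subst m A' * B + subst m B' * D)
      (subst m C' * A + subst m D' * C) (subst m C' * B + subst m D' * D) (m' *m m).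
Proof.
move=> D0 D0' mu mu'; apply: jelE.
exact: (jonq_coords_mul mu (det_row_neq0 D0) (jel_coords D0' mu') (jel_coords D0 mu)).
Qed.

Lemma jel_scale A B C D m (l : K) (u : k) : A * D - B * C != 0 -> m \in unitmx ->
  l != 0 -> u != 0 -> jel (l * A) (l * B) (l * C) (l * D) (u *: m) = jel A B C D m.
Proof.
move=> D0 mu l0 u0; apply: esym; apply: jelE.
exact: (jonq_coords_scale l0 u0 (jel_coords D0 mu)).
Qed.

Lemma jel_inj A B C D m A' B' C' D' m' :
  A * D - B * C != 0 -> A' * D' - B' * C' != 0 -> m \in unitmx -> m' \in unitmx ->
  jel A B C D m = jel A' B' C' D' m' ->
  (exists l, [/\ l != 0, A' = l * A, B' = l * B, C' = l * C & D' = l * D]) /\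
  exists2 u, u != 0 & m' = u *: m.
Proof.
move=> D0 D0' mu mu' E; apply: (jonq_coords_inj D0 D0' mu mu' (jel_coords D0 mu)).
by rewrite E; exact: (jel_coords D0' mu').
Qed.

Lemma jel1 : jel 1 0 0 1 1%:M = 1%g.
Proof.
apply: esym; apply: jelE.
have : in_coords (1%g : Cr) (fun x _ => x) (fun _ y => y).
  apply: represents_in_coords; apply: represents_ext (represents1 _) _.
  apply: generically_sub (pt_chart_generic (oner_neq0 _)) => p [cp _].
  by rewrite /pt_map /= -pt_coord.
move=> /in_coords_eq; apply.
have E0 := rat_evalC (0 : k); rewrite /rat_const polyC0 tofrac0 in E0.
have E1 := rat_evalC (1 : k); rewrite /rat_const polyC1 tofrac1 in E1.
apply: gen2_sub (gen1_gen2 (gen1_and E0 E1)) => x y [Z O].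
rewrite /rat_mobius /mob /mobius O Z !mxE /=.
by rewrite !mul1r !mul0r !addr0 !add0r !divr1.
Qed.

End JonquieresGroup.

(** * Normalisers of tori *)

Section TorusNormaliser.
Variables (k K : fieldType) (G : groupType).
Variables (elt : K -> K -> K -> K -> 'M[k]_2 -> G) (sb : 'M[k]_2 -> K -> K) (y : K).
Implicit Types (m n : 'M[k]_2) (a b l f : K).

(** All that the computation of the normaliser requires: the twisted product, uniqueness up to
    scalars, substitutions acting by field morphisms, with y fixed only by scalar matrices, and
    characteristic different from 2. *)
Record jonquieres_calculus : Prop := JonquieresCalculus {
  eltM_ax : forall A B C D m A' B' C' D' m',
    A * D - B * C != 0 -> A' * D' - B' * C' != 0 -> m \in unitmx -> m' \in unitmx ->
    (elt A' B' C' D' m' * elt A B C D m)%g =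
    elt (sb m A' * A + sb m B' * C) (sb m A' * B + sb m B' * D)
        (sb m C' * A + sb m D' * C) (sb m C' * B + sb m D' * D) (m' *m m);
  elt_inj_ax : forall A B C D m A' B' C' D' m',
    A * D - B * C != 0 -> A' * D' - B' * C' != 0 -> m \in unitmx -> m' \in unitmx ->
    elt A B C D m = elt A' B' C' D' m' ->
    (exists l, [/\ l != 0, A' = l * A, B' = l * B, C' = l * C & D' = l * D]) /\
    exists2 u, u != 0 & m' = u *: m;
  elt_scale_ax : forall A B C D m (l : K) (u : k), A * D - B * C != 0 ->
    m \in unitmx -> l != 0 -> u != 0 ->
    elt (l * A) (l * B) (l * C) (l * D) (u *: m) = elt A B C D m;
  elt1_ax : elt 1 0 0 1 1%:M = 1%g;
  sb_rmorph_ax : forall m, m \in unitmx ->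
    exists g : {rmorphism K -> K}, sb m =1 g;
  sb_comp_ax : forall m m' h, m \in unitmx -> m' \in unitmx ->
    sb m (sb m' h) = sb (m' *m m) h;
  sb1_ax : forall h, sb 1%:M h = h;
  sb_y_ax : forall m, m \in unitmx -> sb m y = y ->
    exists2 u, u != 0 & m = u *: 1%:M;
  two_neq0_ax : (2%:R : K) != 0 }.

Hypothesis calculus : jonquieres_calculus.
Let eltM := eltM_ax calculus.
Let elt_inj := elt_inj_ax calculus.
Let elt_scale := elt_scale_ax calculus.
Let elt1 := elt1_ax calculus.
Let sb_rmorph := sb_rmorph_ax calculus.
Let sb_comp := sb_comp_ax calculus.
Let sb1 := sb1_ax calculus.
Let sb_y := sb_y_ax calculus.
Let two_neq0 := two_neq0_ax calculus.

Lemma sbM m a b : m \in unitmx -> sb m (a * b) = sb m a * sb m b.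
Proof. by move=> /sb_rmorph[g E]; rewrite !E rmorphM. Qed.

Lemma sb_one m : m \in unitmx -> sb m 1 = 1.
Proof. by move=> /sb_rmorph[g E]; rewrite E rmorph1. Qed.

Lemma sb0 m : m \in unitmx -> sb m 0 = 0.
Proof. by move=> /sb_rmorph[g E]; rewrite E rmorph0. Qed.

Lemma sbV m a : m \in unitmx -> sb m a^-1 = (sb m a)^-1.
Proof. by move=> /sb_rmorph[g E]; rewrite !E fmorphV. Qed.

Lemma sb_eq0 m a : m \in unitmx -> (sb m a == 0) = (a == 0).
Proof. by move=> /sb_rmorph[g E]; rewrite E fmorph_eq0. Qed.

Lemma sbK m : m \in unitmx -> cancel (sb (invmx m)) (sb m).
Proof. by move=> mu h; rewrite sb_comp ?unitmx_inv // mulVmx // sb1. Qed.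

Lemma sbVK m : m \in unitmx -> cancel (sb m) (sb (invmx m)).
Proof. by move=> mu h; rewrite sb_comp ?unitmx_inv // mulmxV // sb1. Qed.

Definition tor f a b : G := elt a (b * f) b a 1%:M.
Definition dia l m : G := elt l 0 0 1 m.
Definition torus_set f : set G :=
  [set x | exists a b, (a, b) != (0, 0) /\ x = tor f a b].
Definition elts : set G := [set x | exists A B C D m,
  [/\ A * D - B * C != 0, m \in unitmx & x = elt A B C D m]].
Definition diags : set G := [set x | exists l m,
  [/\ l != 0, m \in unitmx & x = dia l m]].
(** [sb m f] is f o m. The equation says that (x, y) to (l x, m(y)) preserves the curve x^2 =
    f(y). *)
Definition diag_norm f : set G := [set x | exists l m,
  [/\ l != 0, m \in unitmx, sb m f = l ^+ 2 * f & x = dia l m]].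

Lemma dia_det l : l != 0 -> l * 1 - 0 * 0 != 0.
Proof. by rewrite mulr1 mul0r subr0. Qed.

Lemma diaM l m l' m' : l != 0 -> l' != 0 -> m \in unitmx -> m' \in unitmx ->
  (dia l' m' * dia l m)%g = dia (sb m l' * l) (m' *m m).
Proof.
move=> l0 l'0 mu mu'; rewrite /dia eltM ?dia_det //.
by rewrite sb_one // sb0 // !mul0r !mulr0 !addr0 !add0r mulr1.
Qed.

Lemma dia1 : dia 1 1%:M = 1%g.
Proof. exact: elt1. Qed.

Lemma dia_scale l m u : l != 0 -> m \in unitmx -> u != 0 -> dia l (u *: m) = dia l m.
Proof.
move=> l0 mu u0; rewrite /dia -(@elt_scale l 0 0 1 m 1 u) ?dia_det ?oner_neq0 //.
by rewrite !mul1r.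
Qed.

Lemma diaV l m : l != 0 -> m \in unitmx ->
  (dia l m)^-1%g = dia (sb (invmx m) l^-1) (invmx m).
Proof.
move=> l0 mu; apply: (mulIg (dia l m)); rewrite mulVg diaM ?unitmx_inv //.
  by rewrite sbK // mulVf // mulVmx // dia1.
by rewrite sb_eq0 ?unitmx_inv // invr_eq0.
Qed.

Lemma eltsM x x' : elts x -> elts x' -> elts (x * x')%g.
Proof.
move=> [A' [B' [C' [D' [m' [D0' mu' ->]]]]]] [A [B [C [D [m [D0 mu ->]]]]]].
rewrite eltM //; do 5 eexists; split; [| |reflexivity].
  have := mulf_neq0 (_ : sb m (A' * D' - B' * C') != 0) D0; rewrite sb_eq0 // => /(_ D0').
  congr (_ != 0); have [g gE] := sb_rmorph mu; rewrite !gE rmorphB !rmorphM; ring.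
by rewrite unitmx_mul mu mu'.
Qed.

Lemma diags_elts : diags `<=` elts.
Proof.
by move=> _ [l [m [l0 mu ->]]]; exists l, 0, 0, 1, m; split=> //; exact: dia_det.
Qed.

Lemma diags_subgroup : subgroup diags.
Proof.
split.
- by exists 1, 1%:M; split; [exact: oner_neq0 | exact: unitmx1 | rewrite dia1].
- move=> _ _ [l [m [l0 mu ->]]] [l' [m' [l'0 mu' ->]]].
  exists (sb m' l * l'), (m *m m'); split; last by rewrite diaM.
    by rewrite mulf_neq0 // sb_eq0.
  by rewrite unitmx_mul mu mu'.
- move=> _ [l [m [l0 mu ->]]]; exists (sb (invmx m) l^-1), (invmx m); split.
  + by rewrite sb_eq0 ?unitmx_inv // invr_eq0.
  + by rewrite unitmx_inv.
  + by rewrite diaV.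
Qed.

Section OneTorus.
Variable f : K.
Hypothesis nsq : nonsquare f.

(** This is the norm of a + b sqrt f from the field K(sqrt f). *)
Lemma norm_neq0 a b : (a, b) != (0, 0) -> a * a - b * f * b != 0.
Proof.
apply: contraNneq => E; have [b0|b0] := eqVneq b 0.
  move: E; rewrite b0 !mulr0 subr0 => /eqP; rewrite mulf_eq0 orbb => /eqP ->.
  by rewrite eqxx.
case/negP: (nsq (a / b)); apply/eqP.
have -> : f = (a * a - (a * a - b * f * b)) / (b * b) by field.
by rewrite E subr0; field.
Qed.

(** The matrix of [tor f a b] is multiplication by a + b sqrt f, so the torus is the multiplicative
    group of K(sqrt f) modulo that of K. *)
Lemma torM a b a' b' : (a, b) != (0, 0) -> (a', b') != (0, 0) ->
  (tor f a b * tor f a' b')%g = tor f (a * a' + b * f * b') (a * b' + b * a').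
Proof.
move=> ab ab'; rewrite /tor eltM ?norm_neq0 ?unitmx1 // !sb1 mulmx1; congr elt; ring.
Qed.

Lemma tor_pair_neq0 a b a' b' : (a, b) != (0, 0) -> (a', b') != (0, 0) ->
  (a * a' + b * f * b', a * b' + b * a') != (0, 0).
Proof.
move=> /norm_neq0 n0 /norm_neq0 n0'; have := mulf_neq0 n0 n0'.
apply: contraNneq => -[E1 E2].
have -> : (a * a - b * f * b) * (a' * a' - b' * f * b') =
    (a * a' + b * f * b') ^+ 2 - f * (a * b' + b * a') ^+ 2 by ring.
by rewrite E1 E2 !expr0n /= mulr0 subrr.
Qed.

Lemma torC a b a' b' : (a, b) != (0, 0) -> (a', b') != (0, 0) ->
  (tor f a b * tor f a' b')%g = (tor f a' b' * tor f a b)%g.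
Proof. by move=> ab ab'; rewrite !torM //; congr (tor f _ _); ring. Qed.

Lemma tor_a0 a : a != 0 -> tor f a 0 = 1%g.
Proof.
move=> a0; rewrite /tor mul0r -elt1.
have d0 : (1 : K) * 1 - 0 * 0 != 0 by exact: dia_det (oner_neq0 _).
have := elt_scale d0 (unitmx1 _ _) a0 (oner_neq0 k).
by rewrite mulr1 mulr0 scale1r.
Qed.

Lemma torV a b : (a, b) != (0, 0) -> (tor f a b)^-1%g = tor f a (- b).
Proof.
move=> ab; have ab' : (a, - b) != (0, 0) by move: ab; rewrite !xpair_eqE oppr_eq0.
apply: (mulIg (tor f a b)); rewrite mulVg torM //.
rewrite (_ : a * b + - b * a = 0); last by ring.
rewrite tor_a0 //; have := norm_neq0 ab; congr (_ != _); ring.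
Qed.

Lemma torus_subgroup : subgroup (torus_set f).
Proof.
split.
- by exists 1, 0; rewrite tor_a0 ?oner_neq0 // xpair_eqE oner_eq0.
- move=> _ _ [a [b [ab ->]]] [a' [b' [ab' ->]]]; rewrite torM //.
  by exists (a * a' + b * f * b'), (a * b' + b * a'); split=> //; exact: tor_pair_neq0.
- move=> _ [a [b [ab ->]]]; rewrite torV //; exists a, (- b); split=> //.
  by move: ab; rewrite !xpair_eqE oppr_eq0.
Qed.

Lemma torus_commute x x' : torus_set f x -> torus_set f x' -> (x * x' = x' * x)%g.
Proof. by move=> [a [b [ab ->]]] [a' [b' [ab' ->]]]; exact: torC. Qed.

(** Conjugation by [dia l m] acts on coefficients by the inverse substitution and divides the one of
    sqrt f by l. Two functions f and f' are allowed so that one torus can also be carried to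
    another. *)
Lemma dia_tor f' l m a b : l != 0 -> m \in unitmx -> sb m f' = l ^+ 2 * f ->
  nonsquare f' -> (a, b) != (0, 0) ->
  (dia l m * tor f a b)%g =
  (tor f' (sb (invmx m) a) (sb (invmx m) (b / l)) * dia l m)%g.
Proof.
move=> l0 mu mf nsq' ab; have mu' : invmx m \in unitmx by rewrite unitmx_inv.
have n0 := norm_neq0 ab.
have n0' : sb (invmx m) a * sb (invmx m) a -
    sb (invmx m) (b / l) * f' * sb (invmx m) (b / l) != 0.
  rewrite -(sb_eq0 _ mu).
  have [g gE] := sb_rmorph mu.
  rewrite gE rmorphB !rmorphM -!gE !sbK // mf.
  by rewrite (_ : _ - _ = a * a - b * f * b) //; field.
rewrite /tor /dia !eltM ?dia_det ?unitmx1 // !sb1 mul1mx mulmx1.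
rewrite !sbM // !sbK // mf.
by congr elt; field.
Qed.

Lemma dia_conj_torus f' l m : l != 0 -> m \in unitmx -> sb m f' = l ^+ 2 * f ->
  nonsquare f' ->
  [set (dia l m * t * (dia l m)^-1)%g | t in torus_set f] = torus_set f'.
Proof.
move=> l0 mu mf nsq'; have mu' : invmx m \in unitmx by rewrite unitmx_inv.
apply/seteqP; split=> [_ [_ [a [b [ab ->]]] <-]|_ [a [b [ab ->]]]].
  rewrite (dia_tor l0 mu mf) // mulgK.
  exists (sb (invmx m) a), (sb (invmx m) (b / l)); split=> //.
  move: ab; rewrite !xpair_eqE !sb_eq0 // mulf_eq0 invr_eq0 (negPf l0) orbF.
  by [].
have ab' : (sb m a, l * sb m b) != (0, 0).
  by move: ab; rewrite !xpair_eqE mulf_eq0 (negPf l0) !sb_eq0.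
exists (tor f (sb m a) (l * sb m b)); first by exists (sb m a), (l * sb m b).
rewrite (dia_tor l0 mu mf) // mulgK sbVK // mulrAC divff // mul1r.
by rewrite sbVK.
Qed.

(* sigma = (0, f; 1, 0) spans the trace zero part of K + K sigma.             *)
Lemma elts_normaliser x : normaliser elts (torus_set f) x <->
  exists t d, [/\ torus_set f t, diag_norm f d & x = (t * d)%g].
Proof.
split; last first.
  move=> [_ [_ [[a [b [ab ->]]] [l [m [l0 mu mf ->]]] ->]]].
  have n0 := norm_neq0 ab; split.
    rewrite /tor /dia eltM ?dia_det ?unitmx1 // mul1mx.
    do 5 eexists; split; [|exact: mu|reflexivity].
    have := mulf_neq0 (_ : sb m (a * a - b * f * b) != 0) l0; rewrite sb_eq0 // => /(_ n0).
    congr (_ != 0); have [g gE] := sb_rmorph mu; rewrite !gE rmorphB !rmorphM; ring.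
  have E := dia_conj_torus l0 mu mf nsq.
  have C t : torus_set f t -> (tor f a b * (dia l m * t * (dia l m)^-1) * (tor f a b)^-1 =
      dia l m * t * (dia l m)^-1)%g.
    move=> Tt; have T' : torus_set f (dia l m * t * (dia l m)^-1)%g by rewrite -E; exists t.
    by rewrite (torus_commute _ T') ?mulgK //; exists a, b.
  rewrite -[RHS]E; apply/seteqP; split=> _ [t Tt <-]; exists t => //.
    by rewrite invgM !mulgA -C // !mulgA.
  by rewrite -C // invgM !mulgA.
move=> [[A [B [C [D [m [D0 mu ->]]]]]] xT].
have s0 : (0, 1) != (0, 0) :> K * K by rewrite xpair_eqE oner_eq0 andbF.
(* [tor f 0 1] is sqrt f; normalising the torus makes its conjugate some [tor f a b]. *)
have [a [b [ab sE]]] : torus_set f (elt A B C D m * tor f 0 1 * (elt A B C D m)^-1)%g.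
  by rewrite -xT; exists (tor f 0 1) => //; exists 0, 1.
have {}sE : (elt A B C D m * tor f 0 1)%g = (tor f a b * elt A B C D m)%g.
  by rewrite -sE mulgVK.
have n1 := norm_neq0 s0; have n2 := norm_neq0 ab.
set al := sb m a; set be := sb m b; set ph := sb m f.
have n3 : (al * A + be * ph * C) * (be * B + al * D) -
    (al * B + be * ph * D) * (be * A + al * C) != 0.
  have -> : (al * A + be * ph * C) * (be * B + al * D) -
    (al * B + be * ph * D) * (be * A + al * C) = sb m (a * a - b * f * b) * (A * D - B * C).
    by have [g gE] := sb_rmorph mu; rewrite /al /be /ph !gE rmorphB !rmorphM; ring.
  by rewrite mulf_neq0 // sb_eq0.
have n4 : B * (C * f) - A * f * D != 0.
  have -> : B * (C * f) - A * f * D = (A * D - B * C) * - f by ring.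
  rewrite mulf_neq0 // oppr_eq0; apply: contraTneq n1 => ->.
  by rewrite !mulr0 mul0r subrr eqxx.
move: sE; rewrite /tor !eltM ?unitmx1 // !sb1 mulmx1 mul1mx mul1r.
rewrite !mulr0 !mulr1 !add0r !addr0 sbM // -/al -/be -/ph.
move=> /elt_inj[]// [r [r0 E1 E2 E3 E4] _].
(* A conjugate of sqrt f has trace zero: the four equations combine to 2 [al] times the determinant
   being zero. *)
have al0 : al = 0.
  have D2 : 2%:R * (A * D - B * C) != 0 by rewrite mulf_neq0.
  apply: (mulIf D2); rewrite mul0r.
  have -> : al * (2%:R * (A * D - B * C)) =
    ((al * A + be * ph * C) * D - (al * B + be * ph * D) * C) +
    ((be * B + al * D) * A - (be * A + al * C) * B) by ring.
  by rewrite E1 E2 E3 E4; ring.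
move: E1 E2 E3 E4; rewrite al0 !mul0r !add0r !addr0 => E1 E2 E3 E4.
have be0 : be != 0.
  by apply: contraNneq n3 => ->; rewrite al0 !mul0r !addr0 !mulr0 subrr.
(* With [al] = 0 the equations read A = l D and B = l C f for this l, so the matrix is a torus
   matrix times diag(l, 1). *)
pose l := r / be; have l0 : l != 0 by rewrite mulf_neq0 ?invr_eq0.
have AE : A = l * D by rewrite /l mulrAC -E3 mulrAC divff // mul1r.
have BE : B = l * (C * f) by rewrite /l mulrAC -E4 mulrAC divff // mul1r.
have CE : ph * C = l * B by rewrite /l mulrAC -E1 -mulrA mulrAC divff // mul1r.
have DE : ph * D = l * (A * f) by rewrite /l mulrAC -E2 -mulrA mulrAC divff // mul1r.
have mf : ph = l ^+ 2 * f.
  apply: (mulIf D0).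
  rewrite mulrBr -[X in X - _]mulrCA DE -[X in _ - X]mulrCA CE BE AE; ring.
have mu' : invmx m \in unitmx by rewrite unitmx_inv.
have CD : (D, C) != (0, 0).
  by apply: contraNneq D0 => -[-> ->]; rewrite !mulr0 subrr.
have CD' : (sb (invmx m) D, sb (invmx m) (C / l)) != (0, 0).
  by move: CD; rewrite !xpair_eqE !sb_eq0 // mulf_eq0 invr_eq0 (negPf l0) orbF.
exists (tor f (sb (invmx m) D) (sb (invmx m) (C / l))), (dia l m); split.
- by exists (sb (invmx m) D), (sb (invmx m) (C / l)).
- by exists l, m.
rewrite /tor /dia eltM ?dia_det ?unitmx1 ?norm_neq0 //.
rewrite mul1mx sbM // !sbK // -/ph mf AE BE; congr elt; by field.
Qed.

(** A diagonal matrix has b = 0, and [tor f a 0] is scalar. *)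
Lemma tor_dia_inj a b l m : (a, b) != (0, 0) -> l != 0 -> m \in unitmx ->
  tor f a b = dia l m -> tor f a b = 1%g.
Proof.
move=> ab l0 mu; rewrite {1}/tor /dia => /esym/elt_inj[].
- exact: dia_det.
- exact: norm_neq0.
- by [].
- exact: unitmx1.
move=> [r [r0 _ _ bE aE]] _; rewrite bE mulr0 tor_a0 // aE mulr1; exact: r0.
Qed.

Lemma torus_diag_norm x : torus_set f x -> diag_norm f x -> x = 1%g.
Proof. by move=> [a [b [ab ->]]] [l [m [l0 mu _]]]; exact: tor_dia_inj. Qed.

(** A normalising x is t d by [elts_normaliser]; when x is diagonal so is t = x d^-1, and a diagonal
    element of the torus is trivial. *)
Lemma diag_norm_normaliser x : normaliser diags (torus_set f) x <-> diag_norm f x.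
Proof.
split=> [[[l [m [l0 mu xE]]] xT]|[l [m [l0 mu mf ->]]]]; last first.
  by split; [exists l, m | exact: dia_conj_torus].
have : normaliser elts (torus_set f) x.
  by split=> //; exists l, 0, 0, 1, m; split=> //; exact: dia_det.
move=> /elts_normaliser[t [d [Tt dd xtd]]].
suff t1 : t = 1%g by rewrite xtd t1 mul1g.
have [l' [m' [l'0 mu' mf' dE]]] := dd.
have [a [b [ab tE]]] := Tt.
have tE' : t = dia (sb (invmx m') (l * l'^-1)) (m *m invmx m').
  have -> : t = (x * d^-1)%g by rewrite xtd mulgK.
  have mu'i : invmx m' \in unitmx by rewrite unitmx_inv.
  rewrite xE dE diaV // diaM ?sb_eq0 ?invr_eq0 //.
  by rewrite sbM.
have mu'' : m *m invmx m' \in unitmx by rewrite unitmx_mul mu unitmx_inv mu'.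
have l''0 : sb (invmx m') (l * l'^-1) != 0.
  by rewrite sb_eq0 ?unitmx_inv // mulf_neq0 ?invr_eq0.
by move: tE'; rewrite tE; apply: tor_dia_inj.
Qed.

Lemma diag_norm_subgroup : subgroup (diag_norm f).
Proof.
split.
- exists 1, 1%:M; split; [exact: oner_neq0 | exact: unitmx1 | | by rewrite dia1].
  by rewrite sb1 expr1n mul1r.
- move=> _ _ [l' [m' [l'0 mu' mf' ->]]] [l [m [l0 mu mf ->]]].
  exists (sb m l' * l), (m' *m m); split.
  + by rewrite mulf_neq0 ?sb_eq0.
  + by rewrite unitmx_mul mu' mu.
  + rewrite -sb_comp // mf' sbM // mf expr2 sbM // exprMn; ring.
  + by rewrite diaM.
move=> _ [l [m [l0 mu mf ->]]]; have mu' : invmx m \in unitmx by rewrite unitmx_inv.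
exists (sb (invmx m) l^-1), (invmx m); split=> //.
- by rewrite sb_eq0 // invr_eq0.
- rewrite -{1}(mulKf (expf_neq0 2 l0) f) -mf sbM // sbVK //.
  by rewrite expr2 sbV // sbM // sbV // expr2 invfM.
- by rewrite diaV.
Qed.

(** Commuting with 1 + sqrt f forces l = 1. Commuting with y + sqrt f then forces y o m = y, so m is
    scalar. *)
Lemma commute_dia l m : l != 0 -> m \in unitmx -> sb m f = l ^+ 2 * f ->
  (dia l m * tor f 1 1 = tor f 1 1 * dia l m)%g ->
  (dia l m * tor f y 1 = tor f y 1 * dia l m)%g -> dia l m = 1%g.
Proof.
move=> l0 mu mf; have mu' : invmx m \in unitmx by rewrite unitmx_inv.
have p1 c : (c, 1) != (0, 0) :> K * K by rewrite xpair_eqE oner_eq0 andbF.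
rewrite !(dia_tor l0 mu mf) // => /mulIg E1 /mulIg E2.
have p2 c : (sb (invmx m) c, sb (invmx m) (1 / l)) != (0, 0).
  by rewrite xpair_eqE !sb_eq0 // mul1r invr_eq0 (negPf l0) andbF.
move: E1 E2; rewrite /tor sb_one // => /elt_inj[]; rewrite ?unitmx1 ?norm_neq0 //.
  by have := p2 1; rewrite sb_one //; exact: norm_neq0.
move=> [r [r0 E _ E1 _]] _; move: E E1; rewrite mulr1 => <-; rewrite mul1r => E.
have l1 : l = 1.
  apply: invr_inj; rewrite invr1 -[l^-1]mul1r -(sbK mu (1 / l)) -E sb_one //.
rewrite -E => /elt_inj[]; rewrite ?unitmx1 ?norm_neq0 //.
move=> [r' [r'0 E' _ E1 _]] _; move: E1; rewrite mulr1 => r'1.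
move: E'; rewrite -r'1 mul1r => /esym yE.
have ym : sb m y = y by rewrite -{2}(sbK mu y) yE.
have [u u0 ->] := sb_y mu ym.
by rewrite dia_scale ?unitmx1 // l1 dia1.
Qed.

(* The torus is its own centraliser in the normaliser; two of its elements    *)
(* suffice to detect it.                                                      *)
Lemma torus_centraliser x : torus_set f x <-> normaliser elts (torus_set f) x /\
  (x * tor f 1 1 = tor f 1 1 * x)%g /\ (x * tor f y 1 = tor f y 1 * x)%g.
Proof.
have p1 c : (c, 1) != (0, 0) :> K * K by rewrite xpair_eqE oner_eq0 andbF.
have T1 c : torus_set f (tor f c 1) by exists c, 1.
split=> [Tx|[/elts_normaliser[t [d [Tt [l [m [l0 mu mf dE]]] xE]]] [C1 Cy]]].
  split; last by split; exact: torus_commute.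
  apply/elts_normaliser; exists x, 1%g; split=> //; last by rewrite mulg1.
  by have [] := diag_norm_subgroup.
have C c : (x * tor f c 1 = tor f c 1 * x)%g -> (d * tor f c 1 = tor f c 1 * d)%g.
  rewrite xE => E; apply: (mulgI t); rewrite [RHS]mulgA (torus_commute Tt (T1 c)).
  by rewrite -mulgA -E mulgA.
suff d1 : d = 1%g by rewrite xE d1 mulg1.
by move: (C _ C1) (C _ Cy); rewrite dE; exact: commute_dia.
Qed.

End OneTorus.
End TorusNormaliser.

(** * The calculus realised in the Cremona group, and closed subgroups *)

Section JonquieresTorus.
Variable k : closedFieldType.
Local Notation K := {fraction {poly k}}.
Local Notation tofrac := (@FracField.tofrac {poly k}).
Local Notation Cr := (Cremona k).
Hypothesis two_neq0 : (2%:R : k) != 0.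
Implicit Types (m : 'M[k]_2) (f l : K).

Lemma subst_y_scalar m : m \in unitmx -> subst m (rat_y k) = rat_y k ->
  exists2 u, u != 0 & m = u *: 1%:M.
Proof.
move=> mu; rewrite substX // => E.
have d0 := mob_den_neq0 mu.
have : mob_frac m * (rat_const (m 1 0) * rat_y k + rat_const (m 1 1)) =
       rat_y k * (rat_const (m 1 0) * rat_y k + rat_const (m 1 1)) by rewrite E.
rewrite /mob_frac divfK // /rat_const /rat_y -!tofracM -!tofracD -!tofracM => /eqP.
rewrite tofrac_eq => /eqP P.
have c i := congr1 (fun p : {poly k} => p`_i) P.
have := c 0%N; have := c 1%N; have := c 2%N.
rewrite [X in _ = X -> _]coefXM [X in _ -> _ = X -> _]coefXM [X in _ -> _ -> _ = X -> _]coefXM.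
rewrite !(coefD, coefCM, coefX, coefC) /= !mulr0 !mulr1 !addr0 !add0r => c2 c1 c0.
exists (m 0 0); last by apply: mx2_eq; rewrite !mxE /= ?mulr1 ?mulr0.
by apply: contraTneq mu => a0; rewrite unitmx2P a0 -c2 mul0r mulr0 subrr eqxx.
Qed.

Lemma jel_calculus : jonquieres_calculus (@jel k) (@subst k) (rat_y k).
Proof.
split.
- exact: jelM.
- exact: jel_inj.
- exact: jel_scale.
- exact: jel1.
- by move=> m mu; exists (subst_morph mu).
- exact: subst_comp.
- exact: subst1.
- exact: subst_y_scalar.
- by rewrite -(rmorph_nat (const_frac k)) fmorph_eq0.
Qed.

Lemma Jonq_elts : Jonq k = elts (@jel k).
Proof.
apply/seteqP; split=> [phi [A [B [C [D [a [b [c [d [D0 d0 phiE]]]]]]]]]|_ [A [B [C [D [m [D0 mu ->]]]]]]].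
  exists A, B, C, D, (mx2 a b c d); split; [exact: D0 | by rewrite mx2_unit |].
  by apply: jelE; rewrite /jonq_coords /mob !mx2E.
exists A, B, C, D, (m 0 0), (m 0 1), (m 1 0), (m 1 1).
by split; [exact: D0 | rewrite -unitmx2P | exact: (jel_coords D0 mu)].
Qed.

Lemma frac_coords01 : gen1 (fun y : k => rat_eval (0 : K) y = 0 /\ rat_eval (1 : K) y = 1).
Proof.
have E0 := rat_evalC (0 : k); rewrite /rat_const polyC0 tofrac0 in E0.
have E1 := rat_evalC (1 : k); rewrite /rat_const polyC1 tofrac1 in E1.
exact: gen1_and E0 E1.
Qed.

Lemma diag_coords (b : Cr) l m : in_coords b (fun x y => rat_eval l y * x) (fun _ y => mob m y)
  <-> jonq_coords b l 0 0 1 m.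
Proof.
have E : gen2 (fun x y => rat_eval l y * x = rat_mobius l 0 0 1 x y).
  apply: gen2_sub (gen1_gen2 frac_coords01) => x y [Z O].
  by rewrite /rat_mobius /mobius Z O mul0r add0r addr0 divr1.
split=> bP; apply: in_coords_eq bP _; apply: gen2_sub E => x y; by [].
Qed.

Lemma Jonq_diagE : Jonq_diag k = diags (@jel k).
Proof.
apply/seteqP; split=> [phi [l [a [b [c [d [l0 d0 phiE]]]]]]|_ [l [m [l0 mu ->]]]].
  exists l, (mx2 a b c d); split; [exact: l0 | by rewrite mx2_unit |].
  by apply: jelE; apply/diag_coords; rewrite /mob !mx2E.
exists l, (m 0 0), (m 0 1), (m 1 0), (m 1 1).
split; [exact: l0 | by rewrite -unitmx2P |].
by apply/diag_coords; exact: (jel_coords (dia_det l0) mu).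
Qed.

Lemma torusE f : nonsquare f -> torus f = torus_set (@jel k) f.
Proof.
move=> nsq; have mob1 y : mob (1%:M : 'M[k]_2) y = y.
  by rewrite /mob /mobius !mxE /= mul1r mul0r addr0 add0r divr1.
have mob1E : (fun _ : k => mob (1%:M : 'M[k]_2)) = (fun _ y => y).
  by apply/funext => x; apply/funext => y; rewrite mob1.
apply/seteqP; split=> [phi [a [b [ab phiE]]]|_ [a [b [ab ->]]]]; exists a, b; split.
- exact: ab.
- by apply: jelE; rewrite /jonq_coords mob1E.
- exact: ab.
- have := jel_coords (norm_neq0 nsq ab) (unitmx1 _ _).
  by rewrite /jonq_coords mob1E.
Qed.

Definition tau (t : k) : Cr := dia (@jel k) (rat_const t) (mx2 (t ^+ 2) 0 0 1).

Lemma tau_unit (t : k) : t != 0 -> mx2 (t ^+ 2) 0 0 1 \in unitmx.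
Proof. by move=> t0; rewrite mx2_unit mulr1 mul0r subr0 expf_neq0. Qed.

Lemma rat_const_neq0 (t : k) : t != 0 -> rat_const t != 0.
Proof. by move=> t0; rewrite /rat_const tofrac_eq0 polyC_eq0. Qed.

Lemma torus12E : torus12 k = [set x | exists2 t, t != 0 & x = tau t].
Proof.
have E t : t != 0 -> forall b : Cr, in_coords b (fun x _ => t * x) (fun _ y => t ^+ 2 * y) <->
    jonq_coords b (rat_const t) 0 0 1 (mx2 (t ^+ 2) 0 0 1).
  move=> t0 b; rewrite -diag_coords.
  have E : gen2 (fun _ y => t = rat_eval (rat_const t) y).
    by apply: gen1_gen2; apply: gen1_sub (rat_evalC t).
  by split=> bP; apply: in_coords_eq bP _; apply: gen2_sub E => x y <-;
    rewrite /mob /mobius !mx2E mul0r add0r addr0 divr1.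
apply/seteqP; split=> [phi [t t0 phiE]|_ [t t0 ->]]; exists t; rewrite ?t0 //.
  by apply: jelE; apply/(E t t0).
apply/(E t t0); exact: (jel_coords (dia_det (rat_const_neq0 t0)) (tau_unit t0)).
Qed.

Local Notation lP2 := (@P2_local k).
Local Notation sP2 := (@P2_saturated k).

Lemma cr_algebraic_mul (w w' : Cr -> Cr) : algebraic_map w -> algebraic_map w' ->
  algebraic_map (fun b => w b * w' b)%g.
Proof. exact: algebraic_mul lP2 sP2 w w'. Qed.

Lemma cr_algebraic_cst (c : Cr) : algebraic_map (fun _ : Cr => c).
Proof. by apply: algebraic_cst; exact: P2_local. Qed.

Lemma cr_algebraic_inv (w : Cr -> Cr) : algebraic_map w ->
  algebraic_map (fun b => (w b)^-1)%g.
Proof. exact: algebraic_inv lP2 sP2 w. Qed.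

Lemma cr_algebraic_id : algebraic_map (fun b : Cr => b).
Proof. exact: algebraic_id. Qed.

Lemma cr_continuous (w : Cr -> Cr) : algebraic_map w -> continuous w.
Proof. exact: algebraic_continuous. Qed.

(** Commuting with c is an equation between a word and 1, so [closed_algebraic_eq1] applies. *)
Lemma closed_commute (w : Cr -> Cr) (c : Cr) : algebraic_map w ->
  closed [set x | w x * c = c * w x]%g.
Proof.
move=> aw.
have aw' : algebraic_map (fun x => w x * c * (c * w x)^-1)%g.
  have ac := cr_algebraic_cst c.
  apply: (cr_algebraic_mul (cr_algebraic_mul aw ac)).
  exact: (cr_algebraic_inv (cr_algebraic_mul ac aw)).
have := closed_algebraic_eq1 lP2 sP2 (@P2_separated k) aw'.
congr closed; apply/seteqP; split=> x /= E.
  by apply: (mulIg (c * w x)^-1%g); rewrite E mulgV.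
by rewrite E mulgV.
Qed.

Lemma Gm_connected (b : Gm k -> Cr) : bir_morphism b -> connected (range b).
Proof. exact: bir_morphism_connected (Gm_variety k). Qed.

(** On a connected B through 1, H is cut out by the closed set C and its complement by the closed
    set D, a finite union of translates of C by representatives outside H. So H meets B in a
    nonempty clopen set, which is all of B. *)
Lemma id_component_finite_index (N H C : set Cr) (s : seq Cr) :
  subgroup N -> subgroup H -> closed C -> H = N `&` C ->
  (forall g, g \in s -> N g) ->
  (forall x, N x -> exists2 g, g \in s & H (x * g^-1)%g) ->
  id_component N `<=` H.
Proof.
move=> [N1 NM NV] [H1 HM HV] cC HE Ns cov x [B [B1 BN Bc] Bx].
pose D := [set z : Cr | exists2 g, g \in s /\ ~ H g & C (z * g^-1)%g].
have cD : closed D.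
  rewrite /D; elim: s {Ns cov D} => [|g s IHs].
    by rewrite (_ : mkset _ = set0); [exact: closed0 | apply/seteqP; split=> z // [g []]].
  have cg : closed [set z : Cr | ~ H g /\ C (z * g^-1)%g].
    have [Hg|Hg] := pselect (H g).
      by rewrite (_ : mkset _ = set0); [exact: closed0 | apply/seteqP; split=> z // []].
    have ag : algebraic_map (fun z : Cr => z * g^-1)%g.
      exact: (cr_algebraic_mul cr_algebraic_id (cr_algebraic_cst _)).
    have := (continuous_closedP _).1 (cr_continuous ag) C cC.
    by congr closed; apply/seteqP; split=> z //= -[].
  have := closedU cg IHs; congr closed; apply/seteqP; split=> z.
    move=> [[Hg Cz]|[h [hs Hh] Cz]]; first by exists g; rewrite // mem_head.
    by exists h; rewrite // inE hs orbT.
  move=> [h [+ Hh] Cz]; rewrite inE => /predU1P[hE|hs]; last by right; exists h.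
  by left; split; rewrite -?hE.
have HD z : B z -> H z <-> ~ D z.
  move=> Bz; have Nz := BN _ Bz; split=> [Hz [g [gs Hg] Cg]|nD].
    apply: Hg; have Hzg : H (z * g^-1)%g.
      by rewrite HE; split=> //; apply: NM => //; apply: NV; exact: Ns.
    have -> : g = ((z * g^-1)^-1 * z)%g by rewrite invgM invgK mulgVK.
    by apply: HM => //; exact: HV.
  have [g gs Hzg] := cov z Nz; have [Hg|Hg] := pselect (H g).
    by rewrite -(mulgVK g z); apply: HM.
  by case: nD; exists g => //; move: Hzg; rewrite HE => -[].
have BH : B `&` H = B.
  apply: Bc; first by exists 1%g.
    exists (~` D); first by rewrite openC.
    by apply/seteqP; split=> z [Bz /(HD z Bz) ?].
  exists C => //; rewrite HE; apply/seteqP; split=> z [Bz].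
    by move=> [].
  by move=> Cz; do 2?split=> //; apply: BN.
by move: Bx; rewrite -BH => -[].
Qed.

End JonquieresTorus.

(** * Identity components *)

Section GroupLemmas.
Variable G : groupType.
Local Open Scope group_scope.
Implicit Types T D N : set G.

Definition set_prod T D : set G := [set t * d | t in T & d in D].

Lemma set_prod_subgroup T D : subgroup T -> subgroup D ->
  (forall d t, D d -> T t -> T (d * t * d^-1)) -> subgroup (set_prod T D).
Proof.
move=> [T1 TM TV] [D1 DM DV] TD; split.
- by exists 1 => //; exists 1; rewrite ?mulg1.
- move=> _ _ [t Tt [d Dd <-]] [t' Tt' [d' Dd' <-]].
  exists (t * (d * t' * d^-1)); first by apply: TM => //; apply: TD.
  exists (d * d'); first exact: DM.
  by rewrite !mulgA mulgVK.
- move=> _ [t Tt [d Dd <-]].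
  exists (d^-1 * t^-1 * d); first by rewrite -{2}[d]invgK; apply: TD; [exact: DV | exact: TV].
  by exists d^-1; [exact: DV | rewrite mulgK invgM].
Qed.

Lemma semidirect_set_prod T D : subgroup T -> subgroup D ->
  (forall d t, D d -> T t -> T (d * t * d^-1)) -> (forall x, T x -> D x -> x = 1) ->
  semidirect (set_prod T D) T D.
Proof.
move=> sT sD TD TD1; have [S1 SM SV] := set_prod_subgroup sT sD TD.
have [T1 TM TV] := sT; have [D1 DM DV] := sD.
have conj x t : set_prod T D x -> T t -> T (x * t * x^-1).
  move=> [u Tu [d Dd <-]] Tt.
  by have := TM _ _ (TM _ _ Tu (TD _ _ Dd Tt)) (TV _ Tu); rewrite invgM !mulgA.
split=> //.
- by split=> // t Tt; exists t => //; exists 1; rewrite ?mulg1.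
- by split=> // d Dd; exists 1 => //; exists d; rewrite ?mul1g.
- move=> x Sx; apply/seteqP; split=> [_ [t Tt <-]|t Tt]; first exact: conj.
  exists (x^-1 * t * x); last by rewrite !mulgA mulgV mul1g mulgK.
  by rewrite -{2}[x]invgK; apply: conj => //; exact: SV.
split=> //; apply/seteqP; split=> [x [Tx Dx]|_ ->]; first exact: TD1.
by split.
Qed.

Lemma semidirect_trivial T : subgroup T -> semidirect T T [set 1].
Proof.
move=> sT; have s1 : subgroup [set 1 : G].
  by split=> // [x y -> ->|x ->]; rewrite ?mulg1 ?invg1.
have := semidirect_set_prod sT s1; rewrite (_ : set_prod T [set 1] = T); first apply.
- by move=> d t -> Tt; rewrite mul1g invg1 mulg1.
- by [].
apply/seteqP; split=> [_ [t Tt [_ -> <-]]|t Tt]; first by rewrite mulg1.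
by exists t => //; exists 1; rewrite ?mulg1.
Qed.

End GroupLemmas.

Lemma connected_paths (T : topologicalType) (H : set T) (x0 : T) : H x0 ->
  (forall x, H x -> exists B, [/\ connected B, B `<=` H, B x0 & B x]) -> connected H.
Proof.
move=> Hx0 HB; rewrite (_ : H = connected_component H x0).
  exact: component_connected.
apply/seteqP; split; last exact: connected_component_sub.
by move=> x /HB[B [cB BH B0 Bx]]; exists B.
Qed.

Section Components.
Variable k : closedFieldType.
Local Notation K := {fraction {poly k}}.
Local Notation tofrac := (@FracField.tofrac {poly k}).
Hypothesis two_neq0 : (2%:R : k) != 0.
Implicit Types (m : 'M[k]_2) (f l : K).
Let calc := jel_calculus two_neq0.
Local Notation tor := (tor (@jel k)).
Local Notation dia := (dia (@jel k)).
Local Notation torus_set := (torus_set (@jel k)).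
Local Notation diag_norm := (diag_norm (@jel k) (@subst k)).

(** For b nonzero, the family of pairs (2 - a + t (a - 1), b (t - 1)) gives the identity at t = 1
    and (a, b) at t = 2, both in [Gm] because 2 is nonzero. It never vanishes: the second entry is
    zero only at t = 1, where the first one is 1. *)
Lemma torus_connected f : nonsquare f -> connected (torus_set f).
Proof.
move=> nsq; have [T1 _ _] := torus_subgroup calc nsq.
apply: (connected_paths T1) => _ [a [b [ab ->]]].
have path_eq (F : fieldType) (t b' f' : F) : - (b' * f') + t * (b' * f') = (- b' + t * b') * f'.
  by ring.
have path1 (F : fieldType) (a' : F) : 2%:R - a' + 1 * (a' - 1) = 1 by ring.
have path2 (F : fieldType) (a' : F) : 2%:R - a' + 2%:R * (a' - 1) = a' by ring.
have path3 (F : fieldType) (a' : F) : - a' + 2%:R * a' = a' by ring.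
have path0 (F : fieldType) (t a' b' : F) : b' != 0 ->
    (2%:R - a' + t * (a' - 1), - b' + t * b') != (0, 0).
  move=> b0; apply/eqP => -[E1 E2].
  have t1 : t = 1.
    by apply: (mulIf b0); rewrite mul1r; apply/eqP; rewrite -subr_eq0 addrC E2.
  by move: E1; rewrite t1 path1 => /eqP; rewrite oner_eq0.
have [b0|b0] := pselect (b = 0).
  have a0 : a != 0.
    by move: ab; rewrite b0; apply: contraNneq => ->.
  exists [set 1%g]; split; first exact: connected1.
  - by move=> _ ->.
  - by [].
  - by rewrite b0 (tor_a0 calc _ a0).
have {}b0 : b != 0 by exact/eqP.
have det_base (t : k) : t != 0 -> ((1 : {poly k}) * 1 - 0 * 0).[t] != 0.
  by move=> _; rewrite mulr1 mul0r subr0 hornerC oner_neq0.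
have [||beta bm bP] := @family_frac k (2%:R - a) (- (b * f)) (- b) (2%:R - a) (a - 1) (b * f) b (a - 1) 1 0 0 1.
- move=> t _; rewrite path_eq; exact: (norm_neq0 nsq (path0 K (rat_const t) a b b0)).
- exact: det_base.
have bE v : beta v = tor f (2%:R - a + rat_const (Gm_coord v) * (a - 1))
    (- b + rat_const (Gm_coord v) * b).
  have := jelE (bP v); rewrite path_eq /tor hornerC horner0 => ->.
  by congr jel; apply: mx2_eq; rewrite mx2E mxE.
exists (range beta); split; first exact: Gm_connected.
- move=> _ [v _ <-]; rewrite bE; do 2 eexists; split; last reflexivity.
  exact: (path0 K (rat_const (Gm_coord v)) a b b0).
- exists (Gm_of (oner_neq0 k)) => //; rewrite bE Gm_coordK /rat_const polyC1 tofrac1 path1.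
  rewrite (_ : - b + 1 * b = 0); last by rewrite mul1r addNr.
  exact: (tor_a0 calc _ (oner_neq0 _)).
- exists (Gm_of two_neq0) => //; rewrite bE Gm_coordK.
  have -> : rat_const (2%:R : k) = 2%:R by rewrite -(rmorph_nat (const_frac k)).
  by rewrite path2 path3.
Qed.

Lemma rat_constM (s t : k) : rat_const (s * t) = rat_const s * rat_const t.
Proof. by rewrite /rat_const polyCM tofracM. Qed.

Lemma rat_const1 : rat_const (1 : k) = 1.
Proof. by rewrite /rat_const polyC1 tofrac1. Qed.

Lemma rat_const_inj : injective (@rat_const k).
Proof. exact: (fmorph_inj (const_frac k)). Qed.

Lemma mulmx_mx2 (a b c d a' b' c' d' : k) : mx2 a b c d *m mx2 a' b' c' d' =
  mx2 (a * a' + b * c') (a * b' + b * d') (c * a' + d * c') (c * b' + d * d').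
Proof. by apply: mx2_eq; rewrite mulmx2E !mx2E. Qed.

Lemma tauM (s t : k) : s != 0 -> t != 0 -> (tau s * tau t)%g = tau (s * t).
Proof.
move=> s0 t0; rewrite /tau (diaM calc (rat_const_neq0 t0) (rat_const_neq0 s0)) ?tau_unit //.
rewrite substC ?tau_unit // -rat_constM mulmx_mx2 mulr0 mul0r !mulr0 !mul0r !addr0 !add0r mulr1.
by rewrite exprMn.
Qed.

Lemma tau1 : tau (1 : k) = 1%g.
Proof.
rewrite /tau expr1n rat_const1 -(dia1 calc); congr dia.
by apply: mx2_eq; rewrite mx2E mxE.
Qed.

Lemma tauV (t : k) : t != 0 -> (tau t)^-1%g = tau t^-1.
Proof.
move=> t0; apply: (mulgI (tau t)).
by rewrite mulgV tauM ?invr_eq0 // divff // tau1.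
Qed.

Lemma tau_inj (s t : k) : s != 0 -> t != 0 -> tau s = tau t -> s = t.
Proof.
move=> s0 t0; rewrite /tau /dia => /jel_inj[].
- exact: dia_det (rat_const_neq0 s0).
- exact: dia_det (rat_const_neq0 t0).
- exact: tau_unit.
- exact: tau_unit.
move=> [l [_ E _ _ l1]] _; apply/esym/rat_const_inj; rewrite E.
have -> : l = 1 by rewrite [RHS]l1 mulr1.
by rewrite mul1r.
Qed.

Lemma torus12_subgroup : subgroup (torus12 k).
Proof.
rewrite torus12E; split.
- by exists 1; [exact: oner_neq0 | rewrite tau1].
- move=> _ _ [s s0 ->] [t t0 ->]; exists (s * t); first by rewrite mulf_neq0.
  by rewrite tauM.
- by move=> _ [t t0 ->]; exists t^-1; [rewrite invr_eq0 | rewrite tauV].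
Qed.

Lemma torus12_connected : connected (torus12 k).
Proof.
have det_fiber (t : k) : t != 0 ->
    (0 + rat_const t * 1) * (1 + rat_const t * 0) - (0 + rat_const t * 0) * (0 + rat_const t * 0) != 0.
  by move=> t0; rewrite !mulr0 !add0r !addr0 !mulr1 mulr0 subr0 rat_const_neq0.
have det_base (t : k) : t != 0 -> (('X^2 : {poly k}) * 1 - 0 * 0).[t] != 0.
  by move=> t0; rewrite mulr1 mul0r subr0 hornerXn expf_neq0.
have [beta bm bP] := family_frac det_fiber det_base.
suff -> : torus12 k = range beta by exact: Gm_connected.
have bE v : beta v = tau (Gm_coord v).
  have := jelE (bP v); rewrite !mulr0 !add0r !addr0 mulr1.
  by rewrite hornerXn horner0 hornerC.
rewrite torus12E; apply/seteqP; split=> [_ [t t0 ->]|_ [v _ <-]].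
  by exists (Gm_of t0); rewrite // bE.
by exists (Gm_coord v); [exact: Gm_coord_neq0 | rewrite bE].
Qed.

End Components.

(** * The identity component when D is finite, and when f = y *)

Section IdentityComponents.
Variable k : closedFieldType.
Local Notation K := {fraction {poly k}}.
Local Notation tofrac := (@FracField.tofrac {poly k}).
Local Notation Cr := (Cremona k).
Hypothesis two_neq0 : (2%:R : k) != 0.
Implicit Types (m : 'M[k]_2) (f l : K).
Let calc := jel_calculus two_neq0.
Local Notation tor := (tor (@jel k)).
Local Notation dia := (dia (@jel k)).
Local Notation torus_set := (torus_set (@jel k)).
Local Notation diag_norm := (diag_norm (@jel k) (@subst k)).
Local Notation y := (rat_y k).

Section OneTorus.
Variable f : K.
Hypothesis nsq : nonsquare f.

Lemma Jonq_normaliserE : normaliser (Jonq k) (torus f) =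
  set_prod (torus_set f) (diag_norm f).
Proof.
rewrite Jonq_elts torusE //; apply/seteqP; split=> x.
  by move=> /(elts_normaliser calc nsq)[t [d [Tt Dd ->]]]; exists t => //; exists d.
by move=> [t Tt [d Dd <-]]; apply/(elts_normaliser calc nsq); exists t, d.
Qed.

Lemma Jonq_diag_normaliserE : normaliser (Jonq_diag k) (torus f) = diag_norm f.
Proof.
rewrite Jonq_diagE torusE //; apply/seteqP; split=> x.
  by move/(diag_norm_normaliser calc nsq).
by move=> Dx; apply/(diag_norm_normaliser calc nsq).
Qed.

Lemma diag_norm_conj d t : diag_norm f d -> torus_set f t ->
  torus_set f (d * t * d^-1)%g.
Proof.
move=> [l [m [l0 mu mf ->]]] Tt.
by rewrite -(dia_conj_torus calc nsq l0 mu mf nsq); exists t.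
Qed.

Lemma set_prod_diag_normP x : set_prod (torus_set f) (diag_norm f) x <->
  normaliser (elts (@jel k)) (torus_set f) x.
Proof.
split; first by move=> [t Tt [d Dd <-]]; apply/(elts_normaliser calc nsq); exists t, d.
by move=> /(elts_normaliser calc nsq)[t [d [Tt Dd ->]]]; exists t => //; exists d.
Qed.

Lemma diag_norm_set_prod : diag_norm f `<=` set_prod (torus_set f) (diag_norm f).
Proof.
move=> d Dd; have [T1 _ _] := torus_subgroup calc nsq.
by exists 1%g => //; exists d; rewrite ?mul1g.
Qed.

Lemma torus_set_prod : torus_set f `<=` set_prod (torus_set f) (diag_norm f).
Proof.
move=> t Tt; have [D1 _ _] := diag_norm_subgroup calc f.
by exists t => //; exists 1%g; rewrite ?mulg1.
Qed.

Lemma id_componentS (N N' : set Cr) : N `<=` N' -> id_component N `<=` id_component N'.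
Proof. by move=> NN' x [B [B1 BN Bc] Bx]; exists B => //; split=> // z /BN /NN'. Qed.

Lemma id_component_max (N B : set Cr) : B 1%g -> B `<=` N -> connected B ->
  B `<=` id_component N.
Proof. exact: connected_component_max. Qed.

(** Closed conditions that single out the torus within its normaliser, by [torus_centraliser]. *)
Definition torus_centre : set Cr :=
  [set x | (x * tor f 1 1 = tor f 1 1 * x)%g] `&` [set x | (x * tor f y 1 = tor f y 1 * x)%g].

Lemma torus_set_centreE x : set_prod (torus_set f) (diag_norm f) x ->
  torus_set f x <-> torus_centre x.
Proof.
move=> /set_prod_diag_normP Nx; split=> [/(torus_centraliser calc nsq)[_ []]//|[C1 Cy]].
by apply/(torus_centraliser calc nsq).
Qed.

Lemma closed_torus_centre (w : Cr -> Cr) : algebraic_map w ->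
  closed (w @^-1` torus_centre).
Proof.
move=> aw; have := closedI (closed_commute (c := tor f 1 1) aw) (closed_commute (c := tor f y 1) aw).
by [].
Qed.

(** The finitely many diagonal elements represent the cosets of the torus, so
    [id_component_finite_index] applies to it. The component of the diagonal part lies in that of
    the full normaliser, hence in the torus, which meets the diagonal part trivially. *)
Lemma id_component_finite (s : seq Cr) : (forall x, diag_norm f x -> x \in s) ->
  id_component (normaliser (Jonq k) (torus f)) = torus_set f /\
  id_component (normaliser (Jonq_diag k) (torus f)) = [set 1%g].
Proof.
move=> sP; rewrite Jonq_normaliserE Jonq_diag_normaliserE.
have sT := torus_subgroup calc nsq; have sD := diag_norm_subgroup calc f.
have [T1 TM TV] := sT; have [D1 _ _] := sD.
have sN := set_prod_subgroup sT sD (@diag_norm_conj).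
have E : id_component (set_prod (torus_set f) (diag_norm f)) = torus_set f.
  apply/seteqP; split; last first.
    exact: (id_component_max T1 torus_set_prod (torus_connected two_neq0 nsq)).
  pose s' := [seq g <- s | `[< diag_norm f g >]].
  apply: (@id_component_finite_index k _ _ torus_centre s') => //.
  - by have := closed_torus_centre (@cr_algebraic_id k).
  - apply/seteqP; split=> x; last by move=> [Nx Cx]; apply/torus_set_centreE.
    by move=> Tx; split; [exact: torus_set_prod | apply/torus_set_centreE => //; exact: torus_set_prod].
  - by move=> g; rewrite mem_filter => /andP[/asboolP /diag_norm_set_prod].
  move=> _ [t Tt [d Dd <-]]; exists d; last by rewrite mulgK.
  by rewrite mem_filter sP // andbT; apply/asboolP.
split=> //; apply/seteqP; split=> [x xD|_ ->]; last first.
  exact: connected_component_refl.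
apply: (torus_diag_norm calc nsq); last exact: connected_component_sub xD.
by rewrite -E; apply: id_componentS xD; exact: diag_norm_set_prod.
Qed.

End OneTorus.

(** With h = u / v, compare the multiplicities of e in u^2 and p v^2. *)
Lemma square_mup_even (p : {poly k}) (h : K) e : p != 0 -> h ^+ 2 = tofrac p ->
  ~~ odd (mup e p).
Proof.
move=> p0; have [u [v [v0 ->]]] := frac_ex h.
rewrite expr_div_n => E.
have v0' : tofrac v ^+ 2 != 0 by rewrite expf_neq0 // tofrac_eq0.
have : tofrac u ^+ 2 = tofrac p * tofrac v ^+ 2 by rewrite -E divfK.
rewrite -!tofracXn -tofracM => /eqP; rewrite tofrac_eq => /eqP {}E.
have u0 : u != 0 by apply: contraTneq (mulf_neq0 p0 (expf_neq0 2 v0)) => u0; rewrite -E u0 expr0n eqxx.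
have := congr1 (fun p => odd (mup e p)) E.
by rewrite /= !expr2 !mupM ?mulf_neq0 // !oddD !addbb addbF => <-.
Qed.

Lemma nonsquare_y : nonsquare y.
Proof.
move=> h; apply/eqP => E; have := @square_mup_even 'X h 0 (negbT (polyX_eq0 _)) E.
have -> : 'X = ('X - 0%:P) ^+ 1 :> {poly k} by rewrite polyC0 subr0.
by rewrite mup_XsubCX eqxx.
Qed.

Lemma nonsquare_linear (a b : k) (h : K) : a != 0 ->
  h ^+ 2 = rat_const a * y + rat_const b -> False.
Proof.
move=> a0; rewrite /rat_const /rat_y -tofracM -tofracD => E.
have pE : a%:P * 'X + b%:P = a%:P * ('X - (- b / a)%:P).
  have -> : - b / a = - (b / a) by rewrite mulNr.
  by rewrite polyCN opprK mulrDr -polyCM mulrCA divff // mulr1.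
have p0 : a%:P * 'X + b%:P != 0 by rewrite pE mulf_neq0 ?polyC_eq0 ?polyXsubC_eq0.
have := square_mup_even (- b / a) p0 E; rewrite pE mupMr.
  by rewrite -[X in mup _ X]expr1 mup_XsubCX eqxx.
by rewrite rootC.
Qed.

Lemma sqrt_ex (c : k) : exists t, t ^+ 2 = c.
Proof.
have [t E] := @solve_monicpoly k 2 (fun i => if i == 0%N then c else 0) isT.
by exists t; rewrite E !big_ord_recl big_ord0 /= expr0 mulr1 mul0r !addr0.
Qed.

(** The involution (x / y, 1 / y), which exchanges the branch points 0 and infinity of x^2 = y. *)
Definition iota_y : Cr := dia y^-1 (mx2 0 1 1 0).

Lemma y_neq0 : y != 0.
Proof. by rewrite /rat_y tofrac_eq0 polyX_eq0. Qed.

Lemma yV_neq0 : y^-1 != 0.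
Proof. by rewrite invr_eq0 y_neq0. Qed.

Lemma iota_unit : mx2 0 1 1 (0 : k) \in unitmx.
Proof. by rewrite mx2_unit mulr0 mulr1 sub0r oppr_eq0 oner_neq0. Qed.

Lemma rat_const0 : rat_const (0 : k) = 0.
Proof. by rewrite /rat_const polyC0 tofrac0. Qed.

Lemma subst_tau_y t : t != 0 -> subst (mx2 (t ^+ 2) 0 0 1) y = rat_const t ^+ 2 * y.
Proof.
move=> t0; rewrite substX ?tau_unit // /mob_frac !mx2E rat_const0 rat_const1 mul0r addr0 add0r.
by rewrite divr1 expr2 rat_constM.
Qed.

Lemma subst_iota_y : subst (mx2 0 1 1 0) y = y^-1.
Proof.
rewrite substX ?iota_unit // /mob_frac !mx2E rat_const0 rat_const1 mul0r addr0 add0r.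
by rewrite !mul1r.
Qed.

Lemma tau_diag_norm t : t != 0 -> diag_norm y (tau t).
Proof.
move=> t0; exists (rat_const t), (mx2 (t ^+ 2) 0 0 1).
by split; [exact: rat_const_neq0 | exact: tau_unit | exact: subst_tau_y |].
Qed.

Lemma iota_diag_norm : diag_norm y iota_y.
Proof.
exists y^-1, (mx2 0 1 1 0); split; [|exact: iota_unit | |by []].
  by rewrite invr_eq0 y_neq0.
have aux (F : fieldType) (z : F) : z != 0 -> z^-1 = z^-1 ^+ 2 * z by move=> ?; field.
rewrite subst_iota_y; exact: aux y_neq0.
Qed.

Lemma tau_iota t : t != 0 -> (tau t * iota_y)%g = dia (rat_const t / y) (mx2 0 (t ^+ 2) 1 0).
Proof.
move=> t0; have y0 := yV_neq0.
rewrite /tau /iota_y (diaM calc y0 (rat_const_neq0 t0)) ?tau_unit ?iota_unit //.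
by rewrite substC ?iota_unit // mulmx_mx2 !mulr0 !mul0r !mulr1 !addr0 !add0r.
Qed.

Lemma sqrt_rat_const (h : K) (e : k) : h ^+ 2 = rat_const e ->
  exists2 t, t ^+ 2 = e & h = rat_const t.
Proof.
have [t <-] := sqrt_ex e; rewrite [rat_const _](_ : _ = rat_const t ^+ 2); last first.
  by rewrite !expr2 rat_constM.
move=> /eqP; rewrite eqf_sqr => /orP[] /eqP E; first by exists t.
by exists (- t); rewrite ?sqrrN // E /rat_const polyCN tofracN.
Qed.

Lemma diag_norm_yP x : diag_norm y x ->
  exists2 t, t != 0 & x = tau t \/ x = (tau t * iota_y)%g.
Proof.
move=> [l [m [l0 mu E ->]]]; move: E; rewrite substX // => E.
have d0 := mob_den_neq0 mu; have mu' := mu; rewrite unitmx2P in mu'.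
set a := m 0 0 in mu' *; set b := m 0 1 in mu' *.
set c := m 1 0 in mu' d0 *; set d := m 1 1 in mu' d0 *.
have {}E : rat_const a * y + rat_const b = l ^+ 2 * y * (rat_const c * y + rat_const d).
  by rewrite -E /mob_frac divfK.
(* The Moebius map must send 0 to 0 or infinity: otherwise y (a y + b)(c y + d) would be a square
   with a simple zero at 0. *)
have bd : b = 0 \/ d = 0.
  apply: contrapT => /not_orP[b0 d0'].
  pose p := (a%:P * 'X + b%:P) * (c%:P * 'X + d%:P).
  have pr : ~~ root p 0 by rewrite /root /p !hornerE mulf_neq0 //; exact/eqP.
  have p0 : 'X * p != 0.
    by rewrite mulf_neq0 ?polyX_eq0 //; apply: contraNneq pr => ->; rewrite root0.
  have sq : (l * y * (rat_const c * y + rat_const d)) ^+ 2 = tofrac ('X * p).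
    rewrite /p !tofracM !tofracD !tofracM -/(rat_y k) -/(rat_const a) -/(rat_const b).
    rewrite -/(rat_const c) -/(rat_const d) E.
    have aux (F : fieldType) (u v w : F) : (u * v * w) ^+ 2 = v * (u ^+ 2 * v * w * w) by ring.
    exact: aux.
  have := square_mup_even 0 p0 sq; rewrite mupMl //.
  have -> : 'X = ('X - 0%:P) ^+ 1 :> {poly k} by rewrite polyC0 subr0.
  by rewrite mup_XsubCX eqxx.
have [b0|b0] := eqVneq b 0.
  have a0 : a != 0 by apply: contraNneq mu' => ->; rewrite b0 !mul0r subrr.
  have d0' : d != 0 by apply: contraNneq mu' => ->; rewrite b0 mul0r mulr0 subrr.
  have {}E : rat_const a = l ^+ 2 * (rat_const c * y + rat_const d).
    move: E; rewrite b0 rat_const0 addr0.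
    have aux (F : fieldType) (u v w z : F) : v != 0 -> u * v = w * v * z -> u = w * z.
      by move=> v0; rewrite mulrAC => /(mulIf v0).
    exact: aux y_neq0.
  (* Otherwise the linear polynomial a (c y + d) would be the square of l (c y + d). *)
  have c0 : c = 0.
    apply: contrapT => /eqP c0; apply: (@nonsquare_linear (a * c) (a * d)
      (l * (rat_const c * y + rat_const d))); first by rewrite mulf_neq0.
    rewrite !rat_constM.
    have aux (F : fieldType) (u v w z h : F) : u = h ^+ 2 * (v * z + w) ->
        (h * (v * z + w)) ^+ 2 = u * v * z + u * w by move=> ->; ring.
    exact: aux E.
  move: E; rewrite c0 rat_const0 mul0r add0r => E.
  have [t tE lE] : exists2 t, t ^+ 2 = a / d & l = rat_const t.
    apply: sqrt_rat_const; apply: (mulIf (rat_const_neq0 d0')).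
    by rewrite -E -rat_constM divfK.
  have t0 : t != 0 by apply: contraNneq l0 => t0; rewrite lE t0 rat_const0.
  exists t => //; left; rewrite lE /tau -(dia_scale calc (rat_const_neq0 t0) (tau_unit t0) d0').
  congr dia; apply: mx2_eq; rewrite !mxE /= -/a -/b -/c -/d ?mulr0 ?mulr1 //.
  by rewrite tE mulrC divfK.
have dE : d = 0 by case: bd => // bE; rewrite bE eqxx in b0.
have c0 : c != 0 by apply: contraNneq mu' => ->; rewrite dE !mulr0 subrr.
move: E; rewrite dE rat_const0 addr0 => E.
have aE : a = 0.
  apply: contrapT => /eqP a0; apply: (@nonsquare_linear (c * a) (c * b)
      (l * y * rat_const c)); first by rewrite mulf_neq0.
  rewrite !rat_constM.
  have aux (F : fieldType) (u v w z h : F) : u * z + v = h ^+ 2 * z * (w * z) ->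
      (h * z * w) ^+ 2 = w * u * z + w * v.
    by move=> H; rewrite -!mulrA -mulrDr H; ring.
  exact: aux E.
move: E; rewrite aE rat_const0 mul0r add0r => E.
have [t tE lE] : exists2 t, t ^+ 2 = b / c & l * y = rat_const t.
  apply: sqrt_rat_const; apply: (mulIf (rat_const_neq0 c0)).
  rewrite -rat_constM divfK // E.
  have aux (F : fieldType) (u v w : F) : (u * v) ^+ 2 * w = u ^+ 2 * v * (w * v) by ring.
  exact: aux.
have t0 : t != 0.
  by apply: contraNneq b0 => t0; move: tE; rewrite t0 expr0n /= => /esym/eqP; rewrite mulf_eq0 invr_eq0 (negPf c0) orbF.
have lE' : l = rat_const t / y by rewrite -lE (mulfK y_neq0).
have ut : mx2 0 (t ^+ 2) 1 0 \in unitmx.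
  by rewrite mx2_unit mulr0 mulr1 sub0r oppr_eq0 expf_neq0.
have l0' : rat_const t / y != 0 := mulf_neq0 (rat_const_neq0 t0) yV_neq0.
exists t => //; right; rewrite (tau_iota t0) lE' -(dia_scale calc l0' ut c0).
congr dia; apply: mx2_eq; rewrite !mxE /= -/a -/b -/c -/d ?mulr0 ?mulr1 //.
by rewrite tE mulrC divfK.
Qed.

Lemma iota_tau c : c != 0 -> (iota_y * tau c * iota_y^-1)%g = tau c^-1.
Proof.
move=> c0; have y0 := yV_neq0.
have c0' : c^-1 != 0 by rewrite invr_eq0.
suff -> : (iota_y * tau c)%g = (tau c^-1 * iota_y)%g by rewrite mulgK.
rewrite tau_iota // /iota_y /tau (diaM calc (rat_const_neq0 c0) y0) ?tau_unit ?iota_unit //.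
have -> : subst (mx2 (c ^+ 2) 0 0 1) y^-1 = (rat_const c ^+ 2 * y)^-1.
  by rewrite -(subst_tau_y c0) -(subst_morphE (tau_unit c0)) fmorphV.
have ut : mx2 0 (c^-1 ^+ 2) 1 0 \in unitmx.
  by rewrite mx2_unit mulr0 mulr1 sub0r oppr_eq0 expf_neq0.
have aux (F : fieldType) (u v z : F) : u != 0 -> z != 0 -> v * u = 1 ->
    (u ^+ 2 * z)^-1 * u = v / z.
  move=> u0 z0 uv; have -> : v = u^-1 by apply: (mulIf u0); rewrite uv mulVf.
  by field; rewrite u0 z0.
rewrite (aux _ _ (rat_const c^-1) _ (rat_const_neq0 c0) y_neq0); last first.
  by rewrite -rat_constM mulVf // rat_const1.
have l0 : rat_const c^-1 / y != 0 := mulf_neq0 (rat_const_neq0 c0') yV_neq0.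
rewrite -[RHS](dia_scale calc l0 ut (expf_neq0 2 c0)); congr dia.
rewrite mulmx_mx2; apply: mx2_eq; rewrite !mxE /= ?mulr0 ?mul0r ?mulr1 ?mul1r ?addr0 ?add0r //.
by rewrite -exprMn divff // expr1n.
Qed.

Local Notation Ny := (set_prod (torus_set y) (diag_norm y)).
Local Notation Hy := (set_prod (torus_set y) (torus12 k)).

Lemma torus12_diag_norm : torus12 k `<=` diag_norm y.
Proof. by rewrite torus12E => _ [t t0 ->]; exact: tau_diag_norm. Qed.

Lemma Hy_subgroup : subgroup Hy.
Proof.
apply: set_prod_subgroup (torus_subgroup calc nonsquare_y) (torus12_subgroup two_neq0) _.
by move=> d t /torus12_diag_norm; exact: diag_norm_conj nonsquare_y d t.
Qed.

(** An element t d is joined to 1 inside the union of the torus and the translate of T_{1,2} by t,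
    two connected sets that share t. *)
Lemma Hy_connected : connected Hy.
Proof.
have [T1 _ _] := torus_subgroup calc nonsquare_y; have [D1 _ _] := torus12_subgroup two_neq0.
have H1 : Hy 1%g by exists 1%g => //; exists 1%g; rewrite ?mulg1.
apply: (connected_paths H1) => _ [t Tt [d Dd <-]].
exists (torus_set y `|` [set (t * z)%g | z in torus12 k]); split.
- apply: connectedU; [|exact: (torus_connected two_neq0 nonsquare_y)|].
    by exists t; split=> //; exists 1%g; rewrite ?mulg1.
  apply: connected_continuous_connected; first exact: (@torus12_connected k).
  apply: continuous_subspaceT; apply: cr_continuous.
  exact: (cr_algebraic_mul (cr_algebraic_cst _) (@cr_algebraic_id k)).
- move=> u [Tu|[z Dz <-]]; last by exists t => //; exists z.
  by exists u => //; exists 1%g; rewrite ?mulg1.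
- by left.
- by right; exists d.
Qed.

(* Conjugation by iota_y inverts the one-parameter group tau, so commutators  *)
(* with tau c separate the two cosets when c^2 != 1.                          *)
Lemma Hy_closed : exists2 C : set Cr, closed C & Hy = Ny `&` C.
Proof.
have sT := torus_subgroup calc nonsquare_y; have sD := diag_norm_subgroup calc y.
have [T1 TM TV] := sT.
have conj := @diag_norm_conj y nonsquare_y.
have [N1 NM NV] := set_prod_subgroup sT sD conj.
have [c cP] : exists c : k, 'X * ('X^2 - 1) != 0 :> {poly k} /\ ~~ root ('X * ('X^2 - 1)) c.
  have nz : 'X * ('X^2 - 1) != 0 :> {poly k}.
    by rewrite mulf_neq0 ?polyX_eq0 // monic_neq0 // monicXnsubC.
  by have /closed_nonrootP[c] := nz; exists c.
have [c0 c2] : c != 0 /\ c ^+ 2 != 1.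
  case: cP => _; rewrite /root !hornerE mulf_eq0 negb_or => /andP[c0 c2]; split=> //.
  by rewrite -subr_eq0.
pose w (x : Cr) : Cr := (x * tau c * x^-1 * (tau c)^-1)%g.
have aw : algebraic_map w.
  have ac := cr_algebraic_cst (tau c); have ac' := cr_algebraic_cst (tau c)^-1%g.
  have ai := @cr_algebraic_id k.
  exact: (cr_algebraic_mul (cr_algebraic_mul (cr_algebraic_mul ai ac) (cr_algebraic_inv ai)) ac').
exists (w @^-1` torus_centre y); first exact: closed_torus_centre.
have Tc t : torus_set y t -> torus_set y (t * (tau c * t^-1 * (tau c)^-1))%g.
  by move=> Tt; apply: TM => //; apply: conj; [exact: tau_diag_norm | exact: TV].
have Dtau := tau_diag_norm c0.
apply/seteqP; split=> x.
  move=> [t Tt [d Dd <-]]; have Ntd : Ny (t * d)%g.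
    by exists t => //; exists d => //; exact: torus12_diag_norm.
  split=> //; suff : torus_centre y (w (t * d)%g) by [].
  (* Here d commutes with [tau c], so the commutator stays in the torus. *)
  have -> : (w (t * d) = t * (tau c * t^-1 * (tau c)^-1))%g.
    move: Dd; rewrite torus12E => -[s s0 ->].
    rewrite /w invgM !mulgA -[(t * tau s * tau c)%g]mulgA tauM // mulrC -tauM // !mulgA.
    by rewrite mulgK.
  apply/(torus_set_centreE nonsquare_y); last exact: Tc.
  by apply: torus_set_prod; exact: Tc.
move=> [Nx wx]; have [t Tt [d Dd xE]] := Nx.
have [s s0 [dE|dE]] := diag_norm_yP Dd.
  by exists t => //; exists d => //; rewrite torus12E dE; exists s.
have Ntau z : z != 0 -> Ny (tau z) by move=> z0; exact: (diag_norm_set_prod nonsquare_y (tau_diag_norm z0)).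
have Nc := Ntau _ c0.
have Nwx : Ny (w x) := NM _ _ (NM _ _ (NM _ _ Nx Nc) (NV _ Nx)) (NV _ Nc).
have Twx : torus_set y (w x) by apply/(torus_set_centreE nonsquare_y).
have c0' : c^-1 != 0 by rewrite invr_eq0.
(* In the other coset d inverts [tau c], which leaves a factor in T_{1,2} with parameter c^-2. It
   would lie in the torus, hence be trivial, against c^2 != 1. *)
have wE : (w x = t * (tau c^-1 * t^-1 * (tau c^-1)^-1) * (tau c^-1 * (tau c)^-1))%g.
  have dtd : (d * tau c * d^-1)%g = tau c^-1.
    rewrite dE invgM !mulgA -[(tau s * iota_y * tau c)%g]mulgA -[(tau s * _ * _)%g]mulgA.
    by rewrite iota_tau // tauM // mulrC -tauM // mulgK.
  by rewrite /w -xE invgM !mulgA -[(t * d * tau c)%g]mulgA -[(t * _ * d^-1)%g]mulgA dtd !mulgVK.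
have Tcc : torus_set y (tau c^-1 * (tau c)^-1)%g.
  have T' : torus_set y (t * (tau c^-1 * t^-1 * (tau c^-1)^-1))%g.
    by apply: TM => //; apply: conj; [exact: tau_diag_norm | exact: TV].
  have := TM _ _ (TV _ T') Twx; rewrite wE.
  by rewrite mulKg.
have Dcc : diag_norm y (tau c^-1 * (tau c)^-1)%g.
  by rewrite tauV // tauM //; apply: tau_diag_norm; rewrite mulf_neq0.
have := torus_diag_norm calc nonsquare_y Tcc Dcc; rewrite tauV // tauM // -(tau1 two_neq0).
move=> /tau_inj; rewrite mulf_neq0 ?oner_neq0 // => /(_ isT isT) E.
case/negP: c2; apply/eqP; rewrite expr2 -[RHS]invr1 -E invfM !invrK //.
Qed.

Lemma id_component_y : id_component (normaliser (Jonq k) (torus y)) = Hy /\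
  id_component (normaliser (Jonq_diag k) (torus y)) = torus12 k.
Proof.
rewrite (Jonq_normaliserE nonsquare_y) (Jonq_diag_normaliserE nonsquare_y).
have sT := torus_subgroup calc nonsquare_y; have sD := diag_norm_subgroup calc y.
have sH := Hy_subgroup; have [H1 _ _] := sH.
have sN := set_prod_subgroup sT sD (@diag_norm_conj y nonsquare_y).
have HN : Hy `<=` Ny.
  by move=> _ [t Tt [d Dd <-]]; exists t => //; exists d => //; exact: torus12_diag_norm.
have [C cC HE] := Hy_closed.
have E : id_component Ny = Hy.
  apply/seteqP; split; last exact: (id_component_max H1 HN Hy_connected).
  apply: (@id_component_finite_index k _ _ C [:: 1%g; iota_y]) => //.
    move=> g; rewrite !inE => /orP[] /eqP ->; first by case: sN.
    exact: (diag_norm_set_prod nonsquare_y iota_diag_norm).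
  move=> _ [t Tt [d /diag_norm_yP[s s0 [->|->]] <-]].
    exists 1%g; first by rewrite mem_head.
    by rewrite invg1 mulg1; exists t => //; exists (tau s) => //; rewrite torus12E; exists s.
  exists iota_y; first by rewrite !inE eqxx orbT.
  by rewrite mulgA mulgK; exists t => //; exists (tau s) => //; rewrite torus12E; exists s.
split=> //; have [D1 DM DV] := (torus12_subgroup two_neq0); apply/seteqP; split=> [x xD|]; last first.
  exact: (id_component_max D1 torus12_diag_norm (@torus12_connected k)).
have Dx : diag_norm y x := connected_component_sub xD.
have : Hy x by rewrite -E; apply: id_componentS xD; exact: (diag_norm_set_prod nonsquare_y).
(* The torus factor t = x d^-1 of a diagonal element is itself diagonal, hence trivial. *)
move=> [t Tt [d Dd xE]]; suff t1 : t = 1%g by rewrite -xE t1 mul1g.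
apply: (torus_diag_norm calc nonsquare_y Tt); have -> : t = (x * d^-1)%g by rewrite -xE mulgK.
have [_ M V] := sD; apply: M => //; apply: V; exact: torus12_diag_norm.
Qed.

Lemma semidirect_y : semidirect Hy (torus_set y) (torus12 k).
Proof.
apply: semidirect_set_prod (torus_subgroup calc nonsquare_y) (torus12_subgroup two_neq0) _ _.
  by move=> d t /torus12_diag_norm; exact: diag_norm_conj nonsquare_y d t.
by move=> x Tx /torus12_diag_norm; exact: (torus_diag_norm calc nonsquare_y).
Qed.

Lemma torus12_Gm : isomorphic_Gm (torus12 k).
Proof.
exists (@tau k); split; last by move=> s t s0 t0; rewrite tauM.
rewrite torus12E; split.
- by move=> t t0; exists t.
- by move=> s t /set_mem s0 /set_mem t0; exact: tau_inj.
- by move=> _ [t t0 ->]; exists t.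
Qed.

End IdentityComponents.

(** * Transport of normalisers and components by conjugation *)

Section ConjugationTransport.
Variables (k : closedFieldType) (psi : Cremona k).
Local Notation Cr := (Cremona k).
Local Open Scope group_scope.

Definition conj_by (x : Cr) : Cr := psi * x * psi^-1.
Definition conj_by' (x : Cr) : Cr := psi^-1 * x * psi.

Lemma conj_byK : cancel conj_by conj_by'.
Proof. by move=> x; rewrite /conj_by /conj_by' !mulgA mulVg mul1g mulgVK. Qed.

Lemma conj_byVK : cancel conj_by' conj_by.
Proof. by move=> x; rewrite /conj_by /conj_by' !mulgA mulgV mul1g mulgK. Qed.

Lemma conj_byM x x' : conj_by (x * x') = conj_by x * conj_by x'.
Proof. by rewrite /conj_by !mulgA mulgVK. Qed.

Lemma conj_by1 : conj_by 1 = 1.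
Proof. by rewrite /conj_by mulg1 mulgV. Qed.

Lemma conj_byV x : conj_by x^-1 = (conj_by x)^-1.
Proof. by rewrite /conj_by !invgM invgK mulgA. Qed.

Lemma conj_by_continuous : continuous conj_by.
Proof.
apply: cr_continuous; have ac := @cr_algebraic_cst k.
exact: (cr_algebraic_mul (cr_algebraic_mul (ac _) (@cr_algebraic_id k)) (ac _)).
Qed.

Lemma conj_by'_continuous : continuous conj_by'.
Proof.
apply: cr_continuous; have ac := @cr_algebraic_cst k.
exact: (cr_algebraic_mul (cr_algebraic_mul (ac _) (@cr_algebraic_id k)) (ac _)).
Qed.

Lemma conj_image (w : Cr -> Cr) (B : set Cr) : continuous w -> connected B ->
  connected [set w x | x in B].
Proof.
by move=> cw cB; apply: connected_continuous_connected cB _; exact: continuous_subspaceT.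
Qed.

Lemma id_component_conj (N : set Cr) :
  id_component (conj_by @^-1` N) = conj_by @^-1` id_component N.
Proof.
apply/seteqP; split=> x [B [B1 BN Bc] Bx].
  exists [set conj_by z | z in B]; last by exists x.
  split; [by exists 1; rewrite ?conj_by1 | by move=> _ [z /BN Nz <-] |].
  exact: conj_image conj_by_continuous Bc.
exists [set conj_by' z | z in B]; last by exists (conj_by x); rewrite ?conj_byK.
split; [by exists 1 => //; rewrite -{1}conj_by1 conj_byK | |].
  by move=> _ [z /BN Nz <-]; rewrite /preimage /= conj_byVK.
exact: conj_image conj_by'_continuous Bc.
Qed.

Lemma normaliser_conj (H T T' : set Cr) : (forall x x', H x -> H x' -> H (x * x')) ->
  H psi -> H psi^-1 -> [set conj_by t | t in T] = T' -> normaliser H T = conj_by @^-1` normaliser H T'.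
Proof.
move=> HM Hpsi Hpsi' TE; rewrite -{T'}TE.
have HE x : H (conj_by x) <-> H x.
  split=> Hx; last exact: HM (HM _ _ Hpsi Hx) Hpsi'.
  by rewrite -(conj_byK x); exact: HM (HM _ _ Hpsi' Hx) Hpsi.
have cE x t : conj_by x * conj_by t * (conj_by x)^-1 = conj_by (x * t * x^-1).
  by rewrite -conj_byV -!conj_byM.
apply/seteqP; split=> x [Hx xT]; split; try exact/HE.
- apply/seteqP; split=> [_ [_ [t Tt <-] <-]|_ [t Tt <-]].
    by exists (x * t * x^-1); [rewrite -xT; exists t | rewrite cE].
  have : [set x * u * x^-1 | u in T] t by rewrite xT.
  by move=> [u Tu <-]; exists (conj_by u); [exists u | rewrite cE].
apply/seteqP; split=> [_ [t Tt <-]|t Tt].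
  have : [set conj_by z | z in T] (conj_by (x * t * x^-1)).
    by rewrite -xT -cE; exists (conj_by t) => //; exists t.
  by move=> [u Tu /(can_inj conj_byK) <-].
have : [set conj_by z | z in T] (conj_by t) by exists t.
rewrite -xT => -[_ [u Tu <-]]; rewrite cE => /(can_inj conj_byK) E.
by exists u.
Qed.

Lemma subgroup_conj (H : set Cr) : subgroup H -> subgroup (conj_by @^-1` H).
Proof.
move=> [H1 HM HV]; split; rewrite /preimage /= ?conj_by1 //.
  by move=> x x' Hx Hx'; rewrite conj_byM; exact: HM.
by move=> x Hx; rewrite conj_byV; exact: HV.
Qed.

Lemma semidirect_conj (K N H : set Cr) : semidirect K N H ->
  semidirect (conj_by @^-1` K) (conj_by @^-1` N) (conj_by @^-1` H).
Proof.
move=> [sK [sN NK] [sH HK] KN [KE NH]]; split.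
- exact: subgroup_conj.
- by split; [exact: subgroup_conj | move=> x /NK].
- by split; [exact: subgroup_conj | move=> x /HK].
- move=> x Kx; apply/seteqP; split=> [_ [n Nn <-]|n Nn].
    rewrite /preimage /= -(KN _ Kx) !conj_byM conj_byV.
    by exists (conj_by n).
  have : [set conj_by x * z * (conj_by x)^-1 | z in N] (conj_by n) by rewrite KN.
  move=> [z Nz E]; exists (conj_by' z).
    by rewrite /preimage /= conj_byVK.
  by apply: (can_inj conj_byK); rewrite 2!conj_byM conj_byV conj_byVK.
split.
  have KP z : K z <-> [set n * h | n in N & h in H] z by rewrite -KE.
  apply/seteqP; split=> [x /KP[n Nn [h Hh E]]|_ [n Nn [h Hh <-]]].
    exists (conj_by' n).
      by rewrite /preimage /= conj_byVK.
    exists (conj_by' h); first by rewrite /preimage /= conj_byVK.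
    by apply: (can_inj conj_byK); rewrite conj_byM !conj_byVK.
  by apply/KP; rewrite conj_byM; exists (conj_by n) => //; exists (conj_by h).
apply/seteqP; split=> [x [Nx Hx]|_ ->].
  have : (N `&` H) (conj_by x) by [].
  by rewrite NH /= => E; apply: (can_inj conj_byK); rewrite E conj_by1.
have : (N `&` H) 1 by rewrite NH.
by move=> [? ?]; split; rewrite /preimage /= conj_by1.
Qed.

Lemma isomorphic_Gm_conj (H : set Cr) : isomorphic_Gm H ->
  isomorphic_Gm (conj_by @^-1` H).
Proof.
move=> [h [[hH hI hS] hM]]; exists (conj_by' \o h); split.
  split.
  - by move=> t t0; rewrite /preimage /= conj_byVK; exact: hH.
  - move=> s t s0 t0 /= /(congr1 conj_by); rewrite !conj_byVK; exact: hI.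
  - move=> x /hS[t t0 E]; exists t => //=; by rewrite E conj_byK.
move=> s t s0 t0 /=; apply: (can_inj conj_byK).
by rewrite conj_byM !conj_byVK hM.
Qed.

End ConjugationTransport.

(** * Tori conjugate to that of y *)

Section RationalTorus.
Variable k : closedFieldType.
Local Notation K := {fraction {poly k}}.
Local Notation tofrac := (@FracField.tofrac {poly k}).
Local Notation Cr := (Cremona k).
Hypothesis two_neq0 : (2%:R : k) != 0.
Let calc := jel_calculus two_neq0.
Local Notation y := (rat_y k).

Lemma torus_conj_y f (l : K) (n : 'M[k]_2) : nonsquare f -> l != 0 ->
  n \in unitmx -> subst n f = l ^+ 2 * y -> exists psi : Cr,
    [/\ Jonq_diag k psi, Jonq_diag k psi^-1%g &
        [set conj_by psi t | t in torus f] = torus y].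
Proof.
move=> nsq l0 nu nf; have nu' : invmx n \in unitmx by rewrite unitmx_inv.
have q0 : subst (invmx n) l != 0 by rewrite (sb_eq0 calc l nu').
have [_ DM DV] := diags_subgroup calc.
have q0' : (subst (invmx n) l)^-1 != 0 by rewrite invr_eq0.
(* From f o n = l^2 y one gets y o n^-1 = (l o n^-1)^-2 f, which is the condition of
   [dia_conj_torus] for carrying the torus of f to that of y. *)
pose psi : Cr := dia (@jel k) (subst (invmx n) l)^-1 (invmx n).
have Dpsi : diags (@jel k) psi by exists (subst (invmx n) l)^-1, (invmx n).
exists psi; rewrite Jonq_diagE; split; [exact: Dpsi | exact: DV |].
rewrite (torusE nsq) (torusE (@nonsquare_y k)).
apply: (dia_conj_torus calc nsq q0' nu' _ (@nonsquare_y k)).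
have aux (F : fieldType) (u v w : F) : u != 0 -> v = u ^+ 2 * w -> w = u^-1 ^+ 2 * v.
  by move=> u0 ->; field.
apply: aux q0 _.
rewrite -[LHS](sbVK calc nu f) nf !expr2 (sbM calc (l * l) y nu').
by rewrite (sbM calc l l nu').
Qed.

Lemma rational_torus f (l : K) (n : 'M[k]_2) : nonsquare f -> l != 0 ->
  n \in unitmx -> subst n f = l ^+ 2 * y ->
  semidirect (id_component (normaliser (Jonq k) (torus f))) (torus f)
    (id_component (normaliser (Jonq_diag k) (torus f))) /\
  isomorphic_Gm (id_component (normaliser (Jonq_diag k) (torus f))).
Proof.
move=> nsq l0 nu nf; have [psi [Dpsi Dpsi' psiT]] := torus_conj_y nsq l0 nu nf.
have DM := (diags_subgroup calc).
rewrite Jonq_diagE in Dpsi Dpsi'; have [_ DMul _] := DM.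
have NE := normaliser_conj (@eltsM _ _ _ _ _ _ calc) (diags_elts Dpsi) (diags_elts Dpsi') psiT.
have NDE := normaliser_conj DMul Dpsi Dpsi' psiT.
have TE : torus f = conj_by psi @^-1` torus y.
  rewrite -psiT; apply/seteqP; split=> [t Tt|t [u Tu /(can_inj (@conj_byK k psi)) <-] //].
  by exists t.
have [Ey Dy] := id_component_y two_neq0.
have sy := semidirect_y two_neq0; have gy := torus12_Gm two_neq0.
rewrite -Ey -Dy -(torusE (@nonsquare_y k)) Jonq_elts Jonq_diagE in sy.
rewrite -Dy Jonq_diagE in gy; rewrite Jonq_elts Jonq_diagE.
rewrite NE NDE !id_component_conj TE; split; first exact: semidirect_conj.
exact: isomorphic_Gm_conj.
Qed.

End RationalTorus.

(** * Branch points *)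

Section BranchPoints.
Variable k : closedFieldType.
Local Notation K := {fraction {poly k}}.
Local Notation tofrac := (@FracField.tofrac {poly k}).
Local Notation Cr := (Cremona k).
Hypothesis two_neq0 : (2%:R : k) != 0.
Let calc := jel_calculus two_neq0.
Local Notation y := (rat_y k).
Local Notation diag_norm := (diag_norm (@jel k) (@subst k)).
Local Notation dia := (dia (@jel k)).
Implicit Types (r : seq k) (m : 'M[k]_2).

Definition root_poly r : {poly k} := \prod_(c <- r) ('X - c%:P).

Lemma root_poly_neq0 r : root_poly r != 0.
Proof. by rewrite monic_neq0 // monic_prod_XsubC. Qed.

(** When a root already occurs in r, its two occurrences are moved into the square. *)
Lemma squarefree_part (s : seq k) : exists (p : {poly k}) r,
  [/\ p != 0, uniq r & root_poly s = p ^+ 2 * root_poly r].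
Proof.
elim: s => [|c s [p [r [p0 ur E]]]]; first by exists 1, [::]; rewrite oner_neq0 expr1n mul1r.
rewrite /root_poly big_cons -/(root_poly s) E.
have [cr|cr] := boolP (c \in r); last first.
  exists p, (c :: r); split=> //=; first by rewrite cr.
  by rewrite /root_poly big_cons mulrCA.
exists (p * ('X - c%:P)), (rem c r); split.
- by rewrite mulf_neq0 ?polyXsubC_eq0.
- exact: rem_uniq.
rewrite /root_poly (perm_big _ (perm_to_rem cr)) /= big_cons.
by ring.
Qed.

(** f = u / v is u v divided by the square v^2, and the leading coefficient of u v is a square. The
    list is nonempty because f is not a square. *)
Lemma branch_points (f : K) : nonsquare f -> exists (q : K) r,
  [/\ q != 0, uniq r, r != [::] & f = q ^+ 2 * tofrac (root_poly r)].
Proof.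
move=> nsq; have [u [v [v0 fE]]] := frac_ex f.
have [s sE] := closed_field_poly_normal (u * v).
have [p [r [p0 ur E]]] := squarefree_part s.
have [t tE] := sqrt_ex (lead_coef (u * v)).
have v0' : tofrac v != 0 by rewrite tofrac_eq0.
have fE' : f = (tofrac (t%:P * p) / tofrac v) ^+ 2 * tofrac (root_poly r).
  have aux (F : fieldType) (a b c d e : F) : b != 0 -> a * b = (c * d) ^+ 2 * e ->
      a / b = (c * d / b) ^+ 2 * e.
    by move=> b0 H; rewrite expr_div_n mulrAC -H expr2 invfM mulrA mulfK.
  rewrite [LHS]fE tofracM; apply: (aux _ _ _ _ _ _ v0').
  rewrite -!tofracM -tofracXn -tofracM sE -/(root_poly s) E -tE -mul_polyC polyC_exp.
  by congr tofrac; ring.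
have r0 : r != [::].
  apply/eqP => r0; have := nsq (tofrac (t%:P * p) / tofrac v).
  by rewrite fE' r0 /root_poly big_nil tofrac1 mulr1 eqxx.
exists (tofrac (t%:P * p) / tofrac v), r; split; [|exact: ur|exact: r0|exact: fE'].
apply/eqP => q0; have := nsq 0; rewrite fE' q0.
by rewrite !expr0n mul0r eqxx.
Qed.

(* z = (w - c) / (w - d), solved for w *)
Lemma rational_case (f q : K) r : q != 0 -> uniq r -> r != [::] -> (size r <= 2)%N ->
  f = q ^+ 2 * tofrac (root_poly r) ->
  exists l n, [/\ l != 0, n \in unitmx & subst n f = l ^+ 2 * y].
Proof.
move=> q0 ur r0 sr fE.
have sq0 n : n \in unitmx -> subst n q != 0 by move=> nu; rewrite (sb_eq0 calc q nu).
have sfE n : n \in unitmx -> subst n f = subst n q * subst n q * subst n (tofrac (root_poly r)).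
  by move=> nu; rewrite fE expr2 (sbM calc (q * q) _ nu) (sbM calc q q nu).
have sXC n c : n \in unitmx -> subst n (tofrac ('X - c%:P)) = mob_frac n - rat_const c.
  move=> nu; rewrite -(substX nu) -(substC c nu) -!(subst_morphE nu) -rmorphB tofracB.
  by [].
case: r ur r0 sr fE sfE => [|c [|d [|? ?]]] //= ur _ _ fE sfE.
  have nu : mx2 1 c 0 1 \in unitmx by rewrite mx2_unit mulr1 mulr0 subr0 oner_neq0.
  exists (subst (mx2 1 c 0 1) q), (mx2 1 c 0 1); split; [exact: sq0 | exact: nu |].
  rewrite (sfE _ nu) /root_poly big_seq1 (sXC _ _ nu) /mob_frac !mx2E.
  have aux (F : fieldType) (u v w : F) : u * u * ((1 * v + w) / (0 * v + 1) - w) = u ^+ 2 * v.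
    by rewrite mul0r add0r divr1 mul1r addrK expr2.
  rewrite rat_const0 rat_const1; exact: aux.
have cd : c != d by move: ur; rewrite inE andbT.
have nu : mx2 (- d) c (- 1) 1 \in unitmx.
  by rewrite mx2_unit mulr1 mulrN1 opprK addrC subr_eq0.
pose n := mx2 (- d) c (- 1) 1; pose w := mob_frac n.
have w0 : w - rat_const d != 0 by rewrite subr_eq0; exact: mob_frac_nonconst nu d.
exists (subst n q * (w - rat_const d)), n; split; [exact: mulf_neq0 (sq0 _ nu) w0 | exact: nu |].
rewrite (sfE _ nu) /root_poly big_cons big_seq1 tofracM.
rewrite (sbM calc (tofrac ('X - c%:P)) (tofrac ('X - d%:P)) nu) !(sXC _ _ nu) -/n -/w.
have den := mob_den_neq0 nu.
have aux (F : fieldType) (u v z e : F) : - 1 * z + 1 != 0 ->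
    v = (- e * z + u) / (- 1 * z + 1) -> v - u = z * (v - e).
  by move=> z0 ->; field.
have wE : w - rat_const c = y * (w - rat_const d).
  move: den; rewrite /w /mob_frac !mx2E rat_const1.
  have -> : rat_const (- 1 : k) = - 1 by rewrite /rat_const polyCN polyC1 tofracN tofrac1.
  have -> : rat_const (- d) = - rat_const d by rewrite /rat_const polyCN tofracN.
  by move=> den; exact: aux den erefl.
have aux' (F : fieldType) (a b z : F) : a * a * (z * b * b) = (a * b) ^+ 2 * z by ring.
rewrite wE; exact: aux'.
Qed.

(** m(e) = v on the projective line, with [None] as infinity; cross multiplication avoids dividing
    by zero. *)
Definition image_of (v : option k) (e : k) m : Prop :=
  match v with
  | Some c => m 0 0 * e + m 0 1 = c * (m 1 0 * e + m 1 1)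
  | None => m 1 0 * e + m 1 1 = 0
  end.

Lemma image_of_cross v e m m' : image_of v e m -> image_of v e m' ->
  (m 0 0 * e + m 0 1) * (m' 1 0 * e + m' 1 1) = (m' 0 0 * e + m' 0 1) * (m 1 0 * e + m 1 1).
Proof. by case: v => [c|] /= -> ->; [ring | rewrite !mulr0]. Qed.

(** Cross multiplying m(e) = m'(e) gives a polynomial of degree at most 2 with three distinct roots,
    hence zero. *)
Lemma three_images v1 v2 v3 e1 e2 e3 m m' : m \in unitmx -> m' \in unitmx ->
  uniq [:: e1; e2; e3] -> image_of v1 e1 m -> image_of v2 e2 m -> image_of v3 e3 m ->
  image_of v1 e1 m' -> image_of v2 e2 m' -> image_of v3 e3 m' ->
  exists2 u, u != 0 & m' = u *: m.
Proof.
rewrite !unitmx2P => mu mu' ue i1 i2 i3 i1' i2' i3'.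
pose e2' := m 0 0 * m' 1 0 - m' 0 0 * m 1 0.
pose e1' := m 0 0 * m' 1 1 + m 0 1 * m' 1 0 - (m' 0 0 * m 1 1 + m' 0 1 * m 1 0).
pose e0' := m 0 1 * m' 1 1 - m' 0 1 * m 1 1.
have rt v e : image_of v e m -> image_of v e m' -> root (Poly [:: e0'; e1'; e2']) e.
  move=> i i'; apply/eqP; rewrite horner_Poly /=.
  have := image_of_cross i i' => /eqP; rewrite -subr_eq0 => /eqP E; rewrite -[RHS]E.
  by rewrite /e0' /e1' /e2'; ring.
have E : Poly [:: e0'; e1'; e2'] = 0.
  apply/eqP; apply: contrapT => /negP P0.
  have roots : all (root (Poly [:: e0'; e1'; e2'])) [:: e1; e2; e3].
    by apply/and4P; split; rewrite ?(rt _ _ i1 i1') ?(rt _ _ i2 i2') ?(rt _ _ i3 i3').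
  have sz := size_Poly [:: e0'; e1'; e2'].
  by have := max_poly_roots P0 roots ue; rewrite ltnNge sz.
have c i : (Poly [:: e0'; e1'; e2'])`_i = 0 by rewrite E coef0.
have := c 2%N; have := c 1%N; have := c 0%N; rewrite !coef_Poly /=.
move=> /eqP; rewrite subr_eq0 => /eqP c0 /eqP; rewrite subr_eq0 => /eqP c1.
move=> /eqP; rewrite subr_eq0 => /eqP c2.
have [u [u0 E1 E2 E3 E4]] := proportional4 mu mu' c2 c0 c1.
by exists u => //; apply: mx2_eq; rewrite mxE.
Qed.

(* Comparing multiplicities at e: the branch divisor is preserved. *)
Lemma branch_image (f q l : K) r m e : q != 0 -> uniq r -> l != 0 -> m \in unitmx ->
  f = q ^+ 2 * tofrac (root_poly r) -> subst m f = l ^+ 2 * f -> e \in r ->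
  exists2 v, v \in None :: map Some r & image_of v e m.
Proof.
move=> q0 ur l0 mu fE mf er.
pose den : {poly k} := (m 1 0)%:P * 'X + (m 1 1)%:P.
pose num c : {poly k} := (m 0 0)%:P * 'X + (m 0 1)%:P - c%:P * den.
have denE : tofrac den = rat_const (m 1 0) * y + rat_const (m 1 1).
  by rewrite /den tofracD tofracM.
have den0 : tofrac den != 0 by rewrite denE; exact: mob_den_neq0.
have numE c : tofrac (num c) = (mob_frac m - rat_const c) * tofrac den.
  rewrite mulrBl /mob_frac -denE divfK // /num tofracB tofracD !tofracM.
  by [].
have num0 c : num c != 0.
  rewrite -tofrac_eq0 numE; apply: mulf_neq0 den0.
  by rewrite subr_eq0; exact: mob_frac_nonconst mu c.
have prodE s : subst m (tofrac (root_poly s)) * tofrac den ^+ size s =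
    tofrac (\prod_(c <- s) num c).
  elim: s => [|c s IHs].
    by rewrite /root_poly !big_nil tofrac1 (sb_one calc mu) mul1r.
  rewrite /root_poly !big_cons -/(root_poly s) !tofracM (sbM calc _ _ mu) -IHs numE /=.
  have -> : subst m (tofrac ('X - c%:P)) = mob_frac m - rat_const c.
    by rewrite -(substX mu) -(substC c mu) -!(subst_morphE mu) -rmorphB tofracB.
  have aux (F : fieldType) (a b d : F) n : a * b * d ^+ n.+1 = a * d * (b * d ^+ n).
    by rewrite exprS; ring.
  exact: aux.
pose M := \prod_(c <- r) num c.
have M0 : M != 0.
  by rewrite /M; elim: (r) => [|c s IHs]; rewrite ?big_nil ?oner_neq0 // big_cons mulf_neq0.
have d0 : den != 0 by rewrite -tofrac_eq0.
(* This is the branch polynomial P times P o m times an even power of [den], a square because f o m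
   = l^2 f. As e is a simple root of P, it is a root of [den], when m(e) is infinite, or of some
   [num c], when m(e) = c. *)
pose p := root_poly r * (M * den ^+ size r).
have p0 : p != 0 by rewrite !mulf_neq0 ?root_poly_neq0 ?expf_neq0.
have sq : (subst m q / (l * q) * tofrac M) ^+ 2 = tofrac p.
  have H : subst m q * subst m q * subst m (tofrac (root_poly r)) =
      l ^+ 2 * (q ^+ 2 * tofrac (root_poly r)).
    by rewrite -fE -mf fE expr2 (sbM calc (q * q) _ mu) (sbM calc q q mu).
  have aux (F : fieldType) (a b c d e' g h : F) : c != 0 -> d != 0 ->
      a * a * b = c ^+ 2 * (d ^+ 2 * e') -> b * g = h ->
      (a / (c * d) * h) ^+ 2 = e' * (h * g).
    move=> c0 d0' H1 <-; apply: (mulIf (mulf_neq0 (expf_neq0 2 c0) (expf_neq0 2 d0'))).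
    have -> : (a / (c * d) * (b * g)) ^+ 2 * (c ^+ 2 * d ^+ 2) = a * a * b * (b * g * g).
      by field; rewrite c0 d0'.
    by rewrite H1; ring.
  rewrite /p !tofracM tofracXn; exact: aux l0 q0 H (prodE r).
have := square_mup_even e p0 sq.
have mP : mup e (root_poly r) = 1%N by rewrite mu_prod_XsubC count_uniq_mem // er.
have [|nr] := boolP (root (M * den ^+ size r) e); last by rewrite mupMl // mP.
move=> rt _; move: rt; rewrite rootM => /orP[|rt]; last first.
  exists None; first by rewrite mem_head.
  move: rt; rewrite /root horner_exp expf_eq0 => /andP[_ /eqP].
  by rewrite !hornerE.
rewrite /M /root horner_prod prodf_seq_eq0 => /hasP[c cr /eqP numc].
exists (Some c); first by rewrite inE /= map_f.
by move: numc; rewrite /num /den !hornerE => /eqP; rewrite subr_eq0 => /eqP.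
Qed.

Lemma finite_diag_norm (f q : K) r : nonsquare f -> q != 0 -> uniq r -> (2 < size r)%N ->
  f = q ^+ 2 * tofrac (root_poly r) -> exists s : seq Cr, forall x, diag_norm f x -> x \in s.
Proof.
move=> nsq q0 ur sr fE.
have [e1 [e2 [e3 [ue er]]]] : exists e1 e2 e3, uniq [:: e1; e2; e3] /\
    {subset [:: e1; e2; e3] <= r}.
  case: r ur sr {fE} => [|e1 [|e2 [|e3 r]]] // ur _; exists e1, e2, e3; split.
    by move: ur; rewrite -[e1 :: _]/([:: e1; e2; e3] ++ r) cat_uniq => /andP[].
  by move=> e; rewrite !inE => /or3P[] /eqP ->; rewrite eqxx ?orbT.
have f0 : f != 0 by apply/eqP => f0; have := nsq 0; rewrite f0 expr0n eqxx.
pose P (c : option k * option k * option k) x := exists l m, [/\ l != 0, m \in unitmx,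
  subst m f = l ^+ 2 * f, x = dia l m &
  [/\ image_of c.1.1 e1 m, image_of c.1.2 e2 m & image_of c.2 e3 m]].
(* Once the images of three branch points are prescribed, m is unique up to a scalar and l up to
   sign. *)
have fin1 c : exists s : seq Cr, forall x, P c x -> x \in s.
  have [[x0 [l [m [l0 mu mf _ [i1 i2 i3]]]]]|np] := pselect (exists x, P c x); last first.
    by exists [::] => x Px; case: np; exists x.
  exists [:: dia l m; dia (- l) m] => x [l' [m' [l'0 mu' mf' -> [i1' i2' i3']]]].
  have [u u0 mE] := three_images mu mu' ue i1 i2 i3 i1' i2' i3'.
  rewrite mE (dia_scale calc l'0 mu u0) !inE.
  have : l' ^+ 2 = l ^+ 2.
    apply: (mulIf f0); rewrite -mf' -mf mE; exact: subst_scale.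
  by move=> /eqP; rewrite eqf_sqr => /orP[] /eqP ->; rewrite eqxx ?orbT.
have fin (C : seq (option k * option k * option k)) : exists s : seq Cr,
    forall c x, c \in C -> P c x -> x \in s.
  elim: C => [|c C [s IH]]; first by exists [::].
  have [s' s'P] := fin1 c; exists (s' ++ s) => d x; rewrite inE mem_cat => /predU1P[->|dC] Px.
    by rewrite s'P.
  by rewrite (IH d x dC Px) orbT.
pose V := None :: map Some r.
have [s sP] := fin [seq (v, v') | v <- [seq (v, v') | v <- V, v' <- V], v' <- V].
exists s => x [l [m [l0 mu mf xE]]].
have im e : e \in [:: e1; e2; e3] -> exists2 v, v \in V & image_of v e m.
  by move=> /er; exact: branch_image q0 ur l0 mu fE mf.
have [v1 v1V i1] := im e1 (mem_head _ _).
have [v2 v2V i2] : exists2 v, v \in V & image_of v e2 m by apply: im; rewrite !inE eqxx orbT.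
have [v3 v3V i3] : exists2 v, v \in V & image_of v e3 m by apply: im; rewrite !inE eqxx !orbT.
apply: (sP (v1, v2, v3)); first by apply: allpairs_f => //; exact: allpairs_f.
by exists l, m.
Qed.

End BranchPoints.

(** * Places and the genus *)

Section Valuation.
Variables (L : fieldType) (v : L -> int).
Hypothesis vM : forall a b, a != 0 -> b != 0 -> v (a * b) = v a + v b.
Hypothesis vD : forall a b, a != 0 -> b != 0 -> a + b != 0 ->
  (Order.min (v a) (v b) <= v (a + b))%R.

(** Gives 0 infinite valuation, since the value [v 0] is arbitrary. *)
Definition val_ge (n : int) (a : L) : Prop := a = 0 \/ (n <= v a)%R.

Lemma val1 : v 1 = 0.
Proof. by have := @vM 1 1 (oner_neq0 L) (oner_neq0 L); rewrite mulr1; lia. Qed.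

Lemma valV a : a != 0 -> v a^-1 = - v a.
Proof.
by move=> a0; have := vM a0 (_ : a^-1 != 0); rewrite divff // val1 invr_eq0 => /(_ a0); lia.
Qed.

Lemma val_div a b : a != 0 -> b != 0 -> v (a / b) = v a - v b.
Proof. by move=> a0 b0; rewrite vM ?invr_eq0 // valV. Qed.

Lemma valN a : a != 0 -> v (- a) = v a.
Proof.
have n1 : (-1 : L) != 0 by rewrite oppr_eq0 oner_neq0.
have : v (-1) = 0 by have := vM n1 n1; rewrite mulrNN mulr1 val1; lia.
by move=> E a0; rewrite -mulN1r vM // E add0r.
Qed.

Lemma valX a n : a != 0 -> v (a ^+ n) = n%:Z * v a.
Proof.
move=> a0; elim: n => [|n IHn]; first by rewrite expr0 val1 mul0r.
by rewrite exprS vM ?expf_neq0 // IHn; lia.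
Qed.

Lemma val_geM m n a b : val_ge m a -> val_ge n b -> val_ge (m + n) (a * b).
Proof.
rewrite /val_ge => -[->|ma]; first by left; rewrite mul0r.
case=> [->|nb]; first by left; rewrite mulr0.
have [->|a0] := eqVneq a 0; first by left; rewrite mul0r.
have [->|b0] := eqVneq b 0; first by left; rewrite mulr0.
by right; rewrite vM //; lia.
Qed.

Lemma val_geN n a : val_ge n a -> val_ge n (- a).
Proof.
case=> [->|na]; first by left; rewrite oppr0.
have [->|a0] := eqVneq a 0; first by left; rewrite oppr0.
by right; rewrite valN.
Qed.

Lemma val_geD n a b : val_ge n a -> val_ge n b -> val_ge n (a + b).
Proof.
rewrite /val_ge; have [->|a0] := eqVneq a 0; first by rewrite add0r.
have [->|b0] := eqVneq b 0; first by rewrite addr0.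
have [->|ab0] := eqVneq (a + b) 0; first by left.
move=> [/eqP|na]; first by rewrite (negPf a0).
move=> [/eqP|nb]; first by rewrite (negPf b0).
by right; apply: le_trans (vD a0 b0 ab0); rewrite le_min na nb.
Qed.

Lemma val_ge1_prime a b : val_ge 1 (a * b) -> val_ge 1 a \/ val_ge 1 b.
Proof.
have [->|a0] := eqVneq a 0; first by left; left.
have [->|b0] := eqVneq b 0; first by right; left.
case=> [/eqP|]; first by rewrite mulf_eq0 (negPf a0) (negPf b0).
by rewrite vM // => ab; have [?|?] := leP 1 (v a); [left; right | right; right; lia].
Qed.

Lemma val_addl a b : a != 0 -> val_ge (v a + 1) b -> a + b != 0 /\ v (a + b) = v a.
Proof.
move=> a0 bge; have ab0 : a + b != 0.
  apply/eqP => ab0; have bE : b = - a by apply/eqP; rewrite -addr_eq0 addrC ab0.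
  move: bge; rewrite bE => -[/eqP|]; first by rewrite oppr_eq0 (negPf a0).
  by rewrite valN //; lia.
split=> //; apply/eqP; rewrite eq_le; apply/andP; split; last first.
  have : val_ge (v a) (a + b).
    by apply: val_geD; [right | case: bge => [->|h]; [left | right; lia]].
  by case=> // /eqP; rewrite (negPf ab0).
have [//|lt] := leP (v (a + b)) (v a).
have : val_ge (v a + 1) (a + b + - b).
  by apply: val_geD; [right; lia | exact: val_geN].
by rewrite addrK => -[/eqP|]; [rewrite (negPf a0) | lia].
Qed.

Section QuadraticExtension.
Variables (F : fieldType) (j : {rmorphism F -> L}) (s : L) (p : F) (e : int).
Hypothesis s2 : s ^+ 2 = j p.
Hypothesis dec : forall z, exists a b, z = j a + j b * s.
Hypothesis norm : forall a b, b != 0 -> a ^+ 2 - b ^+ 2 * p != 0.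
Hypothesis e_gt0 : (0 < e)%R.
Hypothesis ve : forall a, a != 0 -> exists n, v (j a) = e * n.
Hypothesis unif : exists2 t, t != 0 & v t = 1.
Hypothesis v2 : (2%:R : L) != 0 /\ v 2%:R = 0.

Lemma j_eq0 a : (j a == 0) = (a == 0).
Proof. exact: fmorph_eq0. Qed.

Lemma pos_factor1 (n : int) : 1 = e * n -> e = 1.
Proof.
move=> en; have [n0|n0] := leP n 0.
  have : (e * n <= 0)%R by rewrite pmulr_rle0.
  by lia.
have : (e <= e * n)%R by rewrite ler_peMr //; lia.
by lia.
Qed.

(** Valuations of F are multiples of e, so it suffices that 1 is one. Write a uniformiser as t = a +
    b s = (a + b sg) + b (s - sg). If b = 0 or the first term dominates, then t has the valuation of
    an element of F. Otherwise the conjugate a - b s has the valuation of b, and the norm of t gives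
    the claim. *)
Lemma unramified (sg : F) : sg != 0 -> v (j sg) = 0 -> val_ge 1 (s - j sg) -> e = 1.
Proof.
move=> sg0 vsg sge; have [v20 v2E] := v2; have [t t0 vt] := unif.
have jsg0 : j sg != 0 by rewrite j_eq0.
have sE : s = j sg + (s - j sg) by rewrite addrC subrK.
have [s0 vs] : s != 0 /\ v s = 0.
  by have := @val_addl (j sg) (s - j sg) jsg0; rewrite -sE vsg; apply.
have [a [b tE]] := dec t.
have [b0|b0] := eqVneq b 0.
  have a0 : a != 0 by apply: contraNneq t0 => a0; rewrite tE a0 b0 rmorph0 mul0r addr0.
  have [n vn] := ve a0; apply: (@pos_factor1 n).
  by rewrite -vn -vt tE b0 rmorph0 mul0r addr0.
have jb0 : j b != 0 by rewrite j_eq0.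
have [nb vb] := ve b0.
have tE' : t = j (a + b * sg) + j b * (s - j sg).
  by rewrite tE rmorphD rmorphM; ring.
have rest : val_ge (v (j b) + 1) (j b * (s - j sg)) by apply: val_geM sge; right.
have [[jab0 lt]|ge] : (j (a + b * sg) != 0 /\ (v (j (a + b * sg)) <= v (j b))%R) \/
    val_ge (v (j b) + 1) (j (a + b * sg)).
  have [ab0|ab0] := eqVneq (j (a + b * sg)) 0; first by right; left.
  have [le|lt] := leP (v (j (a + b * sg))) (v (j b)); first by left.
  by right; right; lia.
  have ab0 : a + b * sg != 0 by rewrite -j_eq0.
  have [nab vab] := ve ab0.
  have rest' : val_ge (v (j (a + b * sg)) + 1) (j b * (s - j sg)).
    by case: rest => [->|h]; [left | right; apply: le_trans h; rewrite lerD2r].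
  have [_] := val_addl jab0 rest'; rewrite -tE' vt vab; exact: pos_factor1.
have sg2 : 2%:R * j sg != 0 by rewrite mulf_neq0.
have v2sg : v (2%:R * j sg) = 0 by rewrite vM // v2E vsg.
have [ss0 vss] : s + j sg != 0 /\ v (s + j sg) = 0.
  have := @val_addl (2%:R * j sg) (s - j sg) sg2; rewrite v2sg add0r => /(_ sge).
  by rewrite (_ : 2%:R * j sg + (s - j sg) = s + j sg) //; ring.
have bs0 : - (j b * (s + j sg)) != 0 by rewrite oppr_eq0 mulf_neq0.
have vbs : v (- (j b * (s + j sg))) = v (j b) by rewrite valN ?mulf_neq0 // vM // vss addr0.
have [c0 vc] : j a - j b * s != 0 /\ v (j a - j b * s) = v (j b).
  have := @val_addl _ (j (a + b * sg)) bs0; rewrite vbs => /(_ ge).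
  by rewrite (_ : - _ + _ = j a - j b * s) // rmorphD rmorphM; ring.
have [n vN] := ve (norm a b0).
have NE : j (a ^+ 2 - b ^+ 2 * p) = t * (j a - j b * s).
  by rewrite rmorphB !rmorphM -s2 tE; ring.
move: vN; rewrite NE vM // vt vc vb => E.
by apply: (@pos_factor1 (n - nb)); rewrite mulrBr -E; ring.
Qed.

(* Here e is the valuation of a uniformiser of F, so s has half-integral      *)
(* relative valuation.                                                        *)
Lemma ramified (n : int) : s != 0 -> v s + v s = e * (n + n + 1) -> e = 2.
Proof.
move=> s0 vs; have [t t0 vt] := unif.
have [e' eE] : exists e', e = e' + e'.
  exists (v s - e * n); rewrite -[LHS]mulr1.
  have : v s + v s = e * n + e * n + e * 1 by rewrite vs; ring.
  by move: (v s) (e * n) => a b; rewrite mulr1; lia.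
have vs' : v s = e' * (n + n + 1).
  have : v s + v s = e' * (n + n + 1) + e' * (n + n + 1) by rewrite vs eE; ring.
  by move: (v s) (e' * _) => a b; lia.
have e'0 : (0 < e')%R by move: e_gt0; rewrite eE; lia.
suff [m mE] : exists m, 1 = e' * m.
  rewrite eE; have [m0|m0] := leP m 0.
    have : (e' * m <= 0)%R by rewrite pmulr_rle0.
    by lia.
  have : (e' <= e' * m)%R by rewrite ler_peMr //; lia.
  by lia.
have [a [b tE]] := dec t.
have [b0|b0] := eqVneq b 0.
  have a0 : a != 0 by apply: contraNneq t0 => a0; rewrite tE a0 b0 rmorph0 mul0r addr0.
  have [m vm] := ve a0; exists (m + m).
  by rewrite -vt tE b0 rmorph0 mul0r addr0 vm eE; ring.
have jb0 : j b != 0 by rewrite j_eq0.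
have [nb vb] := ve b0.
have bs0 : j b * s != 0 by rewrite mulf_neq0.
have vbs : v (j b * s) = e' * (nb + nb + (n + n + 1)) by rewrite vM // vb vs' eE; ring.
have [a0|a0] := eqVneq a 0.
  by exists (nb + nb + (n + n + 1)); rewrite -vbs -vt tE a0 rmorph0 add0r.
have ja0 : j a != 0 by rewrite j_eq0.
have [na va] := ve a0.
have va' : v (j a) = e' * (na + na) by rewrite va eE; ring.
(* The first is an even and the second an odd multiple of [e'], so they differ and the smaller one
   is [v t] = 1. *)
have [lt|lt|eq] := ltgtP (v (j a)) (v (j b * s)).
- exists (na + na); rewrite -va' -vt tE; have [|_ ->] := @val_addl _ (j b * s) ja0; last by [].
  by right; lia.
- exists (nb + nb + (n + n + 1)); rewrite -vbs -vt tE addrC.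
  have [|_ ->] := @val_addl _ (j a) bs0; last by [].
  by right; lia.
have e'n0 : e' != 0 by lia.
by move: eq; rewrite va' vbs => /(mulfI e'n0); lia.
Qed.

End QuadraticExtension.
End Valuation.

(** * Regularity of the differential dy / s *)

Section HyperellipticDifferential.
Variable k : closedFieldType.
Local Notation K := {fraction {poly k}}.
Local Notation tofrac := (@FracField.tofrac {poly k}).
Hypothesis two_neq0 : (2%:R : k) != 0.
Variables (L : fieldType) (j : {rmorphism K -> L}) (s : L) (r : seq k).
Hypothesis ur : uniq r.
Hypothesis s2 : s ^+ 2 = j (tofrac (root_poly r)).
Hypothesis dec : forall z, exists a b, z = j a + j b * s.
Hypothesis nsq : nonsquare (tofrac (root_poly r)).
Let jp (p : {poly k}) : L := j (tofrac p).

Lemma branch_norm (a b : K) : b != 0 -> a ^+ 2 - b ^+ 2 * tofrac (root_poly r) != 0.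
Proof.
move=> b0; apply/eqP => E; have := nsq (a / b); case/negP; apply/eqP.
have aux (F : fieldType) (u w p : F) : w != 0 -> u ^+ 2 - w ^+ 2 * p = 0 -> (u / w) ^+ 2 = p.
  by move=> w0 /eqP; rewrite subr_eq0 expr_div_n => /eqP ->; rewrite mulrC mulKf // expf_neq0.
exact: aux b0 E.
Qed.

Section Derivation.
Variable D : L -> L.
Hypothesis DD : forall a b, D (a + b) = D a + D b.
Hypothesis DM : forall a b, D (a * b) = a * D b + b * D a.
Hypothesis DC : forall c, D (j (rat_const c)) = 0.
Hypothesis Dy : D (j (rat_y k)) = 1.

Lemma D1 : D 1 = 0.
Proof. by rewrite -(rmorph1 j) -tofrac1; exact: DC. Qed.

Lemma D_poly p : D (jp p) = jp p^`().
Proof.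
rewrite /jp; elim/poly_ind: p => [|p c IHp].
  by rewrite deriv0 -polyC0 [LHS]DC polyC0 tofrac0 rmorph0.
rewrite derivD derivM derivX derivC addr0 mulr1 !tofracD !tofracM !rmorphD !rmorphM DD DM.
by rewrite [D (j (tofrac 'X))]Dy [D (j (tofrac c%:P))]DC IHp addr0 mulr1; ring.
Qed.

Lemma D_inv a : a != 0 -> D a^-1 = - D a / a ^+ 2.
Proof.
move=> a0; have := DM a a^-1; rewrite divff // D1 => E.
apply: (mulfI a0); have -> : a * D a^-1 = - (a^-1 * D a).
  by apply/eqP; rewrite -addr_eq0 -E.
by field.
Qed.

Lemma D_sqrt : 2%:R * s * D s = jp (root_poly r)^`().
Proof. by rewrite -D_poly /jp -s2 expr2 DM; ring. Qed.

Section Place.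
Variable v : L -> int.
Hypothesis vM : forall a b, a != 0 -> b != 0 -> v (a * b) = v a + v b.
Hypothesis vD : forall a b, a != 0 -> b != 0 -> a + b != 0 ->
  (Order.min (v a) (v b) <= v (a + b))%R.
Hypothesis vC : forall c, c != 0 -> v (j (rat_const c)) = 0.
Hypothesis unif : exists2 t, t != 0 & v t = 1.

Let yL := j (rat_y k).
Let lin c := yL - j (rat_const c).

Lemma linE c : lin c = jp ('X - c%:P).
Proof. by rewrite /lin /jp tofracB rmorphB. Qed.

Lemma jp_neq0 p : p != 0 -> jp p != 0.
Proof. by move=> p0; rewrite /jp fmorph_eq0 tofrac_eq0. Qed.

Lemma lin_neq0 c : lin c != 0.
Proof. by rewrite linE jp_neq0 ?polyXsubC_eq0. Qed.

Lemma val2 : (2%:R : L) != 0 /\ v 2%:R = 0.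
Proof.
have E : (2%:R : L) = j (rat_const 2%:R).
  by rewrite -(rmorph_nat (j \o const_frac k)).
by rewrite E; split; [rewrite fmorph_eq0 rat_const_neq0 | exact: vC].
Qed.

Lemma val_root_poly (w : k -> int) (rs : seq k) : (forall c, v (lin c) = w c) ->
  v (jp (root_poly rs)) = \sum_(c <- rs) w c.
Proof.
move=> vw; elim: rs => [|c rs IHrs].
  by rewrite /root_poly !big_nil /jp tofrac1 rmorph1 (val1 vM).
rewrite /root_poly !big_cons -/(root_poly rs) -vw linE -IHrs /jp tofracM rmorphM.
by rewrite vM // jp_neq0 ?polyXsubC_eq0 ?root_poly_neq0.
Qed.

Lemma val_poly (w : k -> int) p rs : (forall c, v (lin c) = w c) -> p != 0 ->
  p = lead_coef p *: root_poly rs -> v (jp p) = \sum_(c <- rs) w c.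
Proof.
move=> vw p0 ->; rewrite -mul_polyC /jp tofracM rmorphM.
have l0 : lead_coef p != 0 by rewrite lead_coef_eq0.
rewrite vM ?(vC l0) ?add0r; first exact: val_root_poly.
  by rewrite fmorph_eq0 (rat_const_neq0 l0).
by rewrite jp_neq0 // root_poly_neq0.
Qed.

Lemma val_frac (e : int) : (forall p, p != 0 -> exists n, v (jp p) = e * n) ->
  forall a : K, a != 0 -> exists n, v (j a) = e * n.
Proof.
move=> ve a a0; have [p [q [q0 aE]]] := frac_ex a.
have p0 : p != 0 by apply: contraNneq a0 => p0; rewrite aE p0 tofrac0 mul0r.
have [n vp] := ve p p0; have [m vq] := ve q q0; exists (n - m).
rewrite aE rmorphM fmorphV vM ?invr_eq0 ?(jp_neq0 p0) ?(jp_neq0 q0) //.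
by rewrite (valV vM) ?(jp_neq0 q0) // mulrBr -vp -vq.
Qed.

Lemma s_neq0 : s != 0.
Proof.
have : s ^+ 2 != 0 by rewrite s2 (jp_neq0 (root_poly_neq0 _)).
by rewrite expf_eq0.
Qed.

Lemma val_ss : v s + v s = v (jp (root_poly r)).
Proof. by rewrite -vM ?s_neq0 // -expr2 s2. Qed.

Section FinitePlace.
Variable c : k.
Hypothesis vc : (0 < v (lin c))%R.
Let e := v (lin c).

Lemma val_lin d : v (lin d) = if d == c then e else 0.
Proof.
have [->//|dc] := eqVneq d c.
have cd0 : c - d != 0 by rewrite subr_eq0 eq_sym.
have := @val_addl L v vM vD (j (rat_const (c - d))) (lin c).
rewrite fmorph_eq0 rat_const_neq0 // vC // => /(_ isT); case; first by right; lia.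
move=> _ <-; congr v; rewrite /lin /rat_const polyCB tofracB rmorphB; ring.
Qed.

Lemma val_poly_finite p : p != 0 -> v (jp p) = e * (mup c p)%:Z.
Proof.
move=> p0; have [rs pE] := closed_field_poly_normal p.
rewrite (val_poly val_lin p0 pE) [in RHS]pE -mul_polyC mupMr; last first.
  by rewrite rootC lead_coef_eq0.
rewrite mu_prod_XsubC; elim: rs {pE} => [|d rs IHrs]; first by rewrite big_nil mulr0.
by rewrite big_cons IHrs /=; case: eqP => _ /=; lia.
Qed.

Let ve := val_frac (fun p p0 => ex_intro _ _ (val_poly_finite p0)).

Lemma mup_root_poly d : mup d (root_poly r) = (d \in r).
Proof. by rewrite mu_prod_XsubC count_uniq_mem. Qed.

(** Since s^2 - P(c) has positive valuation, s is congruent to one of the square roots of P(c),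
    which are nonzero. The place is thus unramified, with uniformiser y - c, and s is a unit. *)
Lemma regular_unbranched : c \notin r -> exists t u,
  [/\ t != 0, v t = 1, u = 0 \/ (0 <= v u)%R & s^-1 = u * D t].
Proof.
move=> cr; have vs : v s = 0.
  by have := val_ss; rewrite val_poly_finite ?root_poly_neq0 // mup_root_poly (negPf cr) mulr0; lia.
have [sg sgE] := sqrt_ex (root_poly r).[c].
have sg0 : sg != 0.
  apply: contraNneq cr => sg0; move/esym/eqP: sgE; rewrite sg0 expr0n /=.
  by rewrite -/(root _ _) /root_poly root_prod_XsubC.
have prod_ge : val_ge v 1 ((s - j (rat_const sg)) * (s - j (rat_const (- sg)))).
  have -> : (s - j (rat_const sg)) * (s - j (rat_const (- sg))) =
      jp (root_poly r - (root_poly r).[c]%:P).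
    rewrite /jp tofracB rmorphB -s2 -sgE polyC_exp tofracXn rmorphXn.
    by rewrite /rat_const polyCN tofracN rmorphN; ring.
  have [->|n0] := eqVneq (root_poly r - (root_poly r).[c]%:P) 0.
    by left; rewrite /jp tofrac0 rmorph0.
  right; rewrite val_poly_finite //.
  have : (0 < mup c (root_poly r - (root_poly r).[c]%:P))%N.
    by rewrite -XsubC_dvd // dvdp_XsubCl /root !hornerE subrr.
  by have := vc; rewrite -/e; nia.
have [sg' [sg'0 sg'ge]] : exists sg', sg' != 0 /\ val_ge v 1 (s - j (rat_const sg')).
  case: (val_ge1_prime vM prod_ge) => ge; [exists sg | exists (- sg)]; split=> //.
  by rewrite oppr_eq0.
have e1 : e = 1.
  exact: (@unramified L v vM vD K j s _ e s2 dec branch_norm vc ve unif val2 _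
    (rat_const_neq0 sg'0) (vC sg'0) sg'ge).
exists (lin c), s^-1; split.
- exact: lin_neq0.
- exact: e1.
- by right; rewrite (valV vM) ?s_neq0 // vs.
by rewrite linE D_poly derivXsubC /jp tofrac1 rmorph1 mulr1.
Qed.

(** P vanishes simply at c, so s has half the valuation of y - c and is a uniformiser. As dy = 2 s
    ds / P', one takes u = 2 / P', where P'(c) is nonzero. *)
Lemma regular_branched : c \in r -> exists t u,
  [/\ t != 0, v t = 1, u = 0 \/ (0 <= v u)%R & s^-1 = u * D t].
Proof.
move=> cr; have vss : v s + v s = e.
  by rewrite val_ss val_poly_finite ?root_poly_neq0 // mup_root_poly cr mulr1.
have e2 : e = 2.
  apply: (@ramified L v vM vD K j s e dec vc ve unif val2 0 s_neq0).
  by rewrite vss add0r mulr1.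
have rc : ~~ root (root_poly r)^`() c.
  have E : root_poly r = ('X - c%:P) * root_poly (rem c r).
    by rewrite /root_poly (perm_big _ (perm_to_rem cr)) big_cons.
  rewrite E derivM derivXsubC mul1r /root !hornerE subrr mul0r addr0.
  by rewrite -/(root _ _) /root_poly root_prod_XsubC mem_rem_uniq // inE eqxx.
have d0 : (root_poly r)^`() != 0 by apply: contraNneq rc => ->; rewrite root0.
have vd : v (jp (root_poly r)^`()) = 0 by rewrite val_poly_finite // mupNroot // mulr0.
have [v20 v2E] := val2.
exists s, (2%:R / jp (root_poly r)^`()); split.
- exact: s_neq0.
- by lia.
- right; rewrite vM ?invr_eq0 ?(jp_neq0 d0) // (valV vM) ?(jp_neq0 d0) //.
  by rewrite v2E vd.
have Ds : D s != 0.
  by apply: contraTneq (jp_neq0 d0) => Ds; rewrite -D_sqrt Ds mulr0 eqxx.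
have s0 := s_neq0; rewrite -D_sqrt; field.
by rewrite s0 Ds v20.
Qed.

End FinitePlace.

(** Otherwise every y - c has valuation 0 and v is trivial on k(y). A uniformiser then lies outside
    k(y), and its norm would have valuation 0 although it is t times an integral conjugate. *)
Lemma finite_or_infinite : (exists c, (0 < v (lin c))%R) \/ (v yL < 0)%R.
Proof.
have [ltn|gey] := ltP (v yL) 0; first by right.
left; apply: contrapT => nc.
have vlin c : v (lin c) = 0.
  have : val_ge v 0 (lin c).
    apply: (val_geD vD); first by right.
    have [->|c0] := eqVneq c 0; first by left; rewrite /rat_const polyC0 tofrac0 rmorph0 oppr0.
    by right; rewrite (valN vM) ?vC // fmorph_eq0 rat_const_neq0.
  case=> [/eqP|ge0]; first by rewrite (negPf (lin_neq0 c)).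
  by have [//|gt0] := leP (v (lin c)) 0; [lia | case: nc; exists c].
have vp p : p != 0 -> v (jp p) = 0.
  move=> p0; have [rs pE] := closed_field_poly_normal p.
  by rewrite (val_poly vlin p0 pE) big1.
have vj a : a != 0 -> v (j a) = 0.
  have ve p : p != 0 -> exists n, v (jp p) = 0 * n by move=> p0; exists 0; rewrite vp.
  by move=> /(val_frac ve)[n ->]; rewrite mul0r.
have vs : v s = 0 by have := val_ss; rewrite vp ?root_poly_neq0 //; lia.
have [t t0 vt] := unif; have [a [b tE]] := dec t.
have [b0|b0] := eqVneq b 0.
  have a0 : a != 0 by apply: contraNneq t0 => a0; rewrite tE a0 b0 rmorph0 mul0r addr0.
  by move: vt; rewrite tE b0 rmorph0 mul0r addr0 vj.
have N0 := branch_norm a b0; have vN := vj _ N0.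
have NE : j (a ^+ 2 - b ^+ 2 * tofrac (root_poly r)) = t * (j a - j b * s).
  by rewrite rmorphB !rmorphM -s2 tE; ring.
have c0 : j a - j b * s != 0.
  by apply: contraNneq N0 => c0; rewrite -(fmorph_eq0 j) NE c0 mulr0.
have : val_ge v 0 (j a - j b * s).
  apply: (val_geD vD); first by have [->|a0] := eqVneq a 0; [left; rewrite rmorph0 | right; rewrite vj].
  have jb0 : j b != 0 by rewrite fmorph_eq0; exact: b0.
  by apply: (val_geN vM); right; rewrite (vM jb0 s_neq0) (vj _ b0) vs.
case=> [/eqP|]; first by rewrite (negPf c0).
by move: vN; rewrite NE vM // vt; lia.
Qed.

Section InfinitePlace.
Hypothesis vy : (v yL < 0)%R.
Let e := - v yL.

Lemma val_lin_infinity d : v (lin d) = - e.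
Proof.
rewrite opprK; have y0 : yL != 0 by have := lin_neq0 0; rewrite /lin /rat_const polyC0 tofrac0 rmorph0 subr0.
have := @val_addl L v vM vD yL (- j (rat_const d)) y0; case=> //.
have [->|d0] := eqVneq d 0; first by left; rewrite /rat_const polyC0 tofrac0 rmorph0 oppr0.
right; rewrite (valN vM) ?vC // ?fmorph_eq0 ?rat_const_neq0 //.
by lia.
Qed.

Lemma val_poly_infinity p : p != 0 -> v (jp p) = e * - (size p).-1%:Z.
Proof.
move=> p0; have [rs pE] := closed_field_poly_normal p.
rewrite (val_poly val_lin_infinity p0 pE) [in RHS]pE size_scale ?lead_coef_eq0 //.
rewrite size_prod_XsubC /= big_const_seq count_predT iter_addr_0.
by rewrite mulrN -mulNr -mulr_natr natz.
Qed.

Let P := root_poly r.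
Let n := size r.

Lemma size_P : size P = n.+1.
Proof. by rewrite size_prod_XsubC. Qed.

Let P0 : P != 0 := root_poly_neq0 r.

Let ve := val_frac (fun p p0 => ex_intro _ _ (val_poly_infinity p0)).

Let e_gt0 : (0 < e)%R.
Proof. by rewrite /e; lia. Qed.

Let y0 : yL != 0.
Proof. by rewrite fmorph_eq0 tofrac_eq0 polyX_eq0. Qed.

Lemma val_ss_infinity : v s + v s = e * - n%:Z.
Proof. by rewrite val_ss (val_poly_infinity P0) size_P. Qed.

Lemma D_exp m : D (yL ^+ m.+1) = m.+1%:R * yL ^+ m.
Proof.
elim: m => [|m IHm]; first by rewrite expr1 expr0 mulr1.
by rewrite exprS DM IHm Dy mulr1 -[m.+2%:R]/(m.+1.+1%:R) [m.+2%:R]mulrS exprS; ring.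
Qed.

(** The place is ramified: y has valuation -2 and s has valuation -n, so y^(m+1) / s is a
    uniformiser. Its derivative is y^m Q / (2 s P), whence u = 2 P / (y^m Q). *)
Lemma regular_infinity_odd m : n = (m.+1.*2).+1 -> exists t u,
  [/\ t != 0, v t = 1, u = 0 \/ (0 <= v u)%R & s^-1 = u * D t].
Proof.
move=> nE; have e2 : e = 2.
  apply: (@ramified L v vM vD K j s e dec e_gt0 ve unif val2 (- m.+2%:Z) s_neq0).
  by rewrite val_ss_infinity nE; congr (_ * _); lia.
have vs : v s = - (m.+1.*2).+1%:Z by have := val_ss_infinity; rewrite e2 nE; lia.
have vy2 : v yL = - 2 by move: e2; rewrite /e; lia.
pose Q := (m.+1.*2)%:R *: P - 'X * P^`().
(* The coefficient is 2 (m + 1) - n = -1, so Q has the same degree, hence the same valuation, as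
   P. *)
have Qn : Q`_n != 0.
  rewrite coefB coefZ coefXM nE /= coef_deriv -nE.
  have -> : P`_n = 1.
    by rewrite -[n]/(n.+1.-1) -size_P; have /monicP := monic_prod_XsubC r xpredT id.
  by rewrite mulr1 nE -[_ *+ _]/(_%:R) mulrS opprD addrCA subrr addr0 oppr_eq0 oner_neq0.
have Q0 : Q != 0 by apply: contraNneq Qn => ->; rewrite coef0.
have sQ : size Q = n.+1.
  apply/eqP; rewrite eqn_leq; apply/andP; split; last by rewrite ltnNge; apply: contra Qn => /leq_sizeP ->.
  rewrite (leq_trans (size_polyD _ _)) // geq_max (leq_trans (size_scale_leq _ _)) ?size_P //.
  rewrite size_polyN (leq_trans (size_polyMleq _ _)) // size_polyX addSn add1n.
  by have := lt_size_deriv P0; rewrite size_P.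
have t0 : yL ^+ m.+1 / s != 0 by rewrite mulf_neq0 ?expf_neq0 ?invr_eq0 ?s_neq0.
have [v20 v2E] := val2.
exists (yL ^+ m.+1 / s), (2%:R * jp P / (yL ^+ m * jp Q)).
have jQ0 := jp_neq0 Q0; have jP0 := jp_neq0 P0; have s0 := s_neq0.
have ym0 : yL ^+ m != 0 by rewrite expf_neq0.
split.
- exact: t0.
- have y'0 : yL ^+ m.+1 != 0 by rewrite expf_neq0.
  rewrite (val_div vM y'0 s0) (valX vM m.+1 y0) vs vy2; clear; lia.
- right; rewrite (val_div vM (mulf_neq0 v20 jP0) (mulf_neq0 ym0 jQ0)).
  rewrite (vM v20 jP0) (vM ym0 jQ0) v2E (valX vM m y0) (val_poly_infinity P0).
  by rewrite (val_poly_infinity Q0) sQ size_P vy2; clear; lia.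
have Ds : D s = jp P^`() / (2%:R * s) by rewrite -D_sqrt; field; rewrite s0 v20.
have sP : s * s = jp P by rewrite -expr2.
have jQ : jp Q = (m.+1.*2)%:R * jp P - yL * jp P^`().
  by rewrite /jp tofracB rmorphB -mul_polyC !tofracM !rmorphM polyC_natr !rmorph_nat.
have Dt : D (yL ^+ m.+1 / s) = yL ^+ m * jp Q / (2%:R * s * jp P).
  rewrite DM D_inv // D_exp Ds jQ exprS -sP -muln2 natrM; field.
  by rewrite s0 v20.
rewrite Dt; field.
by rewrite s0 jQ0 jP0 v20.
Qed.

(** z = s / y^(m+2) satisfies z^2 = P / y^n, which is 1 at infinity, so z is congruent to 1 or -1
    and the place is unramified, with uniformiser 1 / y. Then u = - y^2 / s has valuation m,
    nonnegative because n is at least 4. *)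
Lemma regular_infinity_even m : n = m.+2.*2 -> exists t u,
  [/\ t != 0, v t = 1, u = 0 \/ (0 <= v u)%R & s^-1 = u * D t].
Proof.
move=> nE; have vs : v s = - e * m.+2%:Z by have := val_ss_infinity; rewrite nE; lia.
pose z := s / yL ^+ m.+2.
have yX0 : yL ^+ m.+2 != 0 by rewrite expf_neq0.
have y'X0 : rat_y k ^+ m.+2 != 0.
  by apply: contraNneq yX0 => E; rewrite -rmorphXn E rmorph0.
have z2 : z ^+ 2 = j (tofrac P / (rat_y k ^+ m.+2) ^+ 2).
  by rewrite rmorphM fmorphV !rmorphXn -s2 expr_div_n.
have zdec x : exists a b, x = j a + j b * z.
  have [a [b ->]] := dec x; exists a, (b * rat_y k ^+ m.+2).
  have sE : s = yL ^+ m.+2 * z by rewrite /z mulrCA divff // mulr1.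
  by rewrite rmorphM rmorphXn -mulrA -sE.
have znorm (a b : K) : b != 0 -> a ^+ 2 - b ^+ 2 * (tofrac P / (rat_y k ^+ m.+2) ^+ 2) != 0.
  move=> b0; have b'0 : b / rat_y k ^+ m.+2 != 0 by apply: mulf_neq0 b0 _; rewrite invr_eq0; exact: y'X0.
  have := branch_norm a b'0; congr (_ != 0).
  have aux (F : fieldType) (x u w q : F) : x ^+ 2 - (u / w) ^+ 2 * q = x ^+ 2 - u ^+ 2 * (q / w ^+ 2).
    by rewrite expr_div_n; ring.
  exact: aux.
have prod_ge : val_ge v 1 ((z - j (rat_const 1)) * (z - j (rat_const (- 1)))).
  have -> : (z - j (rat_const 1)) * (z - j (rat_const (- 1))) = jp (P - 'X^n) / yL ^+ n.
    have -> : jp (P - 'X^n) / yL ^+ n = z ^+ 2 - 1.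
      rewrite /jp tofracB rmorphB tofracXn rmorphXn -s2 /z mulrBl divff ?expf_neq0 //.
      by rewrite expr_div_n -exprM nE -muln2.
    rewrite /rat_const polyCN polyC1 tofracN tofrac1 rmorphN rmorph1; ring.
  have [->|n0] := eqVneq (P - 'X^n) 0; first by left; rewrite /jp tofrac0 rmorph0 mul0r.
  right; have yn0 : yL ^+ n != 0 by rewrite expf_neq0.
  rewrite (val_div vM (jp_neq0 n0) yn0) (valX vM n y0) (val_poly_infinity n0).
  have : (size (P - 'X^n)%R <= n)%N.
    apply/leq_sizeP => i ni; rewrite coefB coefXn.
    have [->|iNn] := eqVneq i n.
      rewrite -[n in P`_n]/(n.+1.-1) -size_P; have /monicP := monic_prod_XsubC r xpredT id.
      by rewrite /lead_coef => ->; rewrite subrr.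
    by rewrite nth_default ?subr0 // size_P; lia.
  rewrite /e; move: (size _) vy => sz; nia.
have [sg [sg0 sgge]] : exists sg, sg != 0 /\ val_ge v 1 (z - j (rat_const sg)).
  case: (val_ge1_prime vM prod_ge) => ge; [exists 1 | exists (- 1)]; split=> //.
    exact: oner_neq0.
  by rewrite oppr_eq0 oner_neq0.
have e1 : e = 1.
  exact: (@unramified L v vM vD K j z _ e z2 zdec znorm e_gt0 ve unif val2 _
    (rat_const_neq0 sg0) (vC sg0) sgge).
have s0 := s_neq0; exists yL^-1, (- yL ^+ 2 / s); split.
- by rewrite invr_eq0.
- by rewrite (valV vM).
- right; have y2 : yL ^+ 2 != 0 by rewrite expf_neq0.
  have y2' : - yL ^+ 2 != 0 by rewrite oppr_eq0.
  rewrite (val_div vM y2' s0) (valN vM y2) (valX vM 2 y0) vs e1; move: e1; rewrite /e; clear; lia.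
by rewrite D_inv // Dy; field; rewrite y0 s0.
Qed.

End InfinitePlace.

Lemma regular_place : (2 < size r)%N -> exists t u,
  [/\ t != 0, v t = 1, u = 0 \/ (0 <= v u)%R & s^-1 = u * D t].
Proof.
move=> sr; have [[c vc]|vy] := finite_or_infinite.
  by have [cr|cr] := boolP (c \in r); [exact: regular_branched vc cr | exact: regular_unbranched vc cr].
have := odd_double_half (size r); case: (odd _) => nE.
  case: _./2 nE => [|m] nE; first by move: sr; rewrite -nE.
  by apply: (regular_infinity_odd vy (m := m)); rewrite -nE.
case: _./2 nE => [|[|m]] nE; try by move: sr; rewrite -nE.
by apply: (regular_infinity_even vy (m := m)); rewrite -nE.
Qed.


End Place.
End Derivation.
End HyperellipticDifferential.

(** * The function field of the curve, and positive genus *)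

Section SqrtCurve.
Variable k : closedFieldType.
Local Notation K := {fraction {poly k}}.
Local Notation tofrac := (@FracField.tofrac {poly k}).
Hypothesis two_neq0 : (2%:R : k) != 0.

Lemma quadratic_decomposition (F : fieldType) (L : fieldExtType F) (s : L) (f : F) :
  s ^+ 2 = f%:A -> <<1; s>>%VS = fullv -> forall z, exists a b : F, z = a%:A + b%:A * s.
Proof.
move=> s2 full z; have /Fadjoin_polyP[p /polyOver1P[u ->] ->] : z \in <<1; s>>%VS by rewrite full memvf.
elim/poly_ind: u => [|u c [a [b IHu]]].
  by exists 0, 0; rewrite rmorph0 horner0 !scale0r mul0r addr0.
exists (b * f + c), a; rewrite rmorphD rmorphM /= map_polyX map_polyC hornerMXaddC IHu.
have -> : (b * f + c)%:A = b%:A * s ^+ 2 + c%:A.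
  by rewrite scalerDl -scalerA -s2 -scalerAl mul1r.
by rewrite -[X in _ + X = _]/(c%:A); move: (c%:A) (a%:A) (b%:A) => x u' w; ring.
Qed.

(** Dividing s by q removes the square factor of f and does not change the field. *)
Lemma rescaled_root (F : fieldType) (L : fieldExtType F) (s : L) (f q p : F) :
  s ^+ 2 = f%:A -> <<1; s>>%VS = fullv -> q != 0 -> p != 0 -> f = q ^+ 2 * p ->
  exists z : L, [/\ z != 0, z ^+ 2 = in_alg L p &
    forall x, exists a b, x = in_alg L a + in_alg L b * z].
Proof.
move=> s2 full q0 p0 fE.
have qA0 : (q%:A : L) != 0 by rewrite -in_algE fmorph_eq0.
have zE : s = q%:A * (s / q%:A) by rewrite mulrC divfK.
have z2 : (s / q%:A) ^+ 2 = in_alg L p.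
  apply: (mulfI (expf_neq0 2 qA0)); rewrite -exprMn -zE s2 fE.
  by rewrite -!in_algE rmorphM rmorphXn.
exists (s / q%:A); split=> //; first by rewrite -sqrf_eq0 z2 fmorph_eq0.
move=> x; have [a [b ->]] := quadratic_decomposition s2 full x; exists a, (b * q).
by rewrite [in LHS]zE mulrA [in RHS]rmorphM.
Qed.

(** An empty basis would make every regular differential zero, whereas dy / z is regular and
    nonzero, z^2 being the branch polynomial. *)
Lemma genus_positive (f q : K) r g : nonsquare f -> q != 0 -> uniq r -> (2 < size r)%N ->
  f = q ^+ 2 * tofrac (root_poly r) -> sqrt_curve_genus f g -> g != 0%N.
Proof.
move=> nsq q0 ur sr fE [L [s [s2 full [D [DD DM DC Dy] [e [_ basis]]]]]].
have p0 : tofrac (root_poly r) != 0 by rewrite tofrac_eq0 root_poly_neq0.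
have [z [z0 z2 dec]] := rescaled_root s2 full q0 p0 fE.
have nsq' : nonsquare (tofrac (root_poly r)).
  move=> h; apply/eqP => E; have := nsq (q * h).
  have aux (F : fieldType) (a b c : F) : b ^+ 2 = c -> (a * b) ^+ 2 = a ^+ 2 * c.
    by rewrite exprMn => ->.
  by rewrite fE (aux _ _ _ _ E) eqxx.
have reg : regular_differential D z^-1.
  move=> v [vM vD vC unif].
  exact: (regular_place two_neq0 ur z2 dec nsq' DD DM DC Dy vM vD vC unif sr).
apply/eqP => g0; subst g; have [c [zV _]] := basis _ reg.
by move: z0; rewrite -invr_eq0 zV big_ord0 eqxx.
Qed.

End SqrtCurve.

(** * Absence of regular differentials on a rational curve *)

Section RationalCurve.
Variable k : closedFieldType.
Variables (L : fieldType) (iota : {rmorphism k -> L}) (z : L).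
Hypothesis tr : transcendental iota z.
Local Notation ev := (poly_eval iota z).
Hypothesis surj : forall x, exists p q, q != 0 /\ x = ev p / ev q.

Lemma poly_eval_eq0 p : (ev p == 0) = (p == 0).
Proof.
have [->|p0] := eqVneq p 0; last by have := tr p0; apply: negPf.
by rewrite -polyC0 poly_evalC rmorph0 eqxx.
Qed.

Section GaussValuation.
Variable m : {poly k} -> int.
Hypothesis mM : forall p q, p != 0 -> q != 0 -> m (p * q) = m p + m q.
Hypothesis mD : forall p q, p != 0 -> q != 0 -> p + q != 0 ->
  (Order.min (m p) (m q) <= m (p + q))%R.

(** Extends a valuation m of k[z] to k(z) through a chosen fraction; multiplicativity of m makes the
    choice immaterial ([val_ofE]). *)
Definition val_of (x : L) : int :=
  let pq := xget (0, 0) [set pq : {poly k} * {poly k} | pq.2 != 0 /\ x = ev pq.1 / ev pq.2] in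
  m pq.1 - m pq.2.

Lemma val_ofE p q : p != 0 -> q != 0 -> val_of (ev p / ev q) = m p - m q.
Proof.
move=> p0 q0; rewrite /val_of; case: xgetP => [[p' q'] _ /= [q'0 E]|/(_ (p, q))]; last first.
  by case; split.
have E' : p * q' = p' * q.
  move/eqP: E; rewrite eqr_div ?tr // -!poly_evalM -subr_eq0 -poly_evalN -poly_evalD.
  by rewrite poly_eval_eq0 subr_eq0 => /eqP.
have p'0 : p' != 0.
  by apply: contra_eq_neq E' => ->; rewrite mul0r mulf_neq0.
have := congr1 m E'; rewrite !mM //; lia.
Qed.

Lemma nonzero_fraction x : x != 0 -> exists p q, [/\ p != 0, q != 0 & x = ev p / ev q].
Proof.
move=> x0; have [p [q [q0 xE]]] := surj x; exists p, q; split=> //.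
by apply: contraNneq x0 => p0; rewrite xE p0 -polyC0 poly_evalC rmorph0 mul0r.
Qed.

Lemma val_ofM a b : a != 0 -> b != 0 -> val_of (a * b) = val_of a + val_of b.
Proof.
move=> /nonzero_fraction[p [q [p0 q0 ->]]] /nonzero_fraction[p' [q' [p'0 q'0 ->]]].
by rewrite mulf_div -!poly_evalM !val_ofE ?mulf_neq0 // !mM //; lia.
Qed.

Lemma val_ofD a b : a != 0 -> b != 0 -> a + b != 0 ->
  (Order.min (val_of a) (val_of b) <= val_of (a + b))%R.
Proof.
move=> /nonzero_fraction[p [q [p0 q0 ->]]] /nonzero_fraction[p' [q' [p'0 q'0 ->]]].
rewrite addf_div ?tr // -!poly_evalM -poly_evalD => n0.
have n0' : p * q' + p' * q != 0.
  by apply: contraNneq n0 => ->; rewrite -polyC0 poly_evalC rmorph0 mul0r.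
rewrite !val_ofE ?mulf_neq0 //.
have := mD (mulf_neq0 p0 q'0) (mulf_neq0 p'0 q0) n0'; rewrite !mM //.
by move: (m (_ + _)) => e; lia.
Qed.

End GaussValuation.

Lemma val_ofC (m : {poly k} -> int) : (forall p q, p != 0 -> q != 0 -> m (p * q) = m p + m q) ->
  (forall c, c != 0 -> m c%:P = 0) -> forall c, c != 0 -> val_of m (iota c) = 0.
Proof.
move=> mM mC c c0; have -> : iota c = ev c%:P / ev 1.
  by rewrite -[1]/(1%:P) !poly_evalC rmorph1 divr1.
by rewrite val_ofE ?polyC_eq0 ?oner_neq0 // -[1]/(1%:P) !mC ?oner_neq0.
Qed.

Section Differential.
Variable D : L -> L.
Hypothesis DD : forall a b, D (a + b) = D a + D b.
Hypothesis DM : forall a b, D (a * b) = a * D b + b * D a.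
Hypothesis DC : forall c, D (iota c) = 0.

Lemma derivation_poly_eval p : D (ev p) = ev p^`() * D z.
Proof.
elim/poly_ind: p => [|p c IHp].
  by rewrite deriv0 -polyC0 poly_evalC DC rmorph0 mul0r.
rewrite derivD derivM derivX derivC addr0 mulr1 !poly_evalD !poly_evalM DD DM.
by rewrite poly_evalX poly_evalC DC IHp; ring.
Qed.

Lemma derivation_fraction p q : q != 0 ->
  D (ev p / ev q) = ev (p^`() * q - p * q^`()) / ev (q ^+ 2) * D z.
Proof.
move=> q0; have q0' : ev q != 0 by rewrite tr.
have E : ev q * D (ev p / ev q) + ev p / ev q * D (ev q) = D (ev p).
  by rewrite -DM mulrC divfK.
apply: (mulfI q0'); have -> : ev q * D (ev p / ev q) = D (ev p) - ev p / ev q * D (ev q).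
  by rewrite -E addrK.
rewrite !derivation_poly_eval expr2 poly_evalD poly_evalN !poly_evalM; field.
by [].
Qed.

Hypothesis Dz : D z != 0.

Definition regular_at_places (h : L) : Prop := forall v : L -> int,
  (forall a b, a != 0 -> b != 0 -> v (a * b) = v a + v b) ->
  (forall a b, a != 0 -> b != 0 -> a + b != 0 -> (Order.min (v a) (v b) <= v (a + b))%R) ->
  (forall c, c != 0 -> v (iota c) = 0) -> (exists2 t, t != 0 & v t = 1) ->
  exists t u : L, [/\ t != 0, v t = 1, u = 0 \/ (0 <= v u)%R & h = u * D t].

Lemma dvdp_deriv_exp (c : k) n (p : {poly k}) :
  ('X - c%:P) ^+ n.+1 %| p -> ('X - c%:P) ^+ n %| p^`().
Proof.
move=> /dvdpP[w ->]; rewrite derivM deriv_exp derivXsubC mul1r /=.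
by rewrite -[_ *+ n.+1]mulr_natl mulrA exprS mulrA dvdp_add // dvdp_mull.
Qed.

(** n bounds from below the order of dt / dz for uniformisers t = p / q, the derivative being (p' q
    - p q') / q^2. When (P / Q) dz = u dt with u integral, P / Q has order at least n. *)
Lemma regular_bound (m : {poly k} -> int) (n : int) P Q :
  (forall p q, p != 0 -> q != 0 -> m (p * q) = m p + m q) ->
  (forall p q, p != 0 -> q != 0 -> p + q != 0 -> (Order.min (m p) (m q) <= m (p + q))%R) ->
  (forall c, c != 0 -> m c%:P = 0) ->
  (exists p q, [/\ p != 0, q != 0 & m p = m q + 1]) ->
  (forall p q, p != 0 -> q != 0 -> m p = m q + 1 ->
     p^`() * q - p * q^`() != 0 -> (m (q ^+ 2) + n <= m (p^`() * q - p * q^`()))%R) ->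
  P != 0 -> Q != 0 -> regular_at_places (ev P / ev Q * D z) -> (m Q + n <= m P)%R.
Proof.
move=> mM mD mC [p1 [q1 [p10 q10 E1]]] mn P0 Q0 reg.
have [|t [u [t0 vt vu E]]] := reg (val_of m) (val_ofM mM) (val_ofD mM mD) (val_ofC mM mC).
  exists (ev p1 / ev q1); first by rewrite mulf_neq0 ?invr_eq0 ?tr.
  by rewrite val_ofE //; lia.
have PQ0 : ev P / ev Q * D z != 0 by rewrite !mulf_neq0 ?invr_eq0 ?tr.
have [u0|u0] := eqVneq u 0; first by move: PQ0; rewrite E u0 mul0r eqxx.
have {}vu : (0 <= val_of m u)%R by case: vu => // /eqP; rewrite (negPf u0).
have [p [q [p0 q0 tE]]] := nonzero_fraction t0.
rewrite tE val_ofE // in vt; rewrite tE derivation_fraction // mulrA in E.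
have {}E := mulIf Dz E.
have d0 : p^`() * q - p * q^`() != 0.
  apply: contraNneq PQ0 => d0; rewrite E d0 -polyC0 poly_evalC rmorph0 mul0r mulr0.
  by rewrite mul0r.
have := mn p q p0 q0 _ d0; rewrite -(subrK (m q) (m p)) vt addrC => /(_ erefl).
have := congr1 (val_of m) E; have q20 : q ^+ 2 != 0 by rewrite expf_neq0.
rewrite val_ofE // val_ofM // ?mulf_neq0 ?invr_eq0 ?tr // val_ofE //.
by move: vu (m (_ - _)) (m (q ^+ 2)); clear; lia.
Qed.

Lemma size_le_mup (P Q : {poly k}) : P != 0 -> Q != 0 ->
  (forall c, (mup c Q <= mup c P)%N) -> (size Q <= size P)%N.
Proof.
move=> P0 Q0 le; have [rs PE] := closed_field_poly_normal P.
have [rs' QE] := closed_field_poly_normal Q.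
have mupE (p : {poly k}) s c : p != 0 -> p = lead_coef p *: root_poly s ->
    mup c p = count_mem c s.
  move=> p0 ->; rewrite -mul_polyC mupMr ?rootC ?lead_coef_eq0 //.
  exact: mu_prod_XsubC.
have /count_subseqP[s sub /perm_size sE] : forall c, (count_mem c rs' <= count_mem c rs)%N.
  by move=> c; rewrite -(mupE _ _ _ P0 PE) -(mupE _ _ _ Q0 QE).
rewrite PE QE !size_scale ?lead_coef_eq0 // !size_prod_XsubC ltnS sE.
exact: size_subseq.
Qed.

(** Suppose h = (P / Q) dz is nonzero. Regularity at each finite c, with n = 0, bounds the
    multiplicities of Q by those of P, so deg Q <= deg P. At infinity the valuation is minus the
    degree, that is 1 - [size], and n = 2, so deg P + 2 <= deg Q. *)
Lemma regular_eq0 h : regular_at_places h -> h = 0.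
Proof.
move=> reg; apply/eqP; apply: contrapT => /negP h0.
have [P [Q [P0 Q0 E]]] : exists P Q, [/\ P != 0, Q != 0 & h / D z = ev P / ev Q].
  by apply: nonzero_fraction; rewrite mulf_neq0 ?invr_eq0.
have hE : h = ev P / ev Q * D z by rewrite -E divfK.
rewrite hE in reg.
have le : (size Q <= size P)%N.
  apply: size_le_mup => // c.
  have := @regular_bound (fun p => (mup c p)%:Z) 0 P Q.
  rewrite addr0; apply=> //.
  - by move=> p q p0 q0; rewrite mupM // mulf_neq0.
  - move=> p q p0 q0 pq0; have : (minn (mup c p) (mup c q) <= mup c (p + q))%N.
      by rewrite mup_geq // dvdp_add // -mup_geq // ?geq_minl ?geq_minr.
    lia.
  - by move=> d d0; rewrite mupNroot // rootC.
  - by exists ('X - c%:P), 1; rewrite polyXsubC_eq0 oner_neq0 -[X in mup c X]expr1 mup_XsubCX eqxx mupNroot ?root1.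
  move=> p q p0 q0 pq d0; rewrite addr0 mupM // lez_nat mup_geq // exprD.
  have dq : ('X - c%:P) ^+ mup c q %| q by rewrite -mup_geq.
  have dp : ('X - c%:P) ^+ (mup c q).+1 %| p by rewrite -mup_geq //; lia.
  apply: dvdp_sub; first by rewrite dvdp_mul // dvdp_deriv_exp.
  (* If q is a unit at c, nothing is required; otherwise the power of X - c lost in q' is recovered
     from p, which has one more than q. *)
  case: (mup c q) dq dp => [|b] dq dp; first by rewrite expr0 mul1r dvd1p.
  by rewrite -exprD -addSnnS exprD dvdp_mul // dvdp_deriv_exp.
suff : (1 - (size Q)%:Z + 2 <= 1 - (size P)%:Z)%R by move: le; clear; lia.
apply: (@regular_bound (fun p => 1 - (size p)%:Z)) => //.
- move=> p q p0 q0; have := size_mul p0 q0; move: p0 q0; rewrite -!size_poly_gt0.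
  by move: (size p) (size q) (size (p * q)) => a b d; clear; lia.
- move=> p q p0 q0 pq0; have := size_polyD p q.
  by move: (size p) (size q) (size (p + q)) => a b d; clear; lia.
- by move=> c c0; rewrite size_polyC c0.
- by exists 1, 'X; rewrite oner_neq0 polyX_eq0 size_polyX size_poly1.
move=> p q p0 q0 pq d0; have := size_mul q0 q0; rewrite expr2.
have := lt_size_deriv p0; have := lt_size_deriv q0.
have := size_polyMleq p^`() q; have := size_polyMleq p q^`().
have := size_polyD (p^`() * q) (- (p * q^`())); rewrite size_polyN; move: pq.
set a := p^`() * q; set b := p * q^`(); set c := a - b; set d := q * q.
move: (size a) (size b) (size c) (size d) (size p) (size q) (size p^`()) (size q^`()).
by clear; lia.
Qed.

End Differential.
End RationalCurve.

(** * Genus zero for a rational function field *)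

Section GenusZero.
Variable k : closedFieldType.
Local Notation K := {fraction {poly k}}.
Local Notation tofrac := (@FracField.tofrac {poly k}).
Hypothesis two_neq0 : (2%:R : k) != 0.
Let calc := jel_calculus two_neq0.
Local Notation y := (rat_y k).
Implicit Types m n : 'M[k]_2.

Lemma mob_frac1 : mob_frac 1%:M = y.
Proof. by rewrite -(substX (unitmx1 k 2)) subst1. Qed.

(** Recovers y from w = n^-1(y), which becomes the square z^2 in the function field. *)
Lemma generator_of_inverse n : n \in unitmx ->
  y = (rat_const (n 0 0) * mob_frac (invmx n) + rat_const (n 0 1)) /
      (rat_const (n 1 0) * mob_frac (invmx n) + rat_const (n 1 1)).
Proof.
move=> nu; have mu : invmx n \in unitmx by rewrite unitmx_inv.
rewrite -mob_frac1 -(mulmxV nu) -(subst_mob mu nu) -(subst_morphE mu) /(mob_frac n).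
by rewrite !(rmorphM, fmorphV, rmorphD) !subst_morphE (substX mu) !substC.
Qed.

Section Surjectivity.
Variables (L : fieldType) (j : {rmorphism K -> L}) (z : L) (w : K).
Hypothesis z2 : z ^+ 2 = j w.
Hypothesis dec : forall x, exists a b, x = j a + j b * z.
Let iota : {rmorphism k -> L} := j \o const_frac k.
Hypothesis tr : transcendental iota z.
Local Notation ev := (poly_eval iota z).
Let im (x : L) := exists p q, q != 0 /\ x = ev p / ev q.

Lemma imC c : im (iota c).
Proof.
exists c%:P, 1; rewrite oner_neq0 -[1]/(1%:P) !poly_evalC rmorph1 divr1.
by split.
Qed.

Lemma imX : im z.
Proof.
exists 'X, 1; rewrite oner_neq0 -[1]/(1%:P) poly_evalX poly_evalC rmorph1 divr1.
by split.
Qed.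

Lemma imD a b : im a -> im b -> im (a + b).
Proof.
move=> [p [q [q0 ->]]] [p' [q' [q'0 ->]]]; exists (p * q' + p' * q), (q * q').
by rewrite mulf_neq0 // addf_div ?tr // poly_evalD !poly_evalM.
Qed.

Lemma imM a b : im a -> im b -> im (a * b).
Proof.
move=> [p [q [q0 ->]]] [p' [q' [q'0 ->]]]; exists (p * p'), (q * q').
by rewrite mulf_neq0 // mulf_div !poly_evalM.
Qed.

Lemma imV a : im a -> im a^-1.
Proof.
move=> [p [q [q0 ->]]]; have [->|p0] := eqVneq p 0.
  rewrite -polyC0 poly_evalC rmorph0 mul0r invr0.
  by have := imC 0; rewrite rmorph0.
by exists q, p; rewrite invf_div.
Qed.

(** The fractions in z form a subfield. It contains k and z, hence w = z^2, hence y = n(w), hence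
    k(y) and all of k(y) + k(y) z. *)
Lemma image_full n : n \in unitmx -> w = mob_frac (invmx n) -> forall x, im x.
Proof.
move=> nu wE.
have imw : im (j w) by rewrite -z2 expr2; exact: imM imX imX.
have imc c : im (j (rat_const c)) by exact: imC.
have imy : im (j y).
  rewrite (generator_of_inverse nu) -wE rmorphM fmorphV !rmorphD !rmorphM.
  by apply: imM; [| apply: imV]; (apply: imD; [apply: imM|]).
have imp p : im (j (tofrac p)).
  elim/poly_ind: p => [|p c IHp]; first by rewrite -polyC0; exact: imc.
  by rewrite tofracD tofracM rmorphD rmorphM; exact: imD (imM IHp imy) (imc c).
have imj a : im (j a).
  by have [p [q [_ ->]]] := frac_ex a; rewrite rmorphM fmorphV; exact: imM (imp p) (imV (imp q)).
by move=> x; have [a [b ->]] := dec x; exact: imD (imj a) (imM (imj b) imX).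
Qed.

End Surjectivity.

(** f is a square times w = n^-1(y), so L is generated by z with z^2 = w and equals k(z). As D y =
    1, D z is nonzero and every differential is a multiple of dz, so [regular_eq0] applies. *)
Lemma regular_differential_eq0 (L : fieldExtType K) (s : L) (D : L -> L) (f l : K) n :
  s ^+ 2 = f%:A -> <<1; s>>%VS = fullv -> derivation_dy D ->
  l != 0 -> n \in unitmx -> subst n f = l ^+ 2 * y ->
  forall h, regular_differential D h -> h = 0.
Proof.
move=> s2 full [DD DM DC Dy] l0 nu nf h reg.
have mu : invmx n \in unitmx by rewrite unitmx_inv.
pose w := mob_frac (invmx n); pose lm := subst (invmx n) l.
have lm0 : lm != 0 by rewrite /lm (sb_eq0 calc l mu).
have w0 : w != 0 by have := mob_frac_nonconst mu 0; rewrite /= polyC0 tofrac0.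
have fE : f = lm ^+ 2 * w.
  rewrite -[LHS]subst1 -(mulmxV nu) -(subst_comp f mu nu) nf -(subst_morphE mu).
  by rewrite rmorphM rmorphXn !subst_morphE (substX mu).
have [z [z0 z2 dec]] := rescaled_root s2 full lm0 w0 fE.
pose iota : {rmorphism k -> L} := in_alg L \o const_frac k.
have znc c : z != iota c.
  apply/eqP => zc; have := mob_frac_nonconst mu (c ^+ 2); case/eqP.
  apply: (fmorph_inj (in_alg L)); apply: (etrans (esym z2)).
  by rewrite zc -(rmorphXn iota).
have tr : transcendental iota z by exact: transcendental_nonconst.
have surj := image_full z2 dec tr nu erefl.
have Dz : D z != 0.
  apply/eqP => Dz; have [p [q [q0 yE]]] := surj (y%:A).
  have := oner_neq0 L; rewrite -Dy yE; case/eqP.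
  by rewrite (derivation_fraction tr DD DM DC p q0) Dz mulr0.
apply: (regular_eq0 tr surj DD DM DC Dz) => v vM vD vC unif.
by apply: reg; split.
Qed.

(** All basis elements are zero by [regular_differential_eq0], so a positive g would contradict the
    uniqueness of coordinates. *)
Lemma genus_zero (f l : K) n g : l != 0 -> n \in unitmx -> subst n f = l ^+ 2 * y ->
  sqrt_curve_genus f g -> g = 0%N.
Proof.
move=> l0 nu nf [L [s [s2 full [D der [e [We basis]]]]]].
have D0 := regular_differential_eq0 s2 full der l0 nu nf.
case: g e We basis => // g e We basis.
have reg0 : regular_differential D 0.
  by move=> v [_ _ _ [t t0 vt]]; exists t, 0; split=> //; [left | rewrite mul0r].
have [c [_ cu]] := basis 0 reg0.
have E (c' : {ffun 'I_g.+1 -> k}) : 0 = \sum_i ext_const L (c' i) * e i.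
  by rewrite big1 // => i _; rewrite (D0 (e i) (We i)) mulr0.
have := etrans (esym (cu [ffun=> 1] (E _))) (cu [ffun=> 0] (E _)).
by move=> /ffunP/(_ ord0); rewrite !ffunE => /eqP; rewrite oner_eq0.
Qed.

End GenusZero.

Theorem proposition7p22 (R : realType) (f : {fraction {poly R[i]}})
    (hf : nonsquare f) :
  [/\ semidirect (id_component (normaliser (Jonq R[i]) (torus f)))
        (torus f)
        (id_component (normaliser (Jonq_diag R[i]) (torus f))),
      forall g : nat, sqrt_curve_genus f g ->
        [/\ (1 <= g)%N ->
              id_component (normaliser (Jonq_diag R[i]) (torus f)) = [set 1%g],
            g = 0%N ->
              isomorphic_Gm
                (id_component (normaliser (Jonq_diag R[i]) (torus f))) &
            (1 <= g)%N ->
              id_component (normaliser (Jonq R[i]) (torus f)) = torus f] &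
      semidirect (id_component (normaliser (Jonq R[i]) (torus (rat_y R[i]))))
        (torus (rat_y R[i])) (torus12 R[i])].
Proof.
have two_neq0 : (2%:R : R[i]) != 0 by rewrite pnatr_eq0.
have calc := jel_calculus two_neq0.
have [q [r [q0 ur r0 fE]]] := branch_points hf.
have ty : semidirect (id_component (normaliser (Jonq R[i]) (torus (rat_y R[i]))))
    (torus (rat_y R[i])) (torus12 R[i]).
  rewrite (id_component_y two_neq0).1 (torusE (@nonsquare_y R[i])).
  exact: semidirect_y.
(* At most two roots give genus 0 and a torus conjugate to that of y; three or more give positive
   genus and a finite diagonal part. In each case the genus clauses of the other case hold
   vacuously. *)
have [sr|sr] := leqP (size r) 2.
  have [l [n [l0 nu nf]]] := rational_case two_neq0 q0 ur r0 sr fE.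
  have [sd gm] := rational_torus two_neq0 hf l0 nu nf.
  split=> // g /(genus_zero two_neq0 l0 nu nf) ->.
  by split.
have [s sP] := finite_diag_norm two_neq0 hf q0 ur sr fE.
have [NE DE] := id_component_finite two_neq0 hf sP.
split; last exact: ty.
  rewrite NE DE (torusE hf); exact: semidirect_trivial (torus_subgroup calc hf).
rewrite NE DE (torusE hf) => g /(genus_positive two_neq0 hf q0 ur sr fE) g0; split=> [_|gE|_].
- exact: erefl.
- by rewrite gE in g0.
- exact: erefl.
Qed.
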